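(* Let $v\in L^p([0,\pi])$, $p>1$, be complex-valued. Then, for all sufficiently large $n$, $$\frac{1}{80}\big(|\beta_n^+(z_n^* )|+|\beta_n^-(z_n^* )|\big)\le|\gamma_n|+|\delta_n^{Neu}|\le 19\big(|\beta_n^+(z_n^* )|+|\beta_n^-(z_n^* )|\big),$$ where $z_n^*=\frac12(\lambda_n^++\lambda_n^-)-n^2$.
   Context: Operators. For complex-valued $v\in L^1([0,\pi])$ let $Ly=-y''+v(x)y$ on $[0,\pi]$, with boundary conditions ($bc$): periodic $Per^+$: $y(0)=y(\pi),\ y'(0)=y'(\pi)$; antiperiodic $Per^-$: $y(0)=-y(\pi),\ y'(0)=-y'(\pi)$; Neumann $Neu$: $y'(0)=y'(\pi)=0$. $L_{bc}$ denotes the closed operator in $L^2([0,\pi])$ generated by $L$ on $\{f:\ f' \text{ absolutely continuous},\ f \text{ satisfies } (bc),\ Lf\in L^2([0,\pi])\}$. Eigenvalues. Let $D_n=\{\lambda\in\mathbb{C}:|\lambda-n^2|<n/4\}$. For all sufficiently large $n\in\mathbb{N}$, $D_n$ contains exactly two eigenvalues (counted with algebraic multiplicity) $\lambda_n^-,\lambda_n^+$ of $L_{Per^+}$ if $n$ is even, respectively of $L_{Per^-}$ if $n$ is odd, and exactly one eigenvalue $\nu_n$ of $L_{Neu}$. They are labelled so that $\operatorname{Re}\lambda_n^-<\operatorname{Re}\lambda_n^+$, or $\operatorname{Re}\lambda_n^-=\operatorname{Re}\lambda_n^+$ and $\operatorname{Im}\lambda_n^-\le\operatorname{Im}\lambda_n^+$.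 Set $\gamma_n=\lambda_n^+-\lambda_n^-$ and $\delta_n^{Neu}=\lambda_n^+-\nu_n$. The functionals $\beta_n^\pm$. Let $V(m)=\frac1\pi\int_0^\pi v(x)e^{-imx}dx$, $m\in2\mathbb{Z}$. For sufficiently large $n$ and $|z|<n/4$ define (the series converge absolutely and are analytic in $z$) $$\beta_n^{\pm}(z)=V(\pm2n)+\sum_{k=1}^\infty\ \sum_{j_1,\dots,j_k\in(n+2\mathbb{Z})\setminus\{\pm n\}}\frac{V(\pm n-j_1)V(j_1-j_2)\cdots V(j_{k-1}-j_k)V(j_k\pm n)}{(n^2-j_1^2+z)\cdots(n^2-j_k^2+z)}.$$ These are the off-diagonal entries of the $2\times2$ matrix $\begin{pmatrix}\alpha_n(z)&\beta_n^+(z)\\ \beta_n^-(z)&\alpha_n(z)\end{pmatrix}$ produced by the Lyapunov–Schmidt reduction to $\mathrm{Span}\{e^{inx},e^{-inx}\}$: for large $n$, $\lambda=n^2+z$ with $|z|<n/4$ is a periodic ($n$ even) or antiperiodic ($n$ odd) eigenvalue if and only if $z$ is an eigenvalue of this matrix. *)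

(* Defs.v *)
From mathcomp Require Import all_boot all_order all_algebra.
From mathcomp Require Export complex.
From mathcomp Require Import all_classical all_reals all_analysis.
Import Order.TTheory GRing.Theory Num.Theory numFieldNormedType.Exports.

Set Implicit Arguments.
Unset Strict Implicit.
Unset Printing Implicit Defensive.

Local Open Scope classical_set_scope.
Local Open Scope ring_scope.
Local Open Scope complex_scope.

Section ComplexAnalysis.
Variable R : realType.
Local Notation mu := (@lebesgue_measure R).

Definition cmod (z : R[i]) : R := Normc.normc z.

Definition expi (t : R) : R[i] := cos t +i* sin t.

(* A function on [0, pi] is represented by a function on R, of which only the
   values on [0, pi] matter. *)
Definition I0pi : set R := `[0, pi]%classic.

Definition in_Lp (p : R) (f : R -> R[i]) : Prop :=
  [/\ measurable_fun I0pi (fun x => complex.Re (f x)),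
      measurable_fun I0pi (fun x => complex.Im (f x)) &
      (\int[mu]_(x in I0pi) ((cmod (f x) `^ p)%:E) < +oo)%E].

Definition integral0pi (f : R -> R[i]) : R[i] :=
  Rintegral mu I0pi (fun x => complex.Re (f x)) +i*
  Rintegral mu I0pi (fun x => complex.Im (f x)).

(* Unordered sums, meaningful for absolutely summable families (as for the
   integral, the value is a junk one otherwise). *)
Definition rsum (T : choiceType) (D : set T) (f : T -> R) : R :=
  fine (\esum_(i in D) (Num.max (f i) 0)%:E) -
  fine (\esum_(i in D) (Num.max (- f i) 0)%:E).

Definition csum (T : choiceType) (D : set T) (f : T -> R[i]) : R[i] :=
  rsum D (fun i => complex.Re (f i)) +i* rsum D (fun i => complex.Im (f i)).

(* f'(x) = l, relative to [0, pi]: one-sided at the end points. *)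
Definition has_deriv (f : R -> R[i]) (x : R) (l : R[i]) : Prop :=
  ((complex.Re (f y) - complex.Re (f x)) / (y - x)
     @[y --> within I0pi x^'] --> complex.Re l) /\
  ((complex.Im (f y) - complex.Im (f x)) / (y - x)
     @[y --> within I0pi x^'] --> complex.Im l).

Definition abs_continuous (f : R -> R[i]) : Prop :=
  forall e : R, 0 < e -> exists2 d : R, 0 < d &
    forall (m : nat) (a b : 'I_m -> R),
      (forall i, [/\ 0 <= a i, a i <= b i & b i <= pi]) ->
      trivIset setT (fun i => `]a i, b i[%classic) ->
      \sum_(i < m) (b i - a i) < d ->
      \sum_(i < m) cmod (f (b i) - f (a i)) < e.

End ComplexAnalysis.

Variant bc_kind := PerPlus | PerMinus | Neu.

Section Hill.
Variable R : realType.
Local Notation mu := (@lebesgue_measure R).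

Definition satisfies_bc (bc : bc_kind) (f f1 : R -> R[i]) : Prop :=
  match bc with
  | PerPlus => f 0 = f pi /\ f1 0 = f1 pi
  | PerMinus => f 0 = - f pi /\ f1 0 = - f1 pi
  | Neu => f1 0 = 0 /\ f1 pi = 0
  end.

(* The graph of L_bc: f is in the domain and g = - f'' + v f in L^2; f1 and f2
   are f' and the almost everywhere derivative of f'. *)
Definition hill_op (v : R -> R[i]) (bc : bc_kind) (f g : R -> R[i]) : Prop :=
  exists f1 f2 : R -> R[i],
    [/\ (forall x, I0pi x -> has_deriv f x (f1 x)),
        abs_continuous f1,
        {ae mu, forall x, I0pi x -> has_deriv f1 x (f2 x)},
        satisfies_bc bc f f1 &
        in_Lp 2 g /\ {ae mu, forall x, I0pi x -> g x = - f2 x + v x * f x}].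

(* The kernel of (L_bc - lam)^k. *)
Fixpoint in_ker_pow (v : R -> R[i]) (bc : bc_kind) (lam : R[i]) (k : nat)
    (f : R -> R[i]) : Prop :=
  match k with
  | 0 => forall x, I0pi x -> f x = 0
  | k'.+1 => exists g : R -> R[i],
      hill_op v bc f g /\ in_ker_pow v bc lam k' (fun x => g x - lam * f x)
  end.

Definition root_function (v : R -> R[i]) (bc : bc_kind) (lam : R[i])
    (f : R -> R[i]) : Prop := exists k : nat, in_ker_pow v bc lam k f.

(* lam has algebraic multiplicity m: the root space of lam has a basis of m
   functions. In particular m = 0 iff lam is not an eigenvalue. *)
Definition alg_mult (v : R -> R[i]) (bc : bc_kind) (lam : R[i]) (m : nat) : Prop :=
  exists e : 'I_m -> (R -> R[i]),
    [/\ (forall i, root_function v bc lam (e i)),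
        (forall c : 'I_m -> R[i],
           (forall x, I0pi x -> \sum_(i < m) c i * e i x = 0) ->
           forall i, c i = 0) &
        (forall f, root_function v bc lam f ->
           exists c : 'I_m -> R[i],
             forall x, I0pi x -> f x = \sum_(i < m) c i * e i x)].

Definition in_disc (n : nat) (lam : R[i]) : Prop :=
  cmod (lam - (n ^ 2)%:R) < n%:R / 4.

Definition per_bc (n : nat) : bc_kind := if odd n then PerMinus else PerPlus.

(* lm, lp are the eigenvalues in D_n counted with algebraic multiplicity, that
   is, each lam in D_n has multiplicity [lam = lm] + [lam = lp]; they are
   labelled by the lexicographic order. *)
Definition per_eigenvalues (v : R -> R[i]) (n : nat) (lm lp : R[i]) : Prop :=
  [/\ in_disc n lm, in_disc n lp,
      (forall lam, in_disc n lam ->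
         alg_mult v (per_bc n) lam ((lam == lm) + (lam == lp))%N) &
      complex.Re lm < complex.Re lp \/
      (complex.Re lm = complex.Re lp /\ complex.Im lm <= complex.Im lp)].

Definition neu_eigenvalue (v : R -> R[i]) (n : nat) (nu : R[i]) : Prop :=
  in_disc n nu /\
  (forall lam, in_disc n lam -> alg_mult v Neu lam (lam == nu)).

Definition fourier (v : R -> R[i]) (m : int) : R[i] :=
  (pi^-1)%:C * integral0pi (fun x => v x * expi (- (m%:~R * x))).

(* V(a - j_1) V(j_1 - j_2) ... V(j_k - b) for js = [:: j_1; ...; j_k]. *)
Fixpoint fourier_chain (v : R -> R[i]) (a : int) (js : seq int) (b : int) : R[i] :=
  match js with
  | [::] => fourier v (a - b)
  | j :: js' => fourier v (a - j) * fourier_chain v j js' b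
  end.

(* (n + 2Z) \ {n, -n} *)
Definition beta_index (n : nat) (j : int) : bool :=
  [&& (2 %| j - n%:Z)%Z, j != n%:Z & j != - n%:Z].

(* The common form of beta_n^+ (a = n) and beta_n^- (a = -n). *)
Definition beta (v : R -> R[i]) (n : nat) (a : int) (z : R[i]) : R[i] :=
  fourier v (2 * a) +
  csum [set k : nat | (1 <= k)%N] (fun k =>
    csum [set js : k.-tuple int | all (beta_index n) js] (fun js =>
      fourier_chain v a js (- a) /
      \prod_(j <- js) ((n ^ 2)%:R - (j ^+ 2)%:~R + z))).

Definition beta_plus (v : R -> R[i]) (n : nat) : R[i] -> R[i] := beta v n n%:Z.
Definition beta_minus (v : R -> R[i]) (n : nat) : R[i] -> R[i] := beta v n (- n%:Z).

End Hill.

(* Main.v *)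
Require Import Defs.
From mathcomp Require Import all_boot all_order all_algebra.
From mathcomp Require Import complex.
From mathcomp Require Import all_classical all_reals all_analysis.
From mathcomp Require Import measurable_realfun.
From mathcomp Require Import ring lra zify.
Import Order.TTheory GRing.Theory Num.Theory numFieldNormedType.Exports.

Set Implicit Arguments.
Unset Strict Implicit.
Unset Printing Implicit Defensive.

Local Open Scope classical_set_scope.
Local Open Scope ring_scope.
Local Open Scope complex_scope.

(* Write lambda = n^2 + z and zeta(z) = z - alpha_n(z).  On Fourier coefficients the
   periodic problem becomes a bi-infinite linear system; eliminating all modes but
   e^{inx}, e^{-inx} leaves zeta u = beta^+ w, zeta w = beta^- u, where alpha and
   beta are uniformly small-Lipschitz in z because the sum of 1 / |n^2 - j^2| is
   O(n^{-1/2}).  Hence zeta^2 = beta^+ beta^- at lambda^+ and lambda^-, and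
   zeta^+ - zeta^- is close to gamma.  Subtracting the two equations,
   zeta^+ + zeta^- is O(n^{-1/2}) (|beta^+| + |beta^-|); when lambda^+ = lambda^-
   the same bound comes from a Jordan pair, or all of zeta, beta^+, beta^- vanish.
   A Neumann eigenfunction is y(0) (cos nx + O(1/n)); correcting it by a multiple of
   (x / pi) cos nx makes it (anti)periodic, at the cost of a source whose
   components along e^{inx} and e^{-inx} are almost opposite.  Adding the two
   reduced equations gives 2 zeta(nu) = beta^+ + beta^- up to a relative O(1/n).
   So the sum of beta^+ and beta^- is controlled by delta and zeta^+, their product
   by gamma, and conversely. *)

(** The Fourier coefficients of [v] enter the reduction only through the bound A, the integral of
    |v|; all smallness comes from the l^1 norm of the weights. As [v] is merely integrable, passing
    from the equation to coefficients requires uniformly convergent Fourier series for functions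
    whose second derivative is only integrable. The obstacle is the Neumann side. A priori only |z|
    < n/4 is known, which shifts the phase of cos nx over [0, pi] by an amount that does not shrink
    with n. Explicit numbers are therefore unavoidable: averaging |cos| and bounding pi by 13/4 make
    variation of constants a contraction, so y is controlled by y(0); testing the equation against
    cos nx then gives |z| <= 150 A; only after that does the expansion with error O(1/n) follow. If
    every error term is dropped, the final algebra gives |gamma| + |delta| <= 2 B and B <= 3 |gamma|
    + 4 |delta|. The constants 19 and 80 leave ample room for relative errors of 1/100, which is all
    that is asked of large n. *)

Section Modulus.
Variable R : realType.
Implicit Types (z w : R[i]) (x : R).

Lemma cmodE z : cmod z = Num.sqrt (complex.Re z ^+ 2 + complex.Im z ^+ 2).
Proof. by case: z. Qed.

Lemma cmod_ge0 z : 0 <= cmod z.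
Proof. by rewrite cmodE sqrtr_ge0. Qed.

Lemma cmod0 : cmod (0 : R[i]) = 0. Proof. exact: Normc.normc0. Qed.
Lemma cmodM z w : cmod (z * w) = cmod z * cmod w. Proof. exact: Normc.normcM. Qed.
Lemma cmodV z : cmod z^-1 = (cmod z)^-1. Proof. exact: Normc.normcV. Qed.
Lemma cmodN z : cmod (- z) = cmod z. Proof. exact: normcN. Qed.
Lemma cmodD z w : cmod (z + w) <= cmod z + cmod w. Proof. exact: le_normcD. Qed.
Lemma cmodB z w : cmod (z - w) <= cmod z + cmod w.
Proof. by rewrite -(cmodN w); exact: cmodD. Qed.
Lemma cmodC z w : cmod (z - w) = cmod (w - z).
Proof. by rewrite -cmodN opprB. Qed.
Lemma cmod_triang z w : cmod z <= cmod w + cmod (z - w).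
Proof. by rewrite -{1}(subrK w z) addrC; exact: cmodD. Qed.
Lemma cmod_eq0 z : cmod z = 0 -> z = 0. Proof. exact: Normc.eq0_normc. Qed.
Lemma cmod_gt0 z : z != 0 -> 0 < cmod z.
Proof.
move=> z0; rewrite lt_neqAle cmod_ge0 andbT eq_sym.
by apply: contra z0 => /eqP/cmod_eq0 ->.
Qed.
Lemma cmod_real x : cmod (x%:C) = `|x|.
Proof. by rewrite cmodE /= expr0n addr0 sqrtr_sqr. Qed.
Lemma natrC (n : nat) : (n%:R : R[i]) = (n%:R : R)%:C.
Proof. by rewrite rmorph_nat. Qed.
Lemma intrC (m : int) : (m%:~R : R[i]) = (m%:~R : R)%:C.
Proof. by rewrite rmorph_int. Qed.
Lemma cmod_nat (n : nat) : cmod (n%:R : R[i]) = n%:R.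
Proof. by rewrite natrC cmod_real ger0_norm. Qed.
Lemma cmod_int (m : int) : cmod (m%:~R : R[i]) = `|m%:~R|.
Proof. by rewrite intrC cmod_real. Qed.

Lemma Re_le_cmod z : `|complex.Re z| <= cmod z.
Proof. by rewrite cmodE -sqrtr_sqr ler_wsqrtr // lerDl sqr_ge0. Qed.
Lemma Im_le_cmod z : `|complex.Im z| <= cmod z.
Proof. by rewrite cmodE -sqrtr_sqr ler_wsqrtr // lerDr sqr_ge0. Qed.
Lemma cmod_le_ReIm z : cmod z <= `|complex.Re z| + `|complex.Im z|.
Proof.
rewrite cmodE -(ger0_norm (addr_ge0 (normr_ge0 _) (normr_ge0 _))) -sqrtr_sqr.
rewrite ler_wsqrtr // sqrrD !real_normK ?num_real //.
by rewrite addrAC lerDl mulrn_wge0 // mulr_ge0.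
Qed.

Lemma cmod_sum (I : Type) (s : seq I) (P : pred I) (F : I -> R[i]) :
  cmod (\sum_(i <- s | P i) F i) <= \sum_(i <- s | P i) cmod (F i).
Proof.
elim/big_ind2: _ => [|a b c d h1 h2|//]; first by rewrite cmod0.
exact: le_trans (cmodD _ _) (lerD h1 h2).
Qed.

Lemma cReD z w : complex.Re (z + w) = complex.Re z + complex.Re w.
Proof. by case: z; case: w. Qed.
Lemma cImD z w : complex.Im (z + w) = complex.Im z + complex.Im w.
Proof. by case: z; case: w. Qed.
Lemma cReN z : complex.Re (- z) = - complex.Re z. Proof. by case: z. Qed.
Lemma cImN z : complex.Im (- z) = - complex.Im z. Proof. by case: z. Qed.
Lemma cReM z w : complex.Re (z * w) =
  complex.Re z * complex.Re w - complex.Im z * complex.Im w.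
Proof. by case: z; case: w. Qed.
Lemma cImM z w : complex.Im (z * w) =
  complex.Re z * complex.Im w + complex.Im z * complex.Re w.
Proof. by case: z; case: w. Qed.
Lemma complex_eq z w :
  complex.Re z = complex.Re w -> complex.Im z = complex.Im w -> z = w.
Proof. by case: z; case: w => a b c d /= -> ->. Qed.

End Modulus.

(** * Unordered sums *)

Section UnorderedSums.
Variables (R : realType).

Section Real.
Variable T : choiceType.
Implicit Types (f g : T -> R).

Definition rsummable f := (\esum_(i in setT) `|f i|%:E < +oo)%E.

Lemma esum_fin f : (forall i, 0 <= f i) -> (\esum_(i in setT) (f i)%:E < +oo)%E ->
  (\esum_(i in setT) (f i)%:E)%E \is a fin_num.
Proof. by move=> f0 ?; rewrite ge0_fin_numE // esum_ge0 // => i _; rewrite lee_fin. Qed.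

Lemma esum_lty_le f g : (forall i, f i <= g i) ->
  (\esum_(i in setT) (g i)%:E < +oo)%E -> (\esum_(i in setT) (f i)%:E < +oo)%E.
Proof. by move=> h; apply: le_lt_trans; apply: le_esum => i _; rewrite lee_fin. Qed.

Lemma rsummable_pos f : rsummable f -> (\esum_(i in setT) (Num.max (f i) 0)%:E < +oo)%E.
Proof. by apply: esum_lty_le => i; rewrite ge_max ler_norm normr_ge0. Qed.

Lemma rsummable_neg f : rsummable f -> (\esum_(i in setT) (Num.max (- f i) 0)%:E < +oo)%E.
Proof. by apply: esum_lty_le => i; rewrite ge_max -{1}normrN ler_norm normr_ge0. Qed.

Lemma rsummable_fin f : rsummable f ->
  [/\ (\esum_(i in setT) (Num.max (f i) 0)%:E < +oo)%E,
      (\esum_(i in setT) (Num.max (- f i) 0)%:E < +oo)%E,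
      (\esum_(i in setT) (Num.max (f i) 0)%:E)%E \is a fin_num &
      (\esum_(i in setT) (Num.max (- f i) 0)%:E)%E \is a fin_num].
Proof.
move=> sf; have a := rsummable_pos sf; have b := rsummable_neg sf.
by split=> //; apply: esum_fin => // i; rewrite le_max lexx orbT.
Qed.

(** The positive part of a sum is not the sum of the positive parts, so linearity cannot be read off
    the definition of [rsum]. It becomes easy once any splitting into two nonnegative summable
    families may replace the canonical one. *)
Lemma rsum_diff f g h : (forall i, 0 <= g i) -> (forall i, 0 <= h i) ->
  (\esum_(i in setT) (g i)%:E < +oo)%E -> (\esum_(i in setT) (h i)%:E < +oo)%E ->
  (forall i, f i = g i - h i) ->
  rsum setT f = fine (\esum_(i in setT) (g i)%:E) - fine (\esum_(i in setT) (h i)%:E).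
Proof.
move=> g0 h0 gf hf fE; rewrite /rsum.
have sf : rsummable f.
  apply: (@esum_lty_le _ (fun i => g i + h i)) => [i|].
    by rewrite fE (le_trans (ler_normB _ _)) // !ger0_norm.
  rewrite (eq_esum (b := fun i => (g i)%:E + (h i)%:E)%E) //.
  by rewrite esumD ?lte_add_pinfty // => i _; rewrite lee_fin.
have p0 i : 0 <= Num.max (f i) 0 by rewrite le_max lexx orbT.
have n0 i : 0 <= Num.max (- f i) 0 by rewrite le_max lexx orbT.
have [_ _ Pf Nf] := rsummable_fin sf.
have Gf := esum_fin g0 gf; have Hf := esum_fin h0 hf.
(* Both differences are cleared, so that only sums of nonnegative families remain; these add
   termwise in the extended reals. *)
apply/eqP; rewrite subr_eq addrAC eq_sym subr_eq; apply/eqP.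
rewrite -!fineD //; congr fine.
rewrite -!esumD; try by move=> i _; rewrite lee_fin.
apply: eq_esum => i _; rewrite -!EFinD; congr (_%:E).
rewrite fE; case: (leP (g i - h i) 0) => H; case: (leP (- (g i - h i)) 0) => H'; lra.
Qed.

Lemma rsumD f g : rsummable f -> rsummable g ->
  rsum setT (fun i => f i + g i) = rsum setT f + rsum setT g.
Proof.
move=> sf sg.
have [f1 f2 f3 f4] := rsummable_fin sf; have [g1 g2 g3 g4] := rsummable_fin sg.
have p0 (k : T -> R) i : 0 <= Num.max (k i) 0 by rewrite le_max lexx orbT.
have n0 (k : T -> R) i : 0 <= Num.max (- k i) 0 by rewrite le_max lexx orbT.
rewrite (@rsum_diff _ (fun i => Num.max (f i) 0 + Num.max (g i) 0)
  (fun i => Num.max (- f i) 0 + Num.max (- g i) 0)).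
- rewrite /rsum.
  under eq_esum do rewrite EFinD.
  under [in X in _ - X]eq_esum do rewrite EFinD.
  rewrite !esumD; try by move=> i _; rewrite lee_fin.
  by rewrite !fineD //; ring.
- by move=> i; rewrite addr_ge0.
- by move=> i; rewrite addr_ge0.
- under eq_esum do rewrite EFinD.
  rewrite esumD ?lte_add_pinfty // => i _; by rewrite lee_fin.
- under eq_esum do rewrite EFinD.
  rewrite esumD ?lte_add_pinfty // => i _; by rewrite lee_fin.
- move=> i; case: (leP (f i) 0) => H; case: (leP (- f i) 0) => H';
  case: (leP (g i) 0) => K; case: (leP (- g i) 0) => K'; lra.
Qed.

Lemma rsumN f : rsum setT (fun i => - f i) = - rsum setT f.
Proof. by rewrite /rsum; under [X in _ - fine X]eq_esum do rewrite opprK; rewrite opprB. Qed.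

(** Finite partial sums give the inequality [<=] for every factor; the converse is the same
    inequality for the factor [c^-1] and the family [c * f]. *)
Lemma esumZl (c : R) f : 0 <= c -> (forall i, 0 <= f i) ->
  (\esum_(i in setT) (f i)%:E < +oo)%E ->
  (\esum_(i in setT) (c * f i)%:E = c%:E * \esum_(i in setT) (f i)%:E)%E.
Proof.
move=> c0 f0 sf.
have le (d : R) (g : T -> R) : 0 <= d -> (forall i, 0 <= g i) ->
  (\esum_(i in setT) (d * g i)%:E <= d%:E * \esum_(i in setT) (g i)%:E)%E.
  move=> d0 g0; apply: ge_ereal_sup => _ [X [finX XI] <-].
  rewrite (eq_fsbigr (fun i => (d%:E * (g i)%:E)%E)) //.
  rewrite -ge0_mule_fsumr; last by move=> i; rewrite lee_fin.
  by rewrite lee_wpmul2l // ?lee_fin //; apply: ereal_sup_ubound; exists X.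
apply/eqP; rewrite eq_le le //=.
have [->|cn0] := eqVneq c 0.
  by rewrite mul0e esum_ge0 // => i _; rewrite mul0r.
have cp : 0 < c by rewrite lt_neqAle eq_sym cn0.
have H := @le c^-1 (fun i => c * f i).
rewrite (eq_esum (b := fun i => (f i)%:E)) in H; last first.
  by move=> i _; rewrite mulKf.
rewrite -lee_pdivlMl // H ?invr_ge0 // => i; exact: mulr_ge0.
Qed.

Lemma rsummableZ c f : rsummable f -> rsummable (fun i => c * f i).
Proof.
move=> sf; rewrite /rsummable; under eq_esum do rewrite normrM.
rewrite esumZl //; exact: lte_mul_pinfty.
Qed.

Lemma rsumZ c f : rsummable f -> rsum setT (fun i => c * f i) = c * rsum setT f.
Proof.
have p0 (k : T -> R) i : 0 <= Num.max (k i) 0 by rewrite le_max lexx orbT.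
have n0 (k : T -> R) i : 0 <= Num.max (- k i) 0 by rewrite le_max lexx orbT.
wlog c0 : c / 0 <= c.
  move=> H sf; have [/H->//|/ltW c0] := leP 0 c.
  have := H (- c); rewrite oppr_ge0 => /(_ c0 sf) E.
  by apply: oppr_inj; rewrite -mulNr -E -rsumN; congr rsum; apply/funext => i; rewrite mulNr.
move=> sf; have [f1 f2 f3 f4] := rsummable_fin sf.
rewrite (@rsum_diff _ (fun i => c * Num.max (f i) 0) (fun i => c * Num.max (- f i) 0)).
- by rewrite !esumZl // /rsum mulrBr !fineM.
- by move=> i; rewrite mulr_ge0.
- by move=> i; rewrite mulr_ge0.
- by rewrite esumZl // lte_mul_pinfty.
- by rewrite esumZl // lte_mul_pinfty.
- move=> i; rewrite -mulrBr; congr (_ * _).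
  case: (leP (f i) 0) => H; case: (leP (- f i) 0) => H'; lra.
Qed.

Lemma rsum_le f K : rsummable f -> (\esum_(i in setT) `|f i|%:E <= K%:E)%E ->
  `|rsum setT f| <= K.
Proof.
move=> sf hK; have [f1 f2 f3 f4] := rsummable_fin sf.
rewrite /rsum; apply: le_trans (ler_normB _ _) _.
have p0 (k : T -> R) : (0 <= \esum_(i in setT) (Num.max (k i) 0)%:E)%E.
  by apply: esum_ge0 => i _; rewrite lee_fin le_max lexx orbT.
rewrite !ger0_norm ?fine_ge0 // -lee_fin EFinD !fineK //.
rewrite -esumD; try by move=> i _; rewrite lee_fin le_max lexx orbT.
apply: le_trans hK; apply: le_esum => i _; rewrite -EFinD lee_fin.
by case: (leP (f i) 0) => H; case: (leP (- f i) 0) => H';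
  case: (ler0P (f i)) => K'; lra.
Qed.

Lemma esum_ge_term f i : (forall i, 0 <= f i) -> ((f i)%:E <= \esum_(i in setT) (f i)%:E)%E.
Proof.
move=> f0; apply: esum_ge; exists [set i]; first by split => //; exact: finite_set1.
by rewrite fsbig_set1.
Qed.

End Real.

Lemma esum_pair (T1 T2 : choiceType) (f : T1 * T2 -> R) : (forall i, 0 <= f i) ->
  (\esum_(k in setT) (f k)%:E =
   \esum_(i in setT) \esum_(j in setT) (f (i, j))%:E)%E.
Proof.
move=> f0; rewrite (esum_esum (J := fun=> setT)).
  rewrite (_ : _ `*`` _ = setT); last by apply/seteqP; split.
  by apply: eq_esum => -[].
by move=> i j _ _; rewrite lee_fin.
Qed.

Lemma esum_pair_fin (T1 T2 : choiceType) (f : T1 * T2 -> R) : (forall i, 0 <= f i) ->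
  (\esum_(k in setT) (f k)%:E < +oo)%E ->
  (forall i, (\esum_(j in setT) (f (i, j))%:E < +oo)%E) /\
  (\esum_(k in setT) (f k)%:E =
   \esum_(i in setT) (fine (\esum_(j in setT) (f (i, j))%:E))%:E)%E.
Proof.
move=> f0; rewrite esum_pair // => sf.
have fin i : (\esum_(j in setT) (f (i, j))%:E < +oo)%E.
  apply: le_lt_trans sf; apply: esum_ge; exists [set i].
    by split => //; exact: finite_set1.
  by rewrite fsbig_set1.
by split=> //; apply: eq_esum => i _; rewrite fineK // esum_fin.
Qed.

Lemma rsum_pair (T1 T2 : choiceType) (f : T1 * T2 -> R) : rsummable f ->
  rsum setT f = rsum setT (fun i => rsum setT (fun j => f (i, j))).
Proof.
move=> sf; have [f1 f2 f3 f4] := rsummable_fin sf.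
have p0 (k : T1 * T2 -> R) i : 0 <= Num.max (k i) 0 by rewrite le_max lexx orbT.
have [h1 h2] := esum_pair_fin (p0 f) f1.
have [h3 h4] := esum_pair_fin (p0 (fun x => - f x)) f2.
rewrite [RHS](@rsum_diff _ _ (fun i => fine (\esum_(j in setT) (Num.max (f (i, j)) 0)%:E))
  (fun i => fine (\esum_(j in setT) (Num.max (- f (i, j)) 0)%:E))).
- by rewrite -h2 -h4.
- by move=> i; apply: fine_ge0; apply: esum_ge0 => j _; rewrite lee_fin le_max lexx orbT.
- by move=> i; apply: fine_ge0; apply: esum_ge0 => j _; rewrite lee_fin le_max lexx orbT.
- by rewrite -h2.
- by rewrite -h4.
- by [].
Qed.

Lemma rsum_reindex (T1 T2 : choiceType) (D : set T2) (e : T1 -> T2) (f : T2 -> R) :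
  set_bij setT D e -> rsum D f = rsum setT (fun i => f (e i)).
Proof. by move=> be; rewrite /rsum !(reindex_esum setT D e). Qed.

Section Complex.
Variable T : choiceType.
Implicit Types (f g : T -> R[i]).

(* An inductive wrapper rather than a plain definition: it keeps unification
   from unfolding the sums. *)
Variant csummable f : Prop :=
  CSummable of (\esum_(i in setT) (cmod (f i))%:E < +oo)%E.

Lemma csummable_lty f : csummable f -> (\esum_(i in setT) (cmod (f i))%:E < +oo)%E.
Proof. by case. Qed.

Lemma csummable_le f (K : R) : (\esum_(i in setT) (cmod (f i))%:E <= K%:E)%E -> csummable f.
Proof. by move=> h; split; apply: le_lt_trans h _; rewrite ltry. Qed.

Lemma csummable_re f : csummable f -> rsummable (fun i => complex.Re (f i)).
Proof. by move=> /csummable_lty; apply: esum_lty_le => i; exact: Re_le_cmod. Qed.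

Lemma csummable_im f : csummable f -> rsummable (fun i => complex.Im (f i)).
Proof. by move=> /csummable_lty; apply: esum_lty_le => i; exact: Im_le_cmod. Qed.

Lemma eq_csum f g : f =1 g -> csum setT f = csum setT g.
Proof. by move=> /funext ->. Qed.

Lemma csummableW f (g : T -> R) : (forall i, cmod (f i) <= g i) ->
  (\esum_(i in setT) (g i)%:E < +oo)%E -> csummable f.
Proof. by move=> h1 h2; split; exact: esum_lty_le h2. Qed.

Lemma csumD f g : csummable f -> csummable g ->
  csum setT (fun i => f i + g i) = csum setT f + csum setT g.
Proof.
move=> sf sg; apply: complex_eq; rewrite ?cReD ?cImD /=.
- rewrite -rsumD; [|exact: csummable_re..].
  by congr rsum; apply/funext => i; rewrite cReD.
- rewrite -rsumD; [|exact: csummable_im..].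
  by congr rsum; apply/funext => i; rewrite cImD.
Qed.

Lemma csumZ c f : csummable f -> csum setT (fun i => c * f i) = c * csum setT f.
Proof.
move=> sf; have sr := csummable_re sf; have si := csummable_im sf.
apply: complex_eq; rewrite ?cReM ?cImM /=.
- have -> : (fun i => complex.Re (c * f i)) =
    (fun i => complex.Re c * complex.Re (f i) + (- complex.Im c) * complex.Im (f i)).
    by apply/funext => i; rewrite cReM mulNr.
  rewrite rsumD; [|exact: rsummableZ..].
  by rewrite (rsumZ _ sr) (rsumZ _ si) mulNr.
- have -> : (fun i => complex.Im (c * f i)) =
    (fun i => complex.Re c * complex.Im (f i) + complex.Im c * complex.Re (f i)).
    by apply/funext => i; rewrite cImM.
  rewrite rsumD; [|exact: rsummableZ..].
  by rewrite (rsumZ _ sr) (rsumZ _ si).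
Qed.

Lemma csummableD f g : csummable f -> csummable g -> csummable (fun i => f i + g i).
Proof.
move=> /csummable_lty sf /csummable_lty sg.
apply: (@csummableW _ (fun i => cmod (f i) + cmod (g i))) => [i|].
  exact: cmodD.
under eq_esum do rewrite EFinD.
by rewrite esumD ?lte_add_pinfty // => i _; rewrite lee_fin cmod_ge0.
Qed.

Lemma csummableZ c f : csummable f -> csummable (fun i => c * f i).
Proof.
move=> /csummable_lty sf; split; under eq_esum do rewrite cmodM.
have f0 i : 0 <= cmod (f i) by exact: cmod_ge0.
by rewrite esumZl ?cmod_ge0 // lte_mul_pinfty ?lee_fin ?cmod_ge0 // esum_fin.
Qed.

Lemma csumN f : csum setT (fun i => - f i) = - csum setT f.
Proof.
apply: complex_eq; rewrite ?cReN ?cImN /= -rsumN; congr rsum; apply/funext => i;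
by rewrite ?cReN ?cImN.
Qed.

Lemma csummableN f : csummable f -> csummable (fun i => - f i).
Proof. by move=> /csummable_lty; apply: csummableW => i; rewrite cmodN. Qed.

Lemma csumB f g : csummable f -> csummable g ->
  csum setT (fun i => f i - g i) = csum setT f - csum setT g.
Proof. by move=> sf sg; rewrite csumD ?csumN //; exact: csummableN. Qed.

Lemma csummableB f g : csummable f -> csummable g -> csummable (fun i => f i - g i).
Proof. by move=> sf sg; apply: csummableD => //; exact: csummableN. Qed.

Lemma csummableM f g (K : R) : (forall i, cmod (f i) <= K) -> csummable g ->
  csummable (fun i => f i * g i).
Proof.
move=> fK /csummable_lty sg; apply: (@csummableW _ (fun i => `|K| * cmod (g i))) => [i|].
  by rewrite cmodM ler_wpM2r ?cmod_ge0 // (le_trans (fK i)) // ler_norm.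
have g0 i : 0 <= cmod (g i) by exact: cmod_ge0.
by rewrite esumZl // lte_mul_pinfty ?lee_fin // esum_fin.
Qed.

(** Estimating real and imaginary parts separately would cost a constant. With w the sum,
    multiplication by the conjugate of w turns |w|^2 into the real part of a sum, to which the real
    estimate applies without loss. *)
Lemma csum_le f (K : R) : (\esum_(i in setT) (cmod (f i))%:E <= K%:E)%E ->
  cmod (csum setT f) <= K.
Proof.
move=> hK; have sf : csummable f by exact: csummable_le hK.
have [->|w0] := eqVneq (csum setT f) 0.
  by rewrite cmod0 -lee_fin; apply: le_trans hK; apply: esum_ge0 => i _; rewrite lee_fin cmod_ge0.
set w := csum setT f in w0 *.
have wp := cmod_gt0 w0.
rewrite -(ler_pM2l wp).
have -> : cmod w * cmod w = complex.Re (csum setT (fun i => conjc w * f i)).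
  rewrite csumZ // -/w cmodE -expr2 sqr_sqrtr ?addr_ge0 ?sqr_ge0 //.
  by case: (w) => a b /=; ring.
have scf := csummableZ (conjc w) sf.
apply: le_trans (ler_norm _) _; apply: rsum_le; first exact: csummable_re.
apply: (@le_trans _ _ (\esum_(i in setT) (cmod w * cmod (f i))%:E)%E).
  apply: le_esum => i _; rewrite lee_fin; apply: le_trans (Re_le_cmod _) _.
  rewrite cmodM; suff -> : cmod (conjc w) = cmod w by [].
  by case: (w) => a b; rewrite !cmodE /= sqrrN.
rewrite esumZl ?(ltW wp) //; [|by move=> i; exact: cmod_ge0|exact: csummable_lty].
by rewrite EFinM lee_wpmul2l // lee_fin ltW.
Qed.

End Complex.

Lemma csum_pair (T1 T2 : choiceType) (f : T1 * T2 -> R[i]) : csummable f ->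
  csum setT f = csum setT (fun i => csum setT (fun j => f (i, j))).
Proof.
move=> sf; apply: complex_eq => /=.
  by rewrite rsum_pair //; exact: csummable_re.
by rewrite rsum_pair //; exact: csummable_im.
Qed.

Lemma csum_reindex (T1 T2 : choiceType) (D : set T2) (e : T1 -> T2) (f : T2 -> R[i]) :
  set_bij setT D e -> csum D f = csum setT (fun i => f (e i)).
Proof. by move=> be; rewrite /csum !(rsum_reindex _ be). Qed.

Lemma csum_swap (T1 T2 : choiceType) (f : T1 -> T2 -> R[i]) :
  (\esum_(i in setT) \esum_(j in setT) (cmod (f i j))%:E < +oo)%E ->
  csum setT (fun i => csum setT (fun j => f i j)) =
  csum setT (fun j => csum setT (fun i => f i j)).
Proof.
move=> sf.
have bs : set_bij setT setT (fun p : T2 * T1 => (p.2, p.1)).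
  split=> //; first by move=> [a b] [c d] _ _ [-> ->].
  by move=> [a b] _; exists (b, a).
have s1 : csummable (fun p => f p.1 p.2).
  by split; rewrite esum_pair // => i; exact: cmod_ge0.
rewrite -(csum_pair s1) (csum_reindex _ bs).
rewrite (@csum_pair _ _ (fun p => f p.2 p.1)) //.
by split; have := csummable_lty s1; rewrite (reindex_esum setT setT _ _ bs).
Qed.

Lemma csum_mkcond (T : choiceType) (D : set T) (f : T -> R[i]) :
  csum D f = csum setT (fun i => if i \in D then f i else 0).
Proof.
have H (g : R[i] -> R) : g 0 = 0 ->
  rsum D (fun i => g (f i)) = rsum setT (fun i => g (if i \in D then f i else 0)).
  move=> g0; rewrite /rsum !(esum_mkcond D); congr (fine _ - fine _);
  by apply: eq_esum => i _; case: ifP => // _; rewrite g0 ?oppr0 maxxx.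
by rewrite /csum !H.
Qed.

End UnorderedSums.

(** * Geometric series, reindexing of sums, and absorption by contraction *)

Section SumTools.
Variables (R : realType).

Lemma csum_set1 (T : choiceType) (a : T) (f : T -> R[i]) : csum [set a] f = f a.
Proof.
have H x : rsum [set a] x = x a.
  rewrite /rsum !esum_set1 ?lee_fin ?le_max ?lexx ?orbT //=.
  by case: (leP (x a) 0) => h; case: (leP (- x a) 0) => h'; lra.
by rewrite /csum !H; case: (f a).
Qed.

Lemma mem_set1 (T : choiceType) (a i : T) : (i \in [set a]) = (i == a).
Proof. by apply/idP/eqP; rewrite inE. Qed.

Lemma csum_delta (T : choiceType) (a : T) (x : R[i]) :
  csum setT (fun i => if i == a then x else 0) = x.
Proof.
rewrite -[RHS](csum_set1 a (fun=> x)) [RHS]csum_mkcond; apply: eq_csum => i.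
by rewrite mem_set1.
Qed.

Lemma csummable_delta (T : choiceType) (a : T) (x : R[i]) :
  csummable (fun i => if i == a then x else 0).
Proof.
split; rewrite (eq_esum (b := fun i => if i \in [set a] then (cmod x)%:E else 0%E)).
  by rewrite -esum_mkcond esum_set1 ?lee_fin ?cmod_ge0 // ltry.
by move=> i _; rewrite mem_set1; case: ifP => //; rewrite cmod0.
Qed.

Lemma esum_nat_le (f : nat -> R) (K : R) : (forall i, 0 <= f i) ->
  (forall n, \sum_(0 <= i < n) f i <= K) -> (\esum_(i in setT) (f i)%:E <= K%:E)%E.
Proof.
move=> f0 fK; rewrite -nneseries_esumT; last by move=> i; rewrite lee_fin.
apply: lime_le; first by apply: is_cvg_nneseries => i _ _; rewrite lee_fin.
by apply: nearW => n; rewrite sumEFin lee_fin.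
Qed.

Lemma sum_geom_le (q : R) n : 0 <= q -> q <= 1 / 2 -> \sum_(0 <= i < n) q ^+ i <= 2.
Proof.
(* The sharper bound is inductive: the step amounts to 2 q^(n+1) <= q^n, that is to q <= 1/2. *)
move=> q0 q1; suff H : \sum_(0 <= i < n) q ^+ i <= 2 - 2 * q ^+ n.
  by apply: le_trans H _; rewrite gerBl mulr_ge0 ?exprn_ge0.
have qn k : 0 <= q ^+ k <= 1.
  by rewrite exprn_ge0 //= exprn_ile1 //; lra.
elim: n => [|n IH]; first by rewrite big_nil expr0; lra.
rewrite big_nat_recr //= exprS.
have /andP[h1 h2] := qn n; nra.
Qed.

Lemma esum_geom_le (C q : R) : 0 <= C -> 0 <= q -> q <= 1 / 2 ->
  (\esum_(k in [set: nat]) (C * q ^+ k)%:E <= (C * 2)%:E)%E.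
Proof.
move=> C0 q0 q1; apply: esum_nat_le => [i|n].
  by rewrite mulr_ge0 // exprn_ge0.
by rewrite -mulr_sumr ler_wpM2l // sum_geom_le.
Qed.

Lemma csum_nat_recl (f : nat -> R[i]) : csummable f ->
  csum setT f = f 0%N + csum setT (fun k => f k.+1).
Proof.
move=> sf.
have bij : set_bij setT [set k : nat | (1 <= k)%N] succn.
  split=> [k _ //|k l _ _ [] //|[//|k] _]; by exists k.
have -> : csum setT (fun k => f k.+1) = csum [set k : nat | (1 <= k)%N] f.
  by rewrite /csum /rsum !(reindex_esum setT [set k : nat | (1 <= k)%N] succn).
rewrite -[f 0%N in RHS](csum_delta 0%N) [X in _ = _ + X]csum_mkcond -csumD.
- apply: eq_csum => -[|k] /=; first by rewrite memNset ?addr0.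
  by rewrite mem_set ?add0r.
- exact: csummable_delta.
- apply: csummableW (csummable_lty sf) => -[|k]; first by rewrite memNset // cmod0 cmod_ge0.
  by rewrite mem_set.
Qed.

Lemma tuple_cons_bij (T : choiceType) k :
  set_bij setT setT (fun p : T * k.-tuple T => [tuple of p.1 :: p.2]).
Proof.
split=> //; first by move=> [a s] [b t] _ _ [] /= -> /val_inj ->.
move=> t _; exists (thead t, [tuple of behead t]) => //=.
by rewrite -tuple_eta.
Qed.

(** If every upper bound S improves to q S + K, then so does the least one, and it can be absorbed.
    The crude bound B serves to make the supremum finite and leaves no trace in the conclusion. *)
Lemma sup_contraction (T : Type) (f : T -> R) (B K q : R) :
  0 <= q -> q < 1 -> (forall a, 0 <= f a <= B) ->
  (forall S, (forall a, f a <= S) -> forall a, f a <= q * S + K) ->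
  forall a, f a * (1 - q) <= K.
Proof.
move=> q0 q1 fB H a.
pose E := [set f x | x in setT].
have hE : has_sup E.
  by split; [exists (f a), a | exists B => _ [x _ <-]; have /andP[] := fB x].
have fS x : f x <= sup E by apply: ub_le_sup; [case: hE|exists x].
have S1 : sup E <= q * sup E + K.
  by apply: ge_sup; [case: hE| move=> _ [x _ <-]; exact: H].
have Sa : f a * (1 - q) <= sup E * (1 - q) by rewrite ler_wpM2r // subr_ge0 ltW.
apply: le_trans Sa _; lra.
Qed.

Lemma csumZE (T : choiceType) (c : R[i]) (f g : T -> R[i]) : csummable f ->
  (forall i, g i = c * f i) -> csum setT g = c * csum setT f.
Proof. by move=> sf gE; rewrite (eq_csum gE) csumZ. Qed.

Lemma csumDE (T : choiceType) (f g h : T -> R[i]) : csummable f -> csummable g ->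
  (forall i, h i = f i + g i) -> csum setT h = csum setT f + csum setT g.
Proof. by move=> sf sg hE; rewrite (eq_csum hE) csumD. Qed.

Lemma csumBE (T : choiceType) (f g h : T -> R[i]) : csummable f -> csummable g ->
  (forall i, h i = f i - g i) -> csum setT h = csum setT f - csum setT g.
Proof. by move=> sf sg hE; rewrite (eq_csum hE) csumB. Qed.

Lemma cmod_csumD_le (T : choiceType) (D f : T -> R[i]) (e K : R) : 0 <= K ->
  (\esum_(j in setT) (cmod (D j))%:E <= e%:E)%E -> (forall j, cmod (f j) <= K) ->
  cmod (csum setT (fun j => D j * f j)) <= e * K.
Proof.
move=> K0 De fK; apply: csum_le.
apply: (@le_trans _ _ (\esum_(j in setT) (K * cmod (D j))%:E)%E).
  apply: le_esum => j _; rewrite lee_fin cmodM mulrC.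
  by rewrite ler_wpM2r // cmod_ge0.
have D0 j : 0 <= cmod (D j) by exact: cmod_ge0.
rewrite esumZl //; last by apply: le_lt_trans De _; rewrite ltry.
by rewrite EFinM muleC lee_wpmul2r // lee_fin.
Qed.

Lemma csummableMr (T : choiceType) (D f : T -> R[i]) (K : R) :
  csummable D -> (forall j, cmod (f j) <= K) -> csummable (fun j => D j * f j).
Proof.
move=> sD fK; rewrite (_ : (fun j => _) = (fun j => f j * D j)).
  exact: csummableM fK sD.
by apply/funext => j; rewrite mulrC.
Qed.

End SumTools.

Local Opaque csum.

(** * The resolvent series *)

Section Resolvent.
Variables (R : realType) (V : int -> R[i]) (C : R).
Hypothesis VC : forall m, cmod (V m) <= C.

(** The weights carry both the denominators and, by vanishing off the admissible indices, the
    restriction on the indices. All sums can then run over all tuples of integers. *)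
Fixpoint wchain (D : int -> R[i]) (a : int) (js : seq int) (b : int) : R[i] :=
  match js with
  | [::] => V (a - b)
  | j :: js' => D j * (V (a - j) * wchain D j js' b)
  end.

Definition chainsum D (b : int) (k : nat) (a : int) : R[i] :=
  csum setT (fun js : k.-tuple int => wchain D a js b).

(** Entry (a, b) of the Neumann series V + V D V + V D V D V + ..., where V is the matrix with
    entries V(i - j) and D is diagonal; formally it is (1 - V D)^(-1) V. *)
Definition resolvent D (b a : int) : R[i] := csum setT (fun k => chainsum D b k a).

Let C0 : 0 <= C. Proof. exact: le_trans (cmod_ge0 _) (VC 0). Qed.

Section OneWeight.
Variables (D : int -> R[i]) (e : R).
Hypothesis De : (\esum_(j in setT) (cmod (D j))%:E <= e%:E)%E.
Hypothesis Ce : C * e <= 1 / 2.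
Let q := C * e.

Let e0 : 0 <= e.
Proof. by rewrite -lee_fin; apply: le_trans De; apply: esum_ge0 => j _; rewrite lee_fin cmod_ge0. Qed.
Let q0 : 0 <= q. Proof. exact: mulr_ge0. Qed.
Let sD : csummable D. Proof. exact: csummable_le De. Qed.
Let sDl : (\esum_(j in setT) (cmod (D j))%:E < +oo)%E. Proof. exact: csummable_lty. Qed.

(** Each additional index contributes the sup norm of V times the l^1 norm of D, which is at most
    [q <= 1 / 2]. *)
Lemma wchain_abs b k a :
  (\esum_(js in [set: k.-tuple int]) (cmod (wchain D a js b))%:E <= (C * q ^+ k)%:E)%E.
Proof.
elim: k a => [|k IH] a.
  rewrite (_ : [set: 0.-tuple int] = [set [tuple]]); last first.
    by apply/seteqP; split => t //= _; exact: tuple0.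
  rewrite esum_set1 ?lee_fin ?cmod_ge0 // expr0 mulr1; exact: VC.
rewrite (reindex_esum setT setT _ _ (@tuple_cons_bij int k)) /=.
have p0 (p : int * k.-tuple int) : 0 <= cmod (D p.1 * (V (a - p.1) * wchain D p.1 p.2 b)).
  exact: cmod_ge0.
rewrite (esum_pair p0) /=.
apply: (@le_trans _ _ (\esum_(j in setT) ((C * (C * q ^+ k)) * cmod (D j))%:E)%E).
  apply: le_esum => j _; under eq_esum do rewrite mulrA cmodM.
  have w0 (i : k.-tuple int) : 0 <= cmod (wchain D j i b) by exact: cmod_ge0.
  rewrite esumZl ?cmod_ge0 //; last by apply: le_lt_trans (IH j) _; rewrite ltry.
  apply: (@le_trans _ _ ((cmod (D j) * C)%:E * (C * q ^+ k)%:E)%E).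
    apply: lee_pmul => //; rewrite ?lee_fin ?cmod_ge0 //.
      by apply: esum_ge0 => i _; rewrite lee_fin.
    by rewrite cmodM ler_wpM2l ?cmod_ge0.
  by rewrite -EFinM lee_fin; lra.
have D0 j : 0 <= cmod (D j) by exact: cmod_ge0.
rewrite esumZl //; last first.
  by rewrite !mulr_ge0 ?exprn_ge0.
rewrite exprS (_ : C * (q * _) = (C * (C * q ^+ k)) * e); last by rewrite /q; ring.
by rewrite [leRHS]EFinM lee_wpmul2l // lee_fin !mulr_ge0 ?exprn_ge0.
Qed.

Lemma wchain_summable b k a : csummable (fun js : k.-tuple int => wchain D a js b).
Proof. exact: csummable_le (wchain_abs b k a). Qed.

Lemma chainsum_bound b k a : cmod (chainsum D b k a) <= C * q ^+ k.
Proof. exact: csum_le (wchain_abs b k a). Qed.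

Lemma chainsum_summable b a : csummable (fun k => chainsum D b k a).
Proof.
apply: csummableW (chainsum_bound b ^~ a) _.
by apply: le_lt_trans (esum_geom_le C0 q0 Ce) _; rewrite ltry.
Qed.

Lemma chainsum_abs b a : (\esum_(k in setT) (cmod (chainsum D b k a))%:E <= (2 * C)%:E)%E.
Proof.
rewrite mulrC; apply: le_trans (esum_geom_le C0 q0 Ce).
by apply: le_esum => k _; rewrite lee_fin chainsum_bound.
Qed.

Lemma resolvent_bound b a : cmod (resolvent D b a) <= 2 * C.
Proof. exact: csum_le (chainsum_abs b a). Qed.

Lemma chainsum0 b a : chainsum D b 0 a = V (a - b).
Proof.
rewrite /chainsum (_ : [set: 0.-tuple int] = [set [tuple]]) ?csum_set1 //.
by apply/seteqP; split => t //= _; exact: tuple0.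
Qed.

Lemma chainsumS b k a :
  chainsum D b k.+1 a = csum setT (fun j => D j * (V (a - j) * chainsum D b k j)).
Proof.
rewrite /chainsum (csum_reindex _ (@tuple_cons_bij int k)) csum_pair /=; last first.
  split; have := csummable_lty (wchain_summable b k.+1 a).
  by rewrite (reindex_esum setT setT _ _ (@tuple_cons_bij int k)).
apply: eq_csum => j.
rewrite -!csumZ //; first exact: csummableZ (wchain_summable b k j).
exact: wchain_summable.
Qed.

(** Splitting off the first index of a chain gives the fixed point equation U = V + V D U.
    Everything below uses this equation and the uniform bound, no longer the series. *)
Lemma resolventE b a :
  resolvent D b a = V (a - b) + csum setT (fun j => D j * (V (a - j) * resolvent D b j)).
Proof.
rewrite /resolvent csum_nat_recl ?chainsum0; last exact: chainsum_summable.
congr (_ + _).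
transitivity (csum setT (fun k => csum setT (fun j => D j * (V (a - j) * chainsum D b k j)))).
  by apply: eq_csum => k; rewrite chainsumS.
rewrite csum_swap.
  apply: eq_csum => j; rewrite -!csumZ //; last exact: chainsum_summable.
  by apply: csummableZ; exact: chainsum_summable.
apply: (@le_lt_trans _ _ (\esum_(k in [set: nat]) ((e * C * C) * q ^+ k)%:E)%E).
  apply: le_esum => k _.
  apply: (@le_trans _ _ (\esum_(j in setT) ((C * (C * q ^+ k)) * cmod (D j))%:E)%E).
    apply: le_esum => j _; rewrite lee_fin !cmodM mulrC.
    by rewrite ler_wpM2r ?cmod_ge0 // ler_pM ?cmod_ge0 ?chainsum_bound.
  have D0 j : 0 <= cmod (D j) by exact: cmod_ge0.
  have K0 : 0 <= C * (C * q ^+ k) by rewrite !mulr_ge0 ?exprn_ge0.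
  rewrite esumZl // (_ : e * C * C * q ^+ k = C * (C * q ^+ k) * e); last by ring.
  by rewrite [leRHS]EFinM lee_wpmul2l // lee_fin.
have K0 : 0 <= e * C * C by rewrite !mulr_ge0.
by apply: le_lt_trans (esum_geom_le K0 q0 Ce) _; rewrite ltry.
Qed.

Lemma Dresolvent_summable b a : csummable (fun j => D j * (V (a - j) * resolvent D b j)).
Proof.
apply: (@csummableMr _ _ _ _ (C * (2 * C))) => // j.
by rewrite cmodM ler_pM ?cmod_ge0 ?resolvent_bound.
Qed.

Hypothesis Deven : forall j, D (- j) = D j.

Lemma opp_bij : set_bij setT setT (fun j : int => - j).
Proof. by split=> // [i j _ _ /oppr_inj //|j _]; exists (- j) => //; rewrite opprK. Qed.

(* Reversing a chain of indices and changing their signs exchanges the roles of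
   the two end points; at the level of the fixed point equations this says
   that the row and the column resolvents agree. *)
Lemma resolvent_sym a b : resolvent D b a = resolvent D (- a) (- b).
Proof.
have [X XD] : exists X : int -> R[i], forall j, X j = resolvent D (- a) (- j) by exists (fun j => resolvent D (- a) (- j)).
have XB j : cmod (X j) <= 2 * C by rewrite XD; exact: resolvent_bound.
have UB j : cmod (resolvent D b j) <= 2 * C by exact: resolvent_bound.
have XE m : X m = V (a - m) + csum setT (fun j => D j * (V (j - m) * X j)).
  rewrite XD resolventE (_ : - m - - a = a - m); last by rewrite opprK addrC.
  apply: (congr1 (fun x => V (a - m) + x)).
  rewrite (csum_reindex (fun j => D j * (V (- m - j) * resolvent D (- a) j)) opp_bij).
  by apply: eq_csum => j; rewrite Deven opprK (addrC (- m)) XD.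
have CC0 : 0 <= C * (2 * C) by rewrite !mulr_ge0.
have sXV m : csummable (fun j => D j * (V (j - m) * X j)).
  apply: (@csummableMr _ _ _ _ (C * (2 * C))) => // j.
  by rewrite cmodM ler_pM ?cmod_ge0.
have sXU : csummable (fun j => D j * (X j * resolvent D b j)).
  apply: (@csummableMr _ _ _ _ (2 * C * (2 * C))) => // j.
  by rewrite cmodM ler_pM ?cmod_ge0.
suff E : csum setT (fun j => D j * (V (a - j) * resolvent D b j)) =
    csum setT (fun j => D j * (V (j - b) * X j)).
  by rewrite resolventE E -XE XD.
(* The double sum of X D V D U is evaluated in both orders. Summing over i uses the equation of U,
   summing over j that of X; the common term, the sum of D X U, then cancels from the comparison. *)
pose I2 j i := D j * (X j * (D i * (V (j - i) * resolvent D b i))).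
have I2E j : csum setT (I2 j) = D j * (X j * (resolvent D b j - V (j - b))).
  rewrite mulrA [resolvent D b j in RHS]resolventE [X in _ * (X - _)]addrC addrK.
  apply: csumZE; first exact: Dresolvent_summable.
  by move=> i; rewrite /I2 mulrA.
have sw : csum setT (fun j => csum setT (I2 j)) = csum setT (fun i => csum setT (I2 ^~ i)).
  apply: csum_swap.
  apply: (@le_lt_trans _ _ (\esum_(j in setT) ((2 * C * (C * (2 * C)) * e) * cmod (D j))%:E)%E).
    apply: le_esum => j _.
    apply: (@le_trans _ _ (\esum_(i in setT) ((cmod (D j) * (2 * C * (C * (2 * C)))) * cmod (D i))%:E)%E).
      apply: le_esum => i _; rewrite lee_fin /I2 !cmodM.
      have h1 : cmod (V (j - i)) * cmod (resolvent D b i) <= C * (2 * C).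
        by rewrite ler_pM ?cmod_ge0.
      have h2 : cmod (X j) * (cmod (V (j - i)) * cmod (resolvent D b i)) <= 2 * C * (C * (2 * C)).
        by rewrite ler_pM ?mulr_ge0 ?cmod_ge0.
      have h3 := ler_wpM2l (mulr_ge0 (cmod_ge0 (D j)) (cmod_ge0 (D i))) h2.
      by move: h3; congr (_ <= _); ring.
    have D0 i : 0 <= cmod (D i) by exact: cmod_ge0.
    have K0 : 0 <= cmod (D j) * (2 * C * (C * (2 * C))) by rewrite !mulr_ge0 ?cmod_ge0.
    rewrite esumZl // (_ : _ * e * _ = cmod (D j) * (2 * C * (C * (2 * C))) * e); last by ring.
    by rewrite [leRHS]EFinM lee_wpmul2l // lee_fin.
  have D0 i : 0 <= cmod (D i) by exact: cmod_ge0.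
  rewrite esumZl ?lte_mul_pinfty ?lee_fin ?mulr_ge0 // esum_fin //.
have I2E' i : csum setT (I2 ^~ i) = D i * ((X i - V (a - i)) * resolvent D b i).
  have [S SE] : exists S, S = csum setT (fun j => D j * (V (j - i) * X j)) by eexists.
  have XS : X i - V (a - i) = S by rewrite XE addrC addKr.
  rewrite XS mulrA mulrAC SE; apply: (csumZE (sXV i)).
  by move=> j; rewrite /I2; ring.
have sI : csummable (fun i => csum setT (I2 ^~ i)).
  rewrite (_ : (fun i => _) = fun i => D i * (X i * resolvent D b i) -
    D i * (V (a - i) * resolvent D b i)).
    exact: csummableB sXU (Dresolvent_summable b a).
  by apply/funext => i; rewrite I2E' mulrBl mulrBr.
have sI' : csummable (fun i => csum setT (I2 i)).
  rewrite (_ : (fun i => _) = fun i => D i * (X i * resolvent D b i) -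
    D i * (V (i - b) * X i)).
    exact: csummableB sXU (sXV b).
  by apply/funext => i; rewrite I2E mulrBr mulrBr (mulrC (V _)).
transitivity (csum setT (fun j => D j * (X j * resolvent D b j)) - csum setT (fun i => csum setT (I2 ^~ i))).
  by apply: (csumBE sXU sI) => i; rewrite I2E' mulrBl mulrBr subKr.
rewrite -sw; apply/esym/(csumBE sXU sI') => j.
by rewrite I2E mulrBr mulrBr subKr (mulrC (V _)).
Qed.

End OneWeight.

(** The difference of the two resolvents solves the same kind of fixed point equation, with a source
    of size C * (2 * C) * e' coming from D - D'. Absorption with the factor [C * e <= 1 / 2] doubles
    this. *)
Lemma resolvent_lip (D D' : int -> R[i]) (e e' : R) b a :
  (\esum_(j in setT) (cmod (D j))%:E <= e%:E)%E ->
  (\esum_(j in setT) (cmod (D' j))%:E <= e%:E)%E ->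
  (\esum_(j in setT) (cmod (D j - D' j))%:E <= e'%:E)%E ->
  C * e <= 1 / 2 ->
  cmod (resolvent D b a - resolvent D' b a) <= 4 * C ^+ 2 * e'.
Proof.
move=> De De' DD Ce.
have e0 : 0 <= e.
  by rewrite -lee_fin; apply: le_trans De; apply: esum_ge0 => j _; rewrite lee_fin cmod_ge0.
have q0 : 0 <= C * e by exact: mulr_ge0.
have UB j : cmod (resolvent D b j) <= 2 * C by exact: resolvent_bound De Ce _ _.
have UB' j : cmod (resolvent D' b j) <= 2 * C by exact: resolvent_bound De' Ce _ _.
have sD : csummable D by exact: csummable_le De.
have sDD : csummable (fun j => D j - D' j) by exact: csummable_le DD.
rewrite (_ : _ * e' = 2 * (C * (2 * C) * e')); last by ring.
have q1 : C * e < 1 by apply: le_lt_trans Ce _; lra.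
suff : cmod (resolvent D b a - resolvent D' b a) * (1 - C * e) <= C * (2 * C) * e'.
  move=> h; rewrite -ler_pdivrMl // mulrC; apply: le_trans h.
  by rewrite ler_wpM2l ?cmod_ge0 //; lra.
apply: (@sup_contraction _ _ (fun a => cmod (resolvent D b a - resolvent D' b a))
  (4 * C) _ (C * e)) => //.
  move=> x; rewrite cmod_ge0 /=; apply: le_trans (cmodB _ _) _.
  by have := lerD (UB x) (UB' x); lra.
move=> S HS x.
have S0 : 0 <= S by apply: le_trans (cmod_ge0 _) (HS x).
rewrite (resolventE De Ce) (resolventE De' Ce) opprD addrACA subrr add0r.
rewrite -(csumBE (h := fun j => D j * (V (x - j) * (resolvent D b j - resolvent D' b j)) +
  (D j - D' j) * (V (x - j) * resolvent D' b j))); first last.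
- by move=> j; ring.
- exact: Dresolvent_summable De' Ce _ _.
- exact: Dresolvent_summable De Ce _ _.
rewrite csumD; first last.
- apply: (@csummableMr _ _ _ _ (C * (2 * C))) => // j.
  by rewrite cmodM ler_pM ?cmod_ge0.
- apply: (@csummableMr _ _ _ _ (C * S)) => // j.
  by rewrite cmodM ler_pM ?cmod_ge0.
apply: le_trans (cmodD _ _) _; apply: lerD.
  rewrite (mulrC C) -mulrA; apply: cmod_csumD_le => //; first exact: mulr_ge0.
  by move=> j; rewrite cmodM ler_pM ?cmod_ge0.
rewrite mulrC; apply: cmod_csumD_le => //; first by rewrite !mulr_ge0.
by move=> j; rewrite cmodM ler_pM ?cmod_ge0.
Qed.

End Resolvent.

(** * Lyapunov-Schmidt reduction *)

Section LyapunovSchmidt.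
Variables (R : realType) (V : int -> R[i]) (C : R).
Hypothesis VC : forall m, cmod (V m) <= C.

Definition conv (c : int -> R[i]) (j : int) : R[i] := csum setT (fun m => V (j - m) * c m).

Let C0 : 0 <= C. Proof. exact: le_trans (cmod_ge0 _) (VC 0). Qed.

Lemma conv_summable c j : csummable c -> csummable (fun m => V (j - m) * c m).
Proof. by move=> sc; exact: (csummableM (fun m => VC (j - m))). Qed.

Lemma conv_le c j (X : R) : (\esum_(m in setT) (cmod (c m))%:E <= X%:E)%E ->
  cmod (conv c j) <= C * X.
Proof.
move=> cX; apply: csum_le.
apply: (@le_trans _ _ (\esum_(m in setT) (C * cmod (c m))%:E)%E).
  by apply: le_esum => m _; rewrite lee_fin cmodM ler_wpM2r ?cmod_ge0.
have c0 m : 0 <= cmod (c m) by exact: cmod_ge0.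
rewrite esumZl //; last by apply: le_lt_trans cX _; rewrite ltry.
by rewrite [leRHS]EFinM lee_wpmul2l.
Qed.

Lemma conv_delta a x j : conv (fun m => if m == a then x else 0) j = V (j - a) * x.
Proof.
rewrite /conv -(csum_delta a (V (j - a) * x)); apply: eq_csum => m.
by case: eqP => [->|_]; rewrite ?mulr0.
Qed.

Lemma convB c c' j : csummable c -> csummable c' ->
  conv (fun m => c m - c' m) j = conv c j - conv c' j.
Proof.
move=> sc sc'; apply: (csumBE (conv_summable j sc) (conv_summable j sc')) => m.
by rewrite mulrBr.
Qed.

Lemma convD c c' j : csummable c -> csummable c' ->
  conv (fun m => c m + c' m) j = conv c j + conv c' j.
Proof.
move=> sc sc'; apply: (csumDE (conv_summable j sc) (conv_summable j sc')) => m.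
by rewrite mulrDr.
Qed.

Lemma convZ c x j : csummable c -> conv (fun m => x * c m) j = x * conv c j.
Proof.
by move=> sc; apply: (csumZE (conv_summable j sc)) => m; rewrite mulrCA.
Qed.

Variables (D : int -> R[i]) (e : R).
Hypothesis De : (\esum_(j in setT) (cmod (D j))%:E <= e%:E)%E.
Hypothesis Ce : C * e <= 1 / 2.

Let sD : csummable D. Proof. exact: csummable_le De. Qed.
Let UB b j : cmod (resolvent V D b j) <= 2 * C.
Proof. exact (resolvent_bound VC De Ce b j). Qed.
Let sDU b : csummable (fun j => D j * resolvent V D b j).
Proof. exact: csummableMr sD (UB b). Qed.

Lemma conv_resolvent b j :
  conv (fun m => D m * resolvent V D b m) j = resolvent V D b j - V (j - b).
Proof.
rewrite [X in _ = X - _](resolventE VC De Ce) [X in _ = X - _]addrC addrK.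
by apply: eq_csum => m; rewrite mulrCA.
Qed.

Variables (a1 a2 : int) (c h : int -> R[i]) (H : R).
Hypothesis a12 : a1 != a2.
Hypothesis Da1 : D a1 = 0.
Hypothesis Da2 : D a2 = 0.
Hypothesis sc : csummable c.
Hypothesis cE : forall j, j != a1 -> j != a2 -> c j = D j * (conv c j + h j).
Hypothesis DH : (\esum_(j in setT) (cmod (D j * h j))%:E <= H%:E)%E.

Let U j := resolvent V D a1 j * c a1 + resolvent V D a2 j * c a2.

(** Given the two entries c(a1) and c(a2), the system without source is solved by D U off these
    indices. The remainder [xi] solves the system with zero entries at a1 and a2, and its l^1 norm X
    satisfies X <= C e X + H, hence X <= 2 H. *)
Lemma lyapunov_schmidt :
  (forall j, cmod (conv c j - U j) <= C * (2 * H)) /\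
  (forall j, j != a1 -> j != a2 -> cmod (c j - D j * U j) <= 2 * H).
Proof.
pose d a j : R[i] := if j == a then c a else 0.
pose w j := D j * resolvent V D a1 j * c a1 + D j * resolvent V D a2 j * c a2.
pose xi j := c j - d a1 j - d a2 j - w j.
have wE : w = fun j => c a1 * (D j * resolvent V D a1 j) + c a2 * (D j * resolvent V D a2 j).
  by apply/funext => j; rewrite /w !(mulrC _ (c _)).
have sd a : csummable (d a) by exact: csummable_delta.
have sw1 := csummableZ (c a1) (sDU a1).
have sw2 := csummableZ (c a2) (sDU a2).
have sw : csummable w by rewrite wE; exact: csummableD sw1 sw2.
have s1 := csummableB sc (sd a1).
have s2 := csummableB s1 (sd a2).
have sxi : csummable xi by exact: csummableB s2 sw.
have convxi j : conv xi j = conv c j - U j.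
  rewrite (convB _ s2 sw) (convB _ s1 (sd a2)) (convB _ sc (sd a1)).
  rewrite /d !conv_delta wE (convD _ sw1 sw2) (convZ _ _ (sDU a1)) (convZ _ _ (sDU a2)).
  by rewrite !conv_resolvent /U; ring.
have xi_off j : j != a1 -> j != a2 -> xi j = c j - D j * U j.
  move=> j1 j2; rewrite /xi /d (negPf j1) (negPf j2) !subr0 /w /U; ring.
have xiE j : xi j = D j * (conv xi j + h j).
  have [->|j1] := eqVneq j a1.
    by rewrite /xi /d /w eqxx (negPf a12) Da1; ring.
  have [->|j2] := eqVneq j a2.
    by rewrite /xi /d /w eqxx eq_sym (negPf a12) Da2; ring.
  by rewrite xi_off // convxi {1}cE //; ring.
have xl := csummable_lty sxi.
have x0 j : 0 <= cmod (xi j) by exact: cmod_ge0.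
have D0 j : 0 <= cmod (D j) by exact: cmod_ge0.
have Dl := csummable_lty sD.
(* The norm has to be a real number before half of it can be subtracted on both sides. *)
have [X XE] : exists X : R, (\esum_(m in setT) (cmod (xi m))%:E = X%:E)%E.
  by exists (fine (\esum_(m in setT) (cmod (xi m))%:E)); rewrite fineK // esum_fin.
have X0 : 0 <= X by rewrite -lee_fin -XE; apply: esum_ge0 => j _; rewrite lee_fin.
have XH : X <= 2 * H.
  suff : X <= C * X * e + H by have := ler_wpM2r X0 Ce; lra.
  rewrite -lee_fin -XE.
  apply: (@le_trans _ _ (\esum_(j in setT) ((C * X * cmod (D j))%:E + (cmod (D j * h j))%:E))%E).
    apply: le_esum => j _; rewrite -EFinD lee_fin {1}xiE mulrDr.
    apply: le_trans (cmodD _ _) _; rewrite lerD2r cmodM mulrC ler_wpM2r //.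
    by apply: conv_le; rewrite XE.
  rewrite esumD; [|by move=> j _; rewrite lee_fin ?mulr_ge0 ?cmod_ge0..].
  rewrite EFinD leeD // esumZl ?mulr_ge0 //.
  by rewrite [leRHS]EFinM lee_wpmul2l // lee_fin mulr_ge0.
split=> j.
  rewrite -convxi; apply: (@le_trans _ _ (C * X)); first by apply: conv_le; rewrite XE.
  exact: ler_wpM2l.
move=> j1 j2; rewrite -xi_off //; apply: le_trans XH; rewrite -lee_fin -XE.
exact: (esum_ge_term (f := fun j => cmod (xi j))).
Qed.

End LyapunovSchmidt.

(** * Summability of the weights 1 / (n^2 - j^2 + z) *)

Section Weights.
Variables (R : realType).

(** The profile |m|^(-3/2), with value 0 at m = 0. It is what remains of 1 / (|j - n| |j + n|) once
    n^(-1/2) is taken out. The sum of 1 / |n^2 - j^2| is really of order log n / n; the weaker rate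
    n^(-1/2) is enough and avoids logarithms. *)
Definition threehalves (m : int) : R :=
  if m == 0 then 0 else (`|m|%N%:R * Num.sqrt `|m|%N%:R)^-1.

Lemma threehalves_ge0 m : 0 <= threehalves m.
Proof. by rewrite /threehalves; case: ifP => // _; rewrite invr_ge0 mulr_ge0 ?sqrtr_ge0. Qed.

(** Integral comparison in telescoping form: 2 t^(-1/2) is a primitive of - t^(-3/2). *)
Lemma threehalves_step (k : nat) : (0 < k)%N ->
  (k.+1%:R * Num.sqrt k.+1%:R)^-1 <= 2 / Num.sqrt k%:R - 2 / Num.sqrt k.+1%:R :> R.
Proof.
move=> k0; set s := Num.sqrt k%:R; set t := Num.sqrt k.+1%:R.
have kr : (0 : R) < k%:R by rewrite ltr0n.
have s0 : 0 < s by rewrite sqrtr_gt0.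
have t0 : 0 < t by rewrite sqrtr_gt0 ltr0n.
have ss : s ^+ 2 = k%:R by rewrite sqr_sqrtr // ltW.
have tt : t ^+ 2 = k.+1%:R by rewrite sqr_sqrtr // ler0n.
have st : t ^+ 2 = s ^+ 2 + 1 by rewrite tt ss -natr1.
have lst : s <= t by rewrite ler_sqrt // ler_nat.
rewrite -tt.
have -> : 2 / s - 2 / t = (2 * (t - s)) / (s * t) by field; rewrite !gt_eqF.
have -> : (t ^+ 2 * t)^-1 = (s / t ^+ 2) / (s * t).
  by field; rewrite !gt_eqF.
rewrite ler_pM2r ?invr_gt0 ?mulr_gt0 // ler_pdivrMr ?exprn_gt0 //.
have e : (t - s) * (t + s) = 1 by rewrite -subr_sqr st; lra.
have h : 0 <= t - s by rewrite subr_ge0.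
have : (t + s) * s <= 2 * t ^+ 2 by nra.
move=> h2; have := ler_wpM2l h h2; rewrite mulrA e; lra.
Qed.

Lemma threehalves_sum n :
  \sum_(0 <= k < n) threehalves k.+1%:Z <= 3.
Proof.
have E k : threehalves k.+1%:Z = (k.+1%:R * Num.sqrt k.+1%:R)^-1 by [].
case: n => [|n]; first by rewrite big_nil.
suff H : \sum_(0 <= k < n.+1) threehalves k.+1%:Z <= 3 - 2 / Num.sqrt n.+1%:R.
  by apply: le_trans H _; rewrite gerBl divr_ge0 ?sqrtr_ge0.
elim: n => [|n IH].
  by rewrite big_nat1 E sqrtr1 mulr1 invr1; lra.
rewrite big_nat_recr // E; apply: le_trans (lerD IH (threehalves_step (ltn0Sn n))) _.
by rewrite addrA subrK.
Qed.

Lemma threehalves_esum : (\esum_(m in setT) (threehalves m)%:E <= 6%:E)%E.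
Proof.
rewrite (esumID [set m : int | 0 <= m]); last by move=> m _; rewrite lee_fin threehalves_ge0.
rewrite !setTI (_ : 6 = 3 + 3) ?EFinD; last by lra.
apply: leeD.
  have bij : set_bij setT [set m : int | 0 <= m] Posz.
    by split=> [k _ //|k l _ _ [] //|[k _|//]]; exists k.
  rewrite (reindex_esum _ _ _ _ bij); apply: esum_nat_le => [i|n].
    exact: threehalves_ge0.
  case: n => [|n]; first by rewrite big_nil.
  by rewrite big_nat_recl //= {1}/threehalves eqxx add0r threehalves_sum.
have bij : set_bij setT (~` [set m : int | 0 <= m]) Negz.
  by split=> [k _ //|k l _ _ [] //|[k /(_ isT) //|k _]]; exists k.
rewrite (reindex_esum _ _ _ _ bij); apply: esum_nat_le => [i|n].
  exact: threehalves_ge0.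
by apply: le_trans (threehalves_sum n).
Qed.

Definition gapinv (n : nat) (j : int) : R :=
  if beta_index n j then `|(n%:Z ^+ 2 - j ^+ 2)%:~R|^-1 else 0.

Lemma gapinv_ge0 n j : 0 <= gapinv n j.
Proof. by rewrite /gapinv; case: ifP => // _; rewrite invr_ge0. Qed.

(** The factors a = |j - n| and b = |j + n| are at least 1 and add up to at least 2n; expanding (a -
    1) (b - 1) >= 0 bounds their product from below. *)
Lemma gap_ge n j : beta_index n j -> ((2 * n)%:Z - 1 <= `|n%:Z ^+ 2 - j ^+ 2|)%R.
Proof.
move=> /and3P[_ j1 j2].
have -> : n%:Z ^+ 2 - j ^+ 2 = - ((j - n%:Z) * (j + n%:Z)) by ring.
rewrite normrN normrM.
have a1 : (1 <= `|j - n%:Z|)%R by rewrite -gtz0_ge1 normr_gt0 subr_eq0.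
have b1 : (1 <= `|j + n%:Z|)%R by rewrite -gtz0_ge1 normr_gt0 addr_eq0.
have ab : (2 * n%:Z <= `|j - n%:Z| + `|j + n%:Z|)%R by lia.
have : 0 <= (`|j - n%:Z| - 1) * (`|j + n%:Z| - 1) by rewrite mulr_ge0 // subr_ge0.
by rewrite PoszM; lia.
Qed.

Lemma gap_ge_n n j : (0 < n)%N -> beta_index n j ->
  n%:R <= `|(n%:Z ^+ 2 - j ^+ 2)%:~R| :> R.
Proof.
move=> n0 /gap_ge h; rewrite -intr_norm.
have -> : n%:R = (n%:Z)%:~R :> R by [].
rewrite ler_int; lia.
Qed.

(** One of |j - n| and |j + n|, called x, is at least n; let y be the other one. If y <= x, then x
    >= sqrt n sqrt y and 1 / (x y) <= n^(-1/2) y^(-3/2). If x <= y, then y >= sqrt n sqrt x and the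
    same holds with x^(-3/2). *)
Lemma gapinv_le n j : (0 < n)%N ->
  gapinv n j <= (Num.sqrt n%:R)^-1 * (threehalves (j - n%:Z) + threehalves (j + n%:Z)).
Proof.
move=> n0; rewrite /gapinv; case: ifP => [bj|_]; last first.
  by rewrite mulr_ge0 ?invr_ge0 ?sqrtr_ge0 ?addr_ge0 ?threehalves_ge0.
have /and3P[_ j1 j2] := bj.
have -> : n%:Z ^+ 2 - j ^+ 2 = - ((j - n%:Z) * (j + n%:Z)) by ring.
rewrite rmorphN normrN rmorphM normrM -!intr_norm.
rewrite /threehalves subr_eq0 addr_eq0 (negPf j1) (negPf j2).
have nr : (0 : R) < n%:R by rewrite ltr0n.
set a := absz (j - n%:Z); set b := absz (j + n%:Z).
have -> : (`|j - n%:Z|%:~R : R) = a%:R by [].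
have -> : (`|j + n%:Z|%:~R : R) = b%:R by [].
have a0 : (0 : R) < a%:R by rewrite ltr0n /a absz_gt0 subr_eq0.
have b0 : (0 : R) < b%:R by rewrite ltr0n /b absz_gt0 addr_eq0.
have ab : (n <= a)%N || (n <= b)%N by rewrite /a /b; apply/orP; lia.
have key (x y : nat) : (0 : R) < x%:R -> (0 : R) < y%:R -> (n <= x)%N ->
  (x%:R * y%:R)^-1 <= (Num.sqrt n%:R)^-1 * ((x%:R * Num.sqrt x%:R)^-1 + (y%:R * Num.sqrt y%:R)^-1) :> R.
  move=> x0 y0 nx.
  have sn : 0 < Num.sqrt n%:R :> R by rewrite sqrtr_gt0.
  have sx : 0 < Num.sqrt x%:R :> R by rewrite sqrtr_gt0.
  have sy : 0 < Num.sqrt y%:R :> R by rewrite sqrtr_gt0.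
  have lnx : Num.sqrt n%:R <= Num.sqrt x%:R :> R by rewrite ler_sqrt ?ler_nat // ltW.
  have pos (u : R) : 0 < u -> 0 <= u^-1 by move=> ?; rewrite invr_ge0 ltW.
  have [xy|/ltW xy] := leP (Num.sqrt y%:R : R) (Num.sqrt x%:R).
    apply: (@le_trans _ _ ((Num.sqrt n%:R)^-1 * (y%:R * Num.sqrt y%:R)^-1)).
      rewrite -invfM lef_pV2 ?posrE ?mulr_gt0 //.
      rewrite mulrCA [leRHS]mulrC ler_wpM2l ?(ltW y0) //.
      by rewrite -(sqr_sqrtr (ltW x0)) expr2 ler_pM ?(ltW sn) ?(ltW sy).
    by rewrite ler_wpM2l ?pos // lerDr pos // mulr_gt0.
  apply: (@le_trans _ _ ((Num.sqrt n%:R)^-1 * (x%:R * Num.sqrt x%:R)^-1)).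
    rewrite -invfM lef_pV2 ?posrE ?mulr_gt0 //.
    rewrite mulrCA ler_wpM2l ?(ltW x0) //.
    rewrite -(sqr_sqrtr (ltW y0)) expr2 ler_pM ?(ltW sn) ?(ltW sx) //.
    exact: le_trans xy.
  by rewrite ler_wpM2l ?pos // lerDl pos // mulr_gt0.
have [h|h] := orP ab; first exact: key.
by rewrite mulrC [X in _ <= _ * X]addrC; exact: key.
Qed.

Lemma gapinv_esum n : (0 < n)%N ->
  (\esum_(j in setT) (gapinv n j)%:E <= (12 / Num.sqrt n%:R)%:E)%E.
Proof.
move=> n0.
have s0 : 0 <= (Num.sqrt n%:R)^-1 :> R by rewrite invr_ge0 sqrtr_ge0.
have shift (k : int) : (\esum_(j in setT) (threehalves (j + k))%:E <= 6%:E)%E.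
  have bij : set_bij setT setT (fun j : int => j + k).
    split=> // [x y _ _ /addIr //|j _]; by exists (j - k) => //; rewrite subrK.
  by rewrite -(reindex_esum setT setT (fun j => j + k) (fun j => (threehalves j)%:E)) // threehalves_esum.
apply: (@le_trans _ _ (\esum_(j in setT) ((Num.sqrt n%:R)^-1 *
   (threehalves (j - n%:Z) + threehalves (j + n%:Z)))%:E)%E).
  by apply: le_esum => j _; rewrite lee_fin gapinv_le.
have S : (\esum_(j in setT) (threehalves (j - n%:Z) + threehalves (j + n%:Z))%:E <= 12%:E)%E.
  under eq_esum do rewrite EFinD.
  rewrite esumD; try by move=> j _; rewrite lee_fin threehalves_ge0.
  rewrite (_ : 12 = 6 + 6) ?EFinD; last by lra.
  by apply: leeD; exact: shift.
rewrite esumZl //.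
- by rewrite mulrC EFinM lee_wpmul2l.
- by move=> j; rewrite addr_ge0 ?threehalves_ge0.
- by apply: le_lt_trans S _; rewrite ltry.
Qed.

Definition weight (n : nat) (z : R[i]) (j : int) : R[i] :=
  if beta_index n j then ((n ^ 2)%:R - (j ^+ 2)%:~R + z)^-1 else 0.

Lemma gapE n j : (n ^ 2)%:R - (j ^+ 2)%:~R = ((n%:Z ^+ 2 - j ^+ 2)%:~R) :> R[i].
Proof. by rewrite rmorphB /= -[(n%:Z ^+ 2)]/(n%:Z * n%:Z) -PoszM. Qed.

Lemma gap_cmod n (z : R[i]) j : (0 < n)%N -> cmod z < n%:R / 4 -> beta_index n j ->
  `|(n%:Z ^+ 2 - j ^+ 2)%:~R| / (2 : R) <= cmod ((n ^ 2)%:R - (j ^+ 2)%:~R + z).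
Proof.
move=> n0 hz bj; rewrite gapE; have := gap_ge_n n0 bj.
have := cmod_triang ((n%:Z ^+ 2 - j ^+ 2)%:~R) (((n%:Z ^+ 2 - j ^+ 2)%:~R) + z).
rewrite opprD addNKr cmodN cmod_int => h1 h2.
have := ler0n R n; lra.
Qed.

Lemma weight_le n z j : (0 < n)%N -> cmod z < n%:R / 4 ->
  cmod (weight n z j) <= 2 * gapinv n j.
Proof.
move=> n0 hz; rewrite /weight /gapinv; case: ifP => [bj|_]; last by rewrite cmod0 mulr0.
have h := gap_cmod n0 hz bj; have h2 := gap_ge_n n0 bj.
have nr : (0 : R) < n%:R by rewrite ltr0n.
have g0 : 0 < `|(n%:Z ^+ 2 - j ^+ 2)%:~R| :> R by exact: lt_le_trans h2.
rewrite cmodV -(invrK 2) -invfM lef_pV2 ?posrE //.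
- by rewrite mulrC.
- by apply: lt_le_trans h; rewrite divr_gt0.
- by rewrite mulr_gt0 ?invr_gt0.
Qed.

Lemma gapinv_le1 n j : (0 < n)%N -> gapinv n j <= 1.
Proof.
move=> n0; rewrite /gapinv; case: ifP => // bj.
have h2 := gap_ge_n n0 bj; rewrite invf_le1; first by apply: le_trans h2; rewrite ler1n.
by apply: lt_le_trans h2; rewrite ltr0n.
Qed.

(** The difference of two inverses is z' - z times the product of the weights; one weight keeps the
    summable factor [gapinv n j], the other is simply bounded by 2. *)
Lemma weight_lip n z z' j : (0 < n)%N -> cmod z < n%:R / 4 -> cmod z' < n%:R / 4 ->
  cmod (weight n z j - weight n z' j) <= (4 * cmod (z - z')) * gapinv n j.
Proof.
move=> n0 hz hz'.
have w1 := weight_le j n0 hz; have w2 := weight_le j n0 hz'.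
have : weight n z j - weight n z' j = (z' - z) * (weight n z j * weight n z' j).
  rewrite /weight; case: ifP => [bj|_]; last by rewrite subr0 mul0r mulr0.
  have h := gap_cmod n0 hz bj; have h' := gap_cmod n0 hz' bj; have h2 := gap_ge_n n0 bj.
  have nr : (0 : R) < n%:R by rewrite ltr0n.
  have g0 : 0 < `|(n%:Z ^+ 2 - j ^+ 2)%:~R| / 2 :> R by rewrite divr_gt0 // (lt_le_trans nr h2).
  have z0 : (n ^ 2)%:R - (j ^+ 2)%:~R + z != 0.
    by apply/eqP => E; move: h; rewrite E cmod0; lra.
  have z0' : (n ^ 2)%:R - (j ^+ 2)%:~R + z' != 0.
    by apply/eqP => E; move: h'; rewrite E cmod0; lra.
  move: z0 z0'; generalize ((n ^ 2)%:R - (j ^+ 2)%:~R : R[i]) => A z0 z0'.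
  by field; rewrite z0 z0'.
move=> ->; rewrite cmodM cmodM cmodC.
rewrite (_ : 4 * _ * _ = cmod (z - z') * ((2 * gapinv n j) * 2)); last by ring.
rewrite ler_wpM2l ?cmod_ge0 // ler_pM ?cmod_ge0 //.
by have := gapinv_le1 j n0; lra.
Qed.

Lemma beta_indexN n j : beta_index n (- j) = beta_index n j.
Proof.
by apply/idP/idP => /and3P[h1 h2 h3]; apply/and3P; split; lia.
Qed.

Lemma weightN n z j : weight n z (- j) = weight n z j.
Proof. by rewrite /weight beta_indexN sqrrN. Qed.

Lemma weight_n n z : weight n z n%:Z = 0.
Proof. by rewrite /weight /beta_index eqxx andbF. Qed.

Lemma weight_Nn n z : weight n z (- n%:Z) = 0.
Proof. by rewrite /weight /beta_index eqxx !andbF. Qed.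

Lemma weight_esum n z : (0 < n)%N -> cmod z < n%:R / 4 ->
  (\esum_(j in setT) (cmod (weight n z j))%:E <= (24 / Num.sqrt n%:R)%:E)%E.
Proof.
move=> n0 hz; have G := gapinv_esum n0.
apply: (@le_trans _ _ (\esum_(j in setT) (2 * gapinv n j)%:E)%E).
  by apply: le_esum => j _; rewrite lee_fin weight_le.
rewrite esumZl //; [|exact: gapinv_ge0|by apply: le_lt_trans G _; rewrite ltry].
rewrite (_ : 24 / _ = 2 * (12 / Num.sqrt n%:R)); last by rewrite mulrA; congr (_ / _); lra.
by rewrite EFinM lee_wpmul2l // lee_fin.
Qed.

Lemma weight_lip_esum n z z' : (0 < n)%N -> cmod z < n%:R / 4 -> cmod z' < n%:R / 4 ->
  (\esum_(j in setT) (cmod (weight n z j - weight n z' j))%:E <=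
   (48 / Num.sqrt n%:R * cmod (z - z'))%:E)%E.
Proof.
move=> n0 hz hz'; have G := gapinv_esum n0.
apply: (@le_trans _ _ (\esum_(j in setT) ((4 * cmod (z - z')) * gapinv n j)%:E)%E).
  by apply: le_esum => j _; rewrite lee_fin weight_lip.
have p0 : 0 <= 4 * cmod (z - z') by rewrite mulr_ge0 ?cmod_ge0.
rewrite esumZl //; [|exact: gapinv_ge0|by apply: le_lt_trans G _; rewrite ltry].
rewrite (_ : 48 / _ * _ = (4 * cmod (z - z')) * (12 / Num.sqrt n%:R)); last first.
  by rewrite (_ : 48 = 4 * 12); [ring|lra].
by rewrite [leRHS]EFinM lee_wpmul2l // lee_fin.
Qed.

Lemma wchainE (v : R -> R[i]) n z a js b : wchain (fourier v) (weight n z) a js b =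
  if all (beta_index n) js then
    fourier_chain v a js b / \prod_(j <- js) ((n ^ 2)%:R - (j ^+ 2)%:~R + z) else 0.
Proof.
elim: js a => [|j js IH] a /=; first by rewrite big_nil divr1.
rewrite IH big_cons /weight; case: (beta_index n j) => /=; last by rewrite mul0r.
by case: ifP => _; rewrite ?mulr0 // invfM; ring.
Qed.

(** The isolated term V(2 a) is the chain without intermediate index between the frequencies a and -
    a, so [beta] is an off-diagonal entry of the resolvent. *)
Lemma beta_resolvent (v : R -> R[i]) (C e : R) n a z :
  (forall m, cmod (fourier v m) <= C) ->
  (\esum_(j in setT) (cmod (weight n z j))%:E <= e%:E)%E -> C * e <= 1 / 2 ->
  beta v n a z = resolvent (fourier v) (weight n z) (- a) a.
Proof.
move=> VC We Ce; rewrite /beta /resolvent.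
rewrite csum_nat_recl; last exact (chainsum_summable VC We Ce _ _).
rewrite chainsum0 opprK mulrDl mul1r; apply: (congr1 (fun x => _ + x)).
have bij : set_bij setT [set k : nat | (1 <= k)%N] succn.
  split=> [k _ //|k l _ _ [] //|[//|k] _]; by exists k.
rewrite (csum_reindex _ bij); apply: eq_csum => k; rewrite /chainsum csum_mkcond; apply: eq_csum => js.
rewrite wchainE; congr (if _ then _ else _).
by apply/idP/idP; rewrite inE.
Qed.

End Weights.

(** * Absolutely continuous functions *)

Section AbsoluteContinuity.
Variable R : realType.
Local Notation mu := (@lebesgue_measure R).

Definition rderiv (F : R -> R) (x l : R) : Prop :=
  (F y - F x) / (y - x) @[y --> within (@I0pi R) x^'] --> l.

Definition rabs_continuous (F : R -> R) : Prop :=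
  forall e : R, 0 < e -> exists2 d : R, 0 < d &
    forall (m : nat) (a b : 'I_m -> R),
      (forall i, [/\ 0 <= a i, a i <= b i & b i <= pi]) ->
      trivIset setT (fun i => `]a i, b i[%classic) ->
      \sum_(i < m) (b i - a i) < d ->
      \sum_(i < m) `|F (b i) - F (a i)| < e.

Lemma I0piP x : @I0pi R x <-> 0 <= x <= pi.
Proof. by rewrite /I0pi /= in_itv. Qed.

Lemma measurable_I0pi : measurable (@I0pi R : set (measurableTypeR R)).
Proof. exact: measurable_itv. Qed.

Lemma rderivP F x l : rderiv F x l <->
  forall e : R, 0 < e -> exists2 d : R, 0 < d &
    forall y, @I0pi R y -> `|y - x| < d -> `|F y - F x - l * (y - x)| <= e * `|y - x|.
Proof.
split.
- move=> /cvgrPdist_le h e e0; have /nbhs_ballP[d /= d0 hd] := h e e0.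
  exists d => // y Iy yd; have [->|yx] := eqVneq y x.
    by rewrite !subrr mulr0 subr0 normr0 mulr0.
  have yx0 : y - x != 0 by rewrite subr_eq0.
  have yn : 0 < `|y - x| by rewrite normr_gt0.
  have := hd y; rewrite /ball /= distrC => /(_ yd yx Iy) h2.
  have -> : F y - F x - l * (y - x) = - ((l - (F y - F x) / (y - x)) * (y - x)).
    by field.
  by rewrite normrN normrM ler_pM2r.
- move=> h; apply/cvgrPdist_le => e e0; have [d d0 hd] := h e e0.
  apply/nbhs_ballP; exists d => //= y; rewrite /ball /= distrC => yd yx Iy.
  have yx0 : y - x != 0 by rewrite subr_eq0.
  have yn : 0 < `|y - x| by rewrite normr_gt0.
  have := hd y Iy yd.
  have -> : F y - F x - l * (y - x) = - ((l - (F y - F x) / (y - x)) * (y - x)).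
    by field.
  by rewrite normrN normrM ler_pM2r.
Qed.

(** Ordered lists of intervals replace indexed disjoint families because a list can be extended on
    the right by one more interval, as the supremum argument below requires. *)
Lemma rabs_continuous_seq F e : rabs_continuous F -> 0 < e ->
  exists2 d : R, 0 < d & forall l : seq (R * R),
    all (fun p => [&& 0 <= p.1, p.1 <= p.2 & p.2 <= pi]) l ->
    pairwise (fun p q => p.2 <= q.1) l ->
    \sum_(p <- l) (p.2 - p.1) < d -> \sum_(p <- l) `|F p.2 - F p.1| < e.
Proof.
move=> acF e0; have [d d0 H] := acF e e0; exists d => // l lI ld lS.
rewrite (big_nth (0, 0)) big_mkord; rewrite (big_nth (0, 0)) big_mkord in lS.
apply: H => //.
- move=> i; have /and3P[] := all_nthP (0, 0) lI i (ltn_ord i); by split.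
- have lt_disj (i j : 'I_(size l)) : (i < j)%N ->
    (nth (0, 0) l i).2 <= (nth (0, 0) l j).1.
    by move=> ij; apply: (pairwiseP (0, 0) ld) => //; rewrite inE.
  apply/trivIsetP => i j _ _ ij; apply/seteqP; split => // x [] /=.
  rewrite !in_itv /= => /andP[h1 h2] /andP[h3 h4].
  have [/lt_disj|/lt_disj|/val_inj E] := ltngtP i j.
  + by move=> h; have := lt_trans h3 (lt_le_trans h2 h); rewrite ltxx.
  + by move=> h; have := lt_trans h1 (lt_le_trans h4 h); rewrite ltxx.
  + by rewrite E eqxx in ij.
Qed.

Let step_in (g gx F H S P I e1 e2 : R) : g <= gx + F + H -> gx <= e1 + S + P ->
  H <= I -> e1 <= e2 -> g <= e2 + (S + F) + (P + I).
Proof. lra. Qed.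

Let step_out (g gx F H S P Q e1 e2 e3 : R) : g <= gx + F + H -> gx <= e1 + S + P ->
  F <= e2 -> H <= e3 -> P <= Q -> g <= e1 + (e2 + e3) + S + Q.
Proof. lra. Qed.

Let in_ball (s d x y t : R) : s - d < x -> y < s + d -> x <= t -> t <= y -> `|t - s| < d.
Proof. by move=> h1 h2 h3 h4; rewrite ltr_norml; apply/andP; split; lra. Qed.

(* The primitive of an integrable function is differentiable almost everywhere;
   points where this or the derivative of F fails are covered by an open set U
   of small measure.  A supremum argument (as in Cousin's lemma) then splits
   [0, b] into intervals on which F - H grows slowly and intervals inside U. *)
Lemma abs_continuous_FTC (F f : R -> R) (b : R) :
  rabs_continuous F -> {ae mu, forall x, I0pi x -> rderiv F x (f x)} ->
  mu.-integrable (@I0pi R) (EFin \o f) -> 0 <= b <= pi ->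
  F b - F 0 = Rintegral mu `[0, b] f.
Proof.
move=> acF dF intf /andP[b0 bpi].
(* Extension by zero gives a primitive [H] on the whole line, to which almost everywhere
   differentiability applies. *)
pose f0 := patch (fun=> 0) (@I0pi R) f.
have mI := measurable_I0pi.
have intf0 : mu.-integrable setT (EFin \o f0).
  by rewrite /f0 -restrict_EFin; apply/integrable_restrict => //=; rewrite setTI.
have intf0A A : measurable A -> mu.-integrable A (EFin \o f0).
  by move=> mA; apply: integrableS intf0.
have intnf0A A : measurable A -> mu.-integrable A (EFin \o (fun x => `|f0 x|)).
  by move=> mA; apply: integrable_norm; exact: intf0A.
pose H x := Rintegral mu `]-oo, x] f0.
have HB x y : x <= y -> H y - H x = Rintegral mu `]x, y] f0.
  by move=> xy; rewrite /H Rintegral_itvB //; exact: intf0A.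
have -> : Rintegral mu `[0, b] f = H b - H 0.
  rewrite HB // Rintegral_itv_obnd_cbnd; last exact: intf0A.
  apply: eq_Rintegral => y; rewrite inE /= in_itv /= => /andP[y0 yb].
  by rewrite mem_set //; apply/I0piP; rewrite y0 (le_trans yb).
(* The budget is e b for the slope of F - H, plus e for the variation of F over the exceptional
   intervals, plus e for the integral of |f| over U. *)
suff key e : 0 < e -> `|F b - H b - (F 0 - H 0)| <= e * (b + 2).
  apply/eqP; rewrite -subr_eq0; apply/eqP.
  have -> : F b - F 0 - (H b - H 0) = F b - H b - (F 0 - H 0) by ring.
  apply/eqP; rewrite -normr_le0; apply/ler_addgt0Pr => e e0; rewrite add0r.
  have b2 : 0 < b + 2 by lra.
  have := key (e / (b + 2)); rewrite divrK ?unitfE ?gt_eqF //; apply.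
  exact: divr_gt0.
move=> e0; pose G x := F x - H x.
have [d1 d10 hd1] := rabs_continuous_seq acF e0.
have [d2 [d20 hd2]] := integral_normr_continuous intf0 e0.
(* The measure of U is below [d1], so that absolute continuity controls F on intervals of total
   length at most that of U, and below [d2], so that the integral of |f0| over U is less than e. *)
have [U [oU UN mUd]] : exists U : set R, [/\ open U,
   (forall x, I0pi x -> ~ U x -> rderiv F x (f x) /\ (derivable H x 1 /\ derive1 H x = f0 x)) &
   (mu U < (Num.min d1 d2)%:E)%E].
  have dH := @FTC1Ny R f0 (fun y => intf0A _ (measurable_itv _)) (integrable_locally mI intf).
  have [N [mN N0 hN]] := @filterI _ _ (ae_filter_ringOfSetsType mu) _ _ dF dH.
  have d0 : 0 < Num.min d1 d2 by rewrite lt_min d10.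
  have [U [oU NU mU]] := lebesgue_regularity_outer mN (eq_ind_r (fun x => x < +oo)%E (ltry 0) N0) d0.
  exists U; split => //.
    move=> x Ix nUx; have : ~ N x by move=> /NU.
    move=> nNx; have := contra_not (hN x) nNx; move=> /contrapT /= [h1 h2].
    split; first exact: h1.
    exact: h2.
  have mU' : measurable U by exact: measurable_realfun.open_measurable.
  have UN0 : mu (U `&` N) = 0%E.
    by apply: (subset_measure0 _ _ _ N0) => //; exact: measurableI.
  have E : (U `\` N) `|` (U `&` N) = U by rewrite setUC setUIDK.
  by rewrite -{1}E measureU0 //; [exact: measurableD|exact: measurableI].
have mU : measurable U by exact: measurable_realfun.open_measurable.
have Ufin : (mu U < +oo)%E by apply: lt_trans mUd _; rewrite ltry.
pose W x := fine (mu (U `&` `[0, x])).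
pose P x := Rintegral mu (U `&` `[0, x]) (fun t => `|f0 t|).
have mUx x : measurable (U `&` `[0, x]) by exact: measurableI.
have le_mu (A B : set R) : measurable A -> measurable B -> A `<=` B -> (mu A <= mu B)%E.
  by move=> mA mB AB; apply: le_measure => //; rewrite inE.
have Wfin x : mu (U `&` `[0, x]) \is a fin_num.
  rewrite ge0_fin_numE //; apply: le_lt_trans Ufin.
  by apply: le_mu => //; exact: subIsetl.
have splitU x y : 0 <= x -> x <= y -> (forall t, x <= t -> t <= y -> U t) ->
    U `&` `[0, y] = (U `&` `[0, x]) `|` `]x, y].
  move=> x0 xy hU; apply/seteqP; split => t /=.
    rewrite !in_itv /= => -[Ut /andP[t0 ty]].
    by have [tx|tx] := leP t x; [left; rewrite t0|right].
  rewrite !in_itv /= => -[[Ut /andP[t0 tx]]|/andP[xt ty]].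
    by rewrite t0 (le_trans tx).
  by split; [apply: hU => //; exact: ltW|rewrite ty (le_trans x0) // ltW].
have disj x y : [disjoint U `&` `[0, x] & `]x, y]].
  apply/eqP/seteqP; split => // t /= [[_]]; rewrite !in_itv /= => /andP[_ tx] /andP[xt _].
  by have := lt_le_trans xt tx; rewrite ltxx.
have WB x y : 0 <= x -> x <= y -> (forall t, x <= t -> t <= y -> U t) -> W y = W x + (y - x).
  move=> x0 xy hU.
  have E : mu (U `&` `[0, y]) = (mu (U `&` `[0%R, x]) + mu `]x, y])%E.
    rewrite (splitU x y) //; apply: measureU; [exact: mUx|exact: measurable_itv|].
    by apply/eqP; exact: disj.
  rewrite /W E fineD //; last by rewrite lebesgue_measure_itv /=; case: ifP.
  congr (_ + _); rewrite lebesgue_measure_itv /= lte_fin.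
  by move: xy; rewrite le_eqVlt => /predU1P[->|->] //; rewrite ltxx subrr.
have PB x y : 0 <= x -> x <= y -> (forall t, x <= t -> t <= y -> U t) ->
    P y = P x + Rintegral mu `]x, y] (fun t => `|f0 t|).
  move=> x0 xy hU; rewrite /P (splitU x y) //.
  apply: Rintegral_setU; [exact: mUx|exact: measurable_itv| |exact: disj].
  by apply: intnf0A; apply: measurableU; [exact: mUx|exact: measurable_itv].
pose S := [set x | 0 <= x <= b /\ exists l : seq (R * R),
  [/\ all (fun p => [&& 0 <= p.1, p.1 <= p.2 & p.2 <= x]) l,
      pairwise (fun p q => p.2 <= q.1) l,
      \sum_(p <- l) (p.2 - p.1) <= W x &
      `|G x - G 0| <= e * x + \sum_(p <- l) `|F p.2 - F p.1| + P x]].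
have S0 : S 0.
  split; first by rewrite lexx.
  exists [::]; rewrite !big_nil; split => //; first exact: fine_ge0.
  by rewrite subrr normr0 mulr0 !add0r; apply: Rintegral_ge0.
have ubS : ubound S b by move=> x [/andP[_ ->]].
have supS : has_sup S by split; [exists 0 | exists b].
set s := sup S.
have s0 : 0 <= s by apply: ub_le_sup => //; exists b.
have sb : s <= b by apply: ge_sup => //; exists 0.
have Is : I0pi s by apply/I0piP; rewrite s0 (le_trans sb).
(* every point of S close to s can be moved past s *)
have [d d0 step] : exists2 d : R, 0 < d & forall x y, S x -> s - d < x -> x <= s -> s <= y ->
    y < s + d -> y <= b -> S y.
  have [Us|nUs] := pselect (U s).
    have [d /= d0 hd] : exists2 d : R, 0 < d & forall t, `|t - s| < d -> U t.
      have /nbhs_ballP[d /= d0 hd] := oU s Us.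
      by exists d => // t td; apply: hd; rewrite /ball /= distrC.
    exists d => // x y [/andP[x0 xb] [l [l1 l2 l3 l4]]] sx xs sy ysd yb.
    have xy : x <= y by exact: le_trans sy.
    have hU t : x <= t -> t <= y -> U t.
      by move=> xt ty; apply: hd; exact: in_ball sx ysd xt ty.
    split; first by rewrite yb (le_trans x0).
    exists (rcons l (x, y)); split.
    - rewrite all_rcons /= x0 xy lexx /=; apply: sub_all l1 => p /and3P[-> ->] /= px.
      exact: le_trans xy.
    - rewrite pairwise_rcons l2 andbT; apply/allP => p /(allP l1) /and3P[_ _ px].
      by [].
    - by rewrite -cats1 big_cat big_seq1 (WB x y) // lerD2r.
    - rewrite -cats1 big_cat big_seq1 /= (PB x y) //.
      have h1 : `|G y - G 0| <= `|G x - G 0| + `|F y - F x| + `|H y - H x|.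
        have -> : G y - G 0 = (G x - G 0) + (F y - F x) - (H y - H x) by rewrite /G; ring.
        by apply: le_trans (ler_normB _ _) _; rewrite lerD2r ler_normD.
      have h2 : `|H y - H x| <= Rintegral mu `]x, y] (fun t => `|f0 t|).
        by rewrite HB //; apply: le_normr_Rintegral => //; exact: intf0A.
      have h3 : e * x <= e * y by rewrite ler_pM2l.
      exact: step_in h1 l4 h2 h3.
  (* Off U the functions F and H have the same derivative [f s] at s, so F - H has slope at most e
     near s, half of it from each function. The list of intervals stays unchanged. *)
  have [dFs [dHs HsE]] := UN s Is nUs.
  have e2 : 0 < e / 2 by rewrite divr_gt0.
  have [da da0 hda] := (rderivP _ _ _).1 dFs _ e2.
  have [db db0 hdb] : exists2 db : R, 0 < db & forall y, `|y - s| < db ->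
      `|H y - H s - f s * (y - s)| <= e / 2 * `|y - s|.
    have fE : f0 s = f s by rewrite /f0 patchE mem_set.
    have /cvgrPdist_le/(_ _ e2) : h^-1 *: (H (h *: 1 + s) - H s) @[h --> 0^'] --> f s.
      have L : 'D_1 H s = f s by rewrite -derive1E HsE.
      by rewrite -L; exact: dHs.
    move=> /nbhs_ballP[db /= db0 hdb]; exists db => // y yd.
    have [->|ys] := eqVneq y s; first by rewrite !subrr mulr0 subr0 normr0 mulr0.
    have ys0 : y - s != 0 by rewrite subr_eq0.
    have := hdb (y - s); rewrite /ball /= sub0r normrN => /(_ yd ys0).
    rewrite -[(y - s) *: 1]/((y - s) * 1) mulr1 subrK => h.
    have -> : H y - H s - f s * (y - s) = - ((f s - (y - s)^-1 *: (H y - H s)) * (y - s)).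
      rewrite -[_ *: _]/(_ * _); by field.
    by rewrite normrN normrM ler_wpM2r.
  exists (Num.min da db); first by rewrite lt_min da0.
  move=> x y [/andP[x0 xb] [l [l1 l2 l3 l4]]] sx xs sy ysd yb.
  have xy : x <= y by exact: le_trans sy.
  have G_lip t : 0 <= t -> t <= pi -> `|t - s| < Num.min da db -> `|G t - G s| <= e * `|t - s|.
    move=> t0 tpi; rewrite lt_min => /andP[ta tb].
    have -> : G t - G s = (F t - F s - f s * (t - s)) - (H t - H s - f s * (t - s)).
      by rewrite /G; ring.
    apply: le_trans (ler_normB _ _) _.
    have := hda t; rewrite I0piP t0 tpi => /(_ isT ta) h1; have h2 := hdb t tb.
    apply: le_trans (lerD h1 h2) _.
    by rewrite -mulrDl -splitr.
  split; first by rewrite yb (le_trans x0).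
  exists l; split => //.
  - by apply: sub_all l1 => p /and3P[-> ->] /= px; exact: le_trans xy.
  - apply: le_trans l3 _; apply: fine_le => //; apply: le_mu => //.
    by move=> t /= [Ut]; rewrite !in_itv /= => /andP[-> tx]; split => //; exact: le_trans xy.
  - have g1 : `|G y - G s| <= e * (y - s).
      rewrite -{1}(ger0_norm (x := y - s)) ?subr_ge0 //; apply: G_lip; [exact: le_trans sy|exact: le_trans bpi|].
      by rewrite ger0_norm ?subr_ge0 // ltrBlDl.
    have g2 : `|G x - G s| <= e * (s - x).
      rewrite -{1}(ger0_norm (x := s - x)) ?subr_ge0 // -(distrC x s); apply: G_lip; [by []|exact: le_trans xs (le_trans sb bpi)|].
      by rewrite distrC ger0_norm ?subr_ge0 // ltrBlDl -ltrBlDr.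
    have h1 : `|G y - G 0| <= `|G x - G 0| + `|G y - G s| + `|G x - G s|.
      have -> : G y - G 0 = (G x - G 0) + (G y - G s) - (G x - G s) by ring.
      by apply: le_trans (ler_normB _ _) _; rewrite lerD2r ler_normD.
    have h2 : P x <= P y.
      have sub : U `&` `[0, x] `<=` U `&` `[0, y].
        by move=> t /= [Ut]; rewrite !in_itv /= => /andP[-> tx]; split => //; exact: le_trans xy.
      have finP z : (\int[mu]_(t in U `&` `[0%R, z]) (`|f0 t|)%:E)%E \is a fin_num.
        by apply: integrable_fin_num; [exact: mUx|apply: intnf0A; exact: mUx].
      apply: fine_le; [exact: finP|exact: finP|].
      apply: ge0_subset_integral; [exact: mUx|exact: mUx| | |exact: sub] => //.
      exact: measurable_int (intnf0A _ (mUx y)).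
    have -> : e * y = e * x + (e * (y - s) + e * (s - x)) by ring.
    exact: step_out h1 l4 g1 g2 h2.
have [x Sx sx] : exists2 x, S x & s - d < x by apply: sup_adherent.
have xs : x <= s by apply: ub_le_sup => //; exists b.
(* If s < b, then a point of S just below s could be moved to a point beyond s, against the choice
   of s as supremum. *)
have Sb : S b.
  have Sy : S (Num.min b (s + d / 2)).
    apply: (step x) => //.
    - by rewrite le_min sb lerDl divr_ge0 // ltW.
    - by rewrite gt_min ltrD2l ltr_pdivrMr // ltr_pMr // ltr1n orbT.
    - by rewrite ge_min lexx.
  have : Num.min b (s + d / 2) <= s by apply: ub_le_sup => //; exists b.
  rewrite ge_min => /orP[bs|]; last by rewrite gerDl leNgt divr_gt0.
  by move: Sy; rewrite min_l // (le_trans bs) // lerDl divr_ge0 // ltW.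
have [_ [l [l1 l2 l3 l4]]] := Sb.
have Wb : W b < Num.min d1 d2.
  rewrite -lte_fin fineK //; apply: le_lt_trans mUd.
  by apply: le_mu => //; exact: subIsetl.
have hF : \sum_(p <- l) `|F p.2 - F p.1| < e.
  apply: hd1 => //.
    by apply: sub_all l1 => p /and3P[-> ->] /= px; exact: le_trans bpi.
  by apply: le_lt_trans l3 (lt_le_trans Wb _); rewrite ge_min lexx.
have hP : P b < e.
  apply: hd2; first exact: mUx.
  have Wd : ((W b)%:E < d2%:E)%E by rewrite lte_fin (lt_le_trans Wb) // ge_min lexx orbT.
  by apply: le_lt_trans Wd; rewrite /W fineK.
apply: le_trans l4 _; rewrite mulrDr -addrA lerD2l mulr_natr mulr2n.
by apply: lerD; exact: ltW.
Qed.

End AbsoluteContinuity.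

(** * Differential calculus on [0, pi] and Green's identity *)

Section RealCalculus.
Variable R : realType.
Local Notation mu := (@lebesgue_measure R).
Local Notation I := (@I0pi R).
Implicit Types (F G : R -> R).

Definition icontinuous F := forall x, I x -> forall e : R, 0 < e ->
  exists2 d : R, 0 < d & forall y, I y -> `|y - x| < d -> `|F y - F x| <= e.

Lemma icontinuous_within F : icontinuous F <-> {within I, continuous F}.
Proof.
split.
- move=> h; apply/subspace_continuousP => x Ix; apply/cvgrPdist_le => e e0.
  have [d d0 hd] := h x Ix e e0; apply/nbhs_ballP; exists d => //= y.
  by rewrite /ball /= distrC => yd Iy; rewrite distrC; exact: hd.
- move=> /subspace_continuousP h x Ix e e0.
  have /cvgrPdist_le/(_ e e0) := h x Ix.
  move=> /nbhs_ballP[d /= d0 hd]; exists d => // y Iy yd.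
  by rewrite distrC; apply: hd => //; rewrite /ball /= distrC.
Qed.

Lemma continuous_icontinuous F : continuous F -> icontinuous F.
Proof. by move=> cF; apply/icontinuous_within; exact: continuous_subspaceT. Qed.

Lemma icontinuous_integrable F (b : R) : icontinuous F -> b <= pi ->
  mu.-integrable `[0, b] (EFin \o F).
Proof.
move=> /icontinuous_within cF bpi.
have iF : mu.-integrable I (EFin \o F).
  by apply: continuous_compact_integrable => //; exact: segment_compact.
apply: integrableS iF; [exact: measurable_itv|exact: measurable_itv|].
by move=> x /=; rewrite in_itv /= => /andP[x0 xb]; apply/I0piP; rewrite x0 (le_trans xb).
Qed.

Lemma icontinuous_bounded F : icontinuous F -> exists2 K, 0 <= K & forall x, I x -> `|F x| <= K.
Proof.
move=> /icontinuous_within cF.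
have p0 : (0 : R) <= pi by exact: pi_ge0.
have [c _ hc] := EVT_max p0 cF; have [d _ hd] := EVT_min p0 cF.
exists (Num.max `|F c| `|F d|); first by rewrite le_max normr_ge0.
move=> x Ix; have h1 := hc x Ix; have h2 := hd x Ix.
rewrite ler_norml; apply/andP; split.
  apply: le_trans h2; rewrite lerNl; apply: le_trans (ler_norm _) _.
  by rewrite normrN le_max lexx orbT.
by apply: le_trans h1 _; apply: le_trans (ler_norm _) _; rewrite le_max lexx.
Qed.

Lemma icontinuous_measurable F : icontinuous F -> measurable_fun I F.
Proof.
move=> /icontinuous_within cF; apply: measurable_realfun.subspace_continuous_measurable_fun => //.
exact: measurable_I0pi.
Qed.

Lemma icontinuousD F G : icontinuous F -> icontinuous G -> icontinuous (fun x => F x + G x).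
Proof.
move=> /icontinuous_within cF /icontinuous_within cG; apply/icontinuous_within.
by move=> x; apply: cvgD; [exact: cF|exact: cG].
Qed.

Lemma icontinuousM F G : icontinuous F -> icontinuous G -> icontinuous (fun x => F x * G x).
Proof.
move=> /icontinuous_within cF /icontinuous_within cG; apply/icontinuous_within.
by move=> x; apply: cvgM; [exact: cF|exact: cG].
Qed.

Lemma rabs_continuous_continuous F : rabs_continuous F -> icontinuous F.
Proof.
move=> acF x /I0piP/andP[x0 xpi] e e0; have [d d0 hd] := rabs_continuous_seq acF e0.
exists d => // y /I0piP/andP[y0 ypi] yd; apply: ltW.
have [xy|/ltW yx] := leP x y.
  have := hd [:: (x, y)]; rewrite !big_seq1 /= x0 xy ypi; apply => //.
  by move: yd; rewrite ger0_norm // subr_ge0.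
have := hd [:: (y, x)]; rewrite !big_seq1 /= y0 yx xpi distrC; apply => //.
by move: yd; rewrite distrC ger0_norm // subr_ge0.
Qed.

Lemma rderiv_continuous F F1 : (forall x, I x -> rderiv F x (F1 x)) -> icontinuous F.
Proof.
move=> dF x Ix e e0.
have [d d0 hd] := (rderivP _ _ _).1 (dF x Ix) 1 ltr01.
have k0 : 0 < 1 + `|F1 x| by rewrite ltr_pwDl.
exists (Num.min d (e / (1 + `|F1 x|))); first by rewrite lt_min d0 divr_gt0.
move=> y Iy; rewrite lt_min => /andP[yd ye].
have -> : F y - F x = (F y - F x - F1 x * (y - x)) + F1 x * (y - x) by ring.
apply: le_trans (ler_normD _ _) _.
apply: (@le_trans _ _ ((1 + `|F1 x|) * `|y - x|)).
  by rewrite mulrDl lerD ?normrM // hd.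
by rewrite mulrC -ler_pdivlMr // ltW.
Qed.

Lemma rderivD F G x l m : rderiv F x l -> rderiv G x m -> rderiv (fun t => F t + G t) x (l + m).
Proof.
move=> hF hG; rewrite /rderiv.
rewrite (_ : (fun y => _) = fun y => (F y - F x) / (y - x) + (G y - G x) / (y - x)).
  exact: cvgD hF hG.
by apply/funext => y; rewrite -mulrDl opprD addrACA.
Qed.

Lemma rderivZ F x k l : rderiv F x l -> rderiv (fun t => k * F t) x (k * l).
Proof.
move=> hF; rewrite /rderiv.
rewrite (_ : (fun y => _) = fun y => k * ((F y - F x) / (y - x))).
  by apply: cvgM => //; exact: cvg_cst.
by apply/funext => y; rewrite mulrA mulrBr.
Qed.

Lemma rderivM F G x l m : icontinuous G -> I x -> rderiv F x l -> rderiv G x m ->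
  rderiv (fun t => F t * G t) x (l * G x + F x * m).
Proof.
move=> cG Ix hF hG; rewrite /rderiv.
rewrite (_ : (fun y => _) = fun y => (F y - F x) / (y - x) * G y + F x * ((G y - G x) / (y - x))).
  apply: cvgD; last by apply: cvgM => //; exact: cvg_cst.
  apply: cvgM => //; apply/cvgrPdist_le => e e0; have [d d0 hd] := cG x Ix e e0.
  apply/nbhs_ballP; exists d => //= y; rewrite /ball /= distrC => yd yx Iy.
  by rewrite distrC; exact: hd.
by apply/funext => y; rewrite mulrAC mulrA -mulrDl; congr (_ / _); ring.
Qed.

Lemma is_derive_rderiv F (x l : R) : is_derive x 1 F l -> rderiv F x l.
Proof.
move=> [dF /esym lE]; apply/rderivP => e e0.
have /cvgrPdist_le/(_ _ e0) : h^-1 *: (F (h *: 1 + x) - F x) @[h --> 0^'] --> l.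
  by rewrite lE; exact: dF.
move=> /nbhs_ballP[d /= d0 hd]; exists d => // y Iy yd.
have [->|ys] := eqVneq y x; first by rewrite !subrr mulr0 subr0 normr0 mulr0.
have ys0 : y - x != 0 by rewrite subr_eq0.
have := hd (y - x); rewrite /ball /= sub0r normrN => /(_ yd ys0).
rewrite -[(y - x) *: 1]/((y - x) * 1) mulr1 subrK => h.
have -> : F y - F x - l * (y - x) = - ((l - (y - x)^-1 *: (F y - F x)) * (y - x)).
  rewrite -[_ *: _]/(_ * _); by field.
by rewrite normrN normrM ler_wpM2r.
Qed.

Lemma rderiv_is_derive F (x l : R) : 0 < x < pi -> rderiv F x l -> is_derive x 1 F l.
Proof.
move=> /andP[x0 xpi] /rderivP hF.
have L : h^-1 *: (F (h *: 1 + x) - F x) @[h --> 0^'] --> l.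
  apply/cvgrPdist_le => e e0; have [d d0 hd] := hF e e0.
  have m0 : 0 < Num.min d (Num.min x (pi - x)) by rewrite !lt_min d0 x0 subr_gt0.
  apply/nbhs_ballP; exists (Num.min d (Num.min x (pi - x))) => //= h.
  rewrite /ball /= sub0r normrN !lt_min => /and3P[h1 h2 h3] h0.
  rewrite -[h *: 1]/(h * 1) mulr1 -[_ *: _]/(_ * _).
  have := hd (h + x); rewrite addrK => /(_ _ h1).
  have Ihx : I (h + x).
    apply/I0piP; move: h2 h3; rewrite !ltr_norml => /andP[a1 _] /andP[_ a2].
    by apply/andP; split; lra.
  move=> /(_ Ihx) hh.
  have -> : l - h^-1 * (F (h + x) - F x) = - (F (h + x) - F x - l * h) / h by field.
  by rewrite normrM normrN normfV ler_pdivrMr // normr_gt0.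
apply: DeriveDef; first by apply/cvg_ex; exists l; exact: L.
by apply/cvg_lim; [exact: Rhausdorff|exact: L].
Qed.

Lemma rderiv_lipschitz F F1 K : (forall x, I x -> rderiv F x (F1 x)) ->
  (forall x, I x -> `|F1 x| <= K) ->
  forall x y, I x -> I y -> `|F y - F x| <= K * `|y - x|.
Proof.
move=> dF F1K.
have H x y : x < y -> I x -> I y -> `|F y - F x| <= K * `|y - x|.
  move=> xy /I0piP/andP[x0 xpi] /I0piP/andP[y0 ypi].
  have cF : {within `[x, y], continuous F}.
    have cI : {within I, continuous F}.
      by apply/icontinuous_within; exact: rderiv_continuous dF.
    apply: continuous_subspaceW cI => t /=; rewrite in_itv /= => /andP[xt ty].
    by apply/I0piP; rewrite (le_trans x0) ?(le_trans ty).
  have der t : t \in `]x, y[ -> is_derive t 1 F (F1 t).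
    rewrite in_itv /= => /andP[xt ty]; apply: rderiv_is_derive.
      by rewrite (le_lt_trans x0) // (lt_le_trans ty).
    by apply: dF; apply/I0piP; rewrite (le_trans x0 (ltW xt)) (le_trans (ltW ty)).
  have [c] := MVT xy der cF; rewrite in_itv /= => /andP[xc cy] ->.
  rewrite normrM ler_wpM2r // F1K //.
  by apply/I0piP; rewrite (le_trans x0 (ltW xc)) (le_trans (ltW cy)).
move=> x y Ix Iy; have [xy|yx|->] := ltgtP x y; first exact: H.
  by rewrite distrC (distrC y); exact: H.
by rewrite !subrr normr0 mulr0.
Qed.

Lemma rabs_continuousD F G : rabs_continuous F -> rabs_continuous G ->
  rabs_continuous (fun x => F x + G x).
Proof.
move=> hF hG e e0; have e2 : 0 < e / 2 by rewrite divr_gt0.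
have [d d0 hd] := hF _ e2; have [d' d0' hd'] := hG _ e2.
exists (Num.min d d'); first by rewrite lt_min d0.
move=> m a b ab tab; rewrite lt_min => /andP[s1 s2].
have h1 := hd m a b ab tab s1; have h2 := hd' m a b ab tab s2.
apply: (@le_lt_trans _ _ (\sum_(i < m) `|F (b i) - F (a i)| + \sum_(i < m) `|G (b i) - G (a i)|)).
  rewrite -big_split /=; apply: ler_sum => i _.
  by rewrite opprD addrACA ler_normD.
by rewrite (splitr e) ltrD.
Qed.

Lemma rabs_continuousM F G : rabs_continuous F -> rabs_continuous G ->
  rabs_continuous (fun x => F x * G x).
Proof.
move=> hF hG e e0.
have [K K0 FK] := icontinuous_bounded (rabs_continuous_continuous hF).
have [L L0 GL] := icontinuous_bounded (rabs_continuous_continuous hG).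
have k0 : 0 < K + L + 1 by rewrite ltr_wpDl // addr_ge0.
have e2 : 0 < e / 2 / (K + L + 1) by rewrite !divr_gt0.
have [d d0 hd] := hF _ e2; have [d' d0' hd'] := hG _ e2.
exists (Num.min d d'); first by rewrite lt_min d0.
move=> m a b ab tab; rewrite lt_min => /andP[s1 s2].
have h1 := hd m a b ab tab s1; have h2 := hd' m a b ab tab s2.
apply: (@le_lt_trans _ _ ((K + L + 1) * (\sum_(i < m) `|F (b i) - F (a i)| + \sum_(i < m) `|G (b i) - G (a i)|))).
  rewrite -big_split mulr_sumr /=; apply: ler_sum => i _.
  have [a0 lab bpi] := ab i.
  have Ia : I (a i) by apply/I0piP; rewrite a0 (le_trans lab).
  have Ib : I (b i) by apply/I0piP; rewrite (le_trans a0).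
  have -> : F (b i) * G (b i) - F (a i) * G (a i) =
    (F (b i) - F (a i)) * G (b i) + F (a i) * (G (b i) - G (a i)) by ring.
  apply: le_trans (ler_normD _ _) _; rewrite !normrM mulrDr; apply: lerD.
    rewrite mulrC ler_wpM2r //; apply: le_trans (GL _ Ib) _.
    by rewrite addrAC lerDr addr_ge0.
  rewrite ler_wpM2r //; apply: le_trans (FK _ Ia) _.
  by rewrite -addrA lerDl addr_ge0.
rewrite mulrC -ltr_pdivlMr //.
by apply: lt_le_trans (ltrD h1 h2) _; rewrite -mulrDl -splitr.
Qed.

Lemma lipschitz_rabs_continuous F K : 0 <= K ->
  (forall x y, I x -> I y -> `|F y - F x| <= K * `|y - x|) -> rabs_continuous F.
Proof.
move=> K0 FK e e0; have k0 : 0 < K + 1 by rewrite ltr_wpDl.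
exists (e / (K + 1)); first by rewrite divr_gt0.
move=> m a b ab _ sd.
apply: (@le_lt_trans _ _ ((K + 1) * \sum_(i < m) (b i - a i))).
  rewrite mulr_sumr; apply: ler_sum => i _; have [a0 lab bpi] := ab i.
  have Ia : I (a i) by apply/I0piP; rewrite a0 (le_trans lab).
  have Ib : I (b i) by apply/I0piP; rewrite (le_trans a0).
  apply: le_trans (FK _ _ Ia Ib) _; rewrite ger0_norm ?subr_ge0 //.
  by rewrite ler_wpM2r ?subr_ge0 // lerDl.
by rewrite mulrC -ltr_pdivlMr.
Qed.

Lemma is_derive_cos_affine (k c x : R) :
  is_derive x 1 (fun t : R => cos (k * t + c)) (- sin (k * x + c) * k).
Proof.
apply: (@is_derive1_comp _ cos (fun t => k * t + c)).
rewrite -[X in is_derive _ _ _ X]addr0; apply: is_deriveD.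
rewrite -[X in is_derive _ _ _ X]mulr1.
exact: (@is_deriveZ _ _ _ id k x 1 1).
Qed.

Lemma is_derive_sin_affine (k c x : R) :
  is_derive x 1 (fun t : R => sin (k * t + c)) (cos (k * x + c) * k).
Proof.
apply: (@is_derive1_comp _ sin (fun t => k * t + c)).
rewrite -[X in is_derive _ _ _ X]addr0; apply: is_deriveD.
rewrite -[X in is_derive _ _ _ X]mulr1.
exact: (@is_deriveZ _ _ _ id k x 1 1).
Qed.

Lemma cos_affine_continuous (k c : R) : icontinuous (fun t => cos (k * t + c)).
Proof.
apply: continuous_icontinuous => x.
exact/differentiable_continuous/derivable1_diffP/(@ex_derive _ _ _ _ _ _ _ (is_derive_cos_affine k c x)).
Qed.

Lemma sin_affine_continuous (k c : R) : icontinuous (fun t => sin (k * t + c)).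
Proof.
apply: continuous_icontinuous => x.
exact/differentiable_continuous/derivable1_diffP/(@ex_derive _ _ _ _ _ _ _ (is_derive_sin_affine k c x)).
Qed.

Lemma cos_affine_abs_continuous (k c : R) : rabs_continuous (fun t => cos (k * t + c)).
Proof.
apply: (@lipschitz_rabs_continuous _ `|k|) => //.
apply: (@rderiv_lipschitz _ (fun t => - sin (k * t + c) * k)) => x _.
  exact: is_derive_rderiv (is_derive_cos_affine k c x).
by rewrite normrM normrN ler_piMl // sin_max.
Qed.

Lemma sin_affine_abs_continuous (k c : R) : rabs_continuous (fun t => sin (k * t + c)).
Proof.
apply: (@lipschitz_rabs_continuous _ `|k|) => //.
apply: (@rderiv_lipschitz _ (fun t => cos (k * t + c) * k)) => x _.
  exact: is_derive_rderiv (is_derive_sin_affine k c x).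
by rewrite normrM ler_piMl // cos_max.
Qed.

Lemma integrable_Mcontinuous F G : mu.-integrable I (EFin \o F) -> icontinuous G ->
  mu.-integrable I (EFin \o (fun x => F x * G x)).
Proof.
move=> iF cG; have [K K0 GK] := icontinuous_bounded cG.
have mF : measurable_fun I F by apply/measurable_EFinP; exact: measurable_int iF.
have iG := integrableZl (@measurable_I0pi R) K iF.
apply: le_integrable iG; first exact: measurable_I0pi.
- by apply/measurable_EFinP; apply: measurable_funM => //; exact: icontinuous_measurable.
- move=> x Ix /=; rewrite lee_fin !normrM mulrC ler_wpM2r //.
  by apply: le_trans (GK x Ix) _; rewrite ler_norm.
Qed.

(* Green's identity for F against cos (k t + c), in one stroke: the function
   F1 cos (k t + c) + k F sin (k t + c) has derivative (F2 + k^2 F) cos (k t + c). *)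
Lemma green_cos F F1 F2 (k c b : R) :
  (forall x, I x -> rderiv F x (F1 x)) -> rabs_continuous F1 ->
  {ae mu, forall x, I x -> rderiv F1 x (F2 x)} ->
  mu.-integrable I (EFin \o F2) -> 0 <= b <= pi ->
  F1 b * cos (k * b + c) + k * F b * sin (k * b + c)
  - (F1 0 * cos c + k * F 0 * sin c)
  = Rintegral mu `[0, b] (fun t => (F2 t + k ^+ 2 * F t) * cos (k * t + c)).
Proof.
move=> dF acF1 dF1 iF2 bI.
have cF := rderiv_continuous dF.
have [K K0 F1K] := icontinuous_bounded (rabs_continuous_continuous acF1).
have acF : rabs_continuous F by exact: lipschitz_rabs_continuous K0 (rderiv_lipschitz dF F1K).
pose G t := F1 t * cos (k * t + c) + k * (F t * sin (k * t + c)).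
have accst : rabs_continuous (fun=> k).
  by apply: (@lipschitz_rabs_continuous _ 0) => // x y _ _; rewrite subrr normr0 mul0r.
rewrite -(@abs_continuous_FTC _ G) //.
- by rewrite /G mulr0 add0r !mulrA.
- apply: rabs_continuousD; first exact: rabs_continuousM (cos_affine_abs_continuous k c).
  by apply: rabs_continuousM => //; exact: rabs_continuousM (sin_affine_abs_continuous k c).
- apply: filterS dF1; first exact: (ae_filter_ringOfSetsType mu).
  move=> x h Ix.
  have -> : (F2 x + k ^+ 2 * F x) * cos (k * x + c) =
    (F2 x * cos (k * x + c) + F1 x * (- sin (k * x + c) * k)) +
    k * (F1 x * sin (k * x + c) + F x * (cos (k * x + c) * k)) by ring.
  apply: rderivD.
    apply: rderivM => //; [exact: cos_affine_continuous|exact: h|].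
    exact: is_derive_rderiv (is_derive_cos_affine k c x).
  apply: rderivZ; apply: rderivM => //; [exact: sin_affine_continuous|exact: dF|].
  exact: is_derive_rderiv (is_derive_sin_affine k c x).
- apply: integrable_Mcontinuous; last exact: cos_affine_continuous.
  rewrite (_ : _ \o _ = (EFin \o F2) \+ (fun x => (k ^+ 2)%:E * (F x)%:E)%E) //.
  apply: integrableD => //; first exact: measurable_I0pi.
  by apply: integrableZl; [exact: measurable_I0pi|exact: icontinuous_integrable].
Qed.

End RealCalculus.

(** * Fourier coefficients *)

Section ComplexIntegral.
Variable R : realType.
Local Notation mu := (@lebesgue_measure R).
Local Notation I := (@I0pi R).
Implicit Types (f g : R -> R[i]) (A : set R).

Let mI : measurable (I : set (measurableTypeR R)).
Proof. exact: measurable_I0pi. Qed.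

Lemma expiD (s t : R) : expi (s + t) = expi s * expi t.
Proof. by apply: complex_eq; rewrite ?cReM ?cImM /expi /= ?cosD ?sinD; ring. Qed.

Lemma expi0 : expi (0 : R) = 1.
Proof. by rewrite /expi cos0 sin0. Qed.

Lemma cmod_expi (t : R) : cmod (expi t) = 1.
Proof. by rewrite cmodE /= cos2Dsin2 sqrtr1. Qed.

Lemma expiNK (t : R) : expi (- t) * expi t = 1.
Proof. by rewrite -expiD addNr expi0. Qed.

Definition cintegrable A f : Prop :=
  mu.-integrable A (EFin \o (fun x => complex.Re (f x))) /\
  mu.-integrable A (EFin \o (fun x => complex.Im (f x))).

Definition cint A f : R[i] :=
  Rintegral mu A (fun x => complex.Re (f x)) +i* Rintegral mu A (fun x => complex.Im (f x)).

Lemma integrableD_real A (F G : R -> R) : measurable (A : set (measurableTypeR R)) ->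
  mu.-integrable A (EFin \o F) -> mu.-integrable A (EFin \o G) ->
  mu.-integrable A (EFin \o (fun x => F x + G x)).
Proof.
by move=> mA iF iG; rewrite (_ : _ \o _ = (EFin \o F) \+ (EFin \o G)) //; exact: integrableD.
Qed.

Lemma integrableZ_real A (k : R) (F : R -> R) : measurable (A : set (measurableTypeR R)) ->
  mu.-integrable A (EFin \o F) -> mu.-integrable A (EFin \o (fun x => k * F x)).
Proof. by move=> mA iF; exact (integrableZl mA k iF). Qed.

Lemma cintegrableD A f g : measurable (A : set (measurableTypeR R)) ->
  cintegrable A f -> cintegrable A g -> cintegrable A (fun x => f x + g x).
Proof.
move=> mA [f1 f2] [g1 g2]; split; under eq_fun do rewrite ?cReD ?cImD;
exact: integrableD_real.
Qed.

Lemma cintD A f g : measurable (A : set (measurableTypeR R)) ->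
  cintegrable A f -> cintegrable A g ->
  cint A (fun x => f x + g x) = cint A f + cint A g.
Proof.
move=> mA [f1 f2] [g1 g2]; rewrite /cint.
under eq_fun do rewrite cReD; under [X in _ +i* Rintegral _ _ X]eq_fun do rewrite cImD.
by rewrite !RintegralD.
Qed.

Lemma cintegrableZ A (k : R[i]) f : measurable (A : set (measurableTypeR R)) ->
  cintegrable A f -> cintegrable A (fun x => k * f x).
Proof.
move=> mA [f1 f2]; split.
  under eq_fun do rewrite cReM -mulNr.
  by apply: integrableD_real => //; exact: integrableZ_real.
under eq_fun do rewrite cImM.
by apply: integrableD_real => //; exact: integrableZ_real.
Qed.

Lemma cintZ A (k : R[i]) f : measurable (A : set (measurableTypeR R)) ->
  cintegrable A f -> cint A (fun x => k * f x) = k * cint A f.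
Proof.
move=> mA [f1 f2]; rewrite /cint.
under eq_fun do rewrite cReM -mulNr; under [X in _ +i* Rintegral _ _ X]eq_fun do rewrite cImM.
rewrite !RintegralD //; [|exact: integrableZ_real..].
by rewrite !RintegralZl //; apply: complex_eq; rewrite ?cReM ?cImM /= ?mulNr.
Qed.

Lemma eq_cint A f g : (forall x, A x -> f x = g x) -> cint A f = cint A g.
Proof.
by move=> fg; rewrite /cint; congr (_ +i* _); apply: eq_Rintegral => x; rewrite inE => Ax;
  rewrite fg.
Qed.

Lemma cintN A f : measurable (A : set (measurableTypeR R)) ->
  cintegrable A f -> cint A (fun x => - f x) = - cint A f.
Proof.
move=> mA If; rewrite -mulN1r -cintZ //; apply: eq_cint => x _.
by rewrite mulN1r.
Qed.

Lemma cintegrableN A f : measurable (A : set (measurableTypeR R)) ->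
  cintegrable A f -> cintegrable A (fun x => - f x).
Proof.
move=> mA If; under eq_fun do rewrite -mulN1r; exact: cintegrableZ.
Qed.

Lemma cintegrableB A f g : measurable (A : set (measurableTypeR R)) ->
  cintegrable A f -> cintegrable A g -> cintegrable A (fun x => f x - g x).
Proof. by move=> mA If Ig; apply: cintegrableD => //; exact: cintegrableN. Qed.

Lemma cintB A f g : measurable (A : set (measurableTypeR R)) ->
  cintegrable A f -> cintegrable A g ->
  cint A (fun x => f x - g x) = cint A f - cint A g.
Proof. by move=> mA If Ig; rewrite cintD ?cintN //; exact: cintegrableN. Qed.

Lemma eq_cintegrable A f g : measurable (A : set (measurableTypeR R)) ->
  (forall x, A x -> f x = g x) -> cintegrable A f -> cintegrable A g.
Proof.
move=> mA fg [f1 f2]; split.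
  by apply: eq_integrable f1 => // x; rewrite inE => Ax /=; rewrite fg.
by apply: eq_integrable f2 => // x; rewrite inE => Ax /=; rewrite fg.
Qed.

Lemma cintegrable_cmod A f : measurable (A : set (measurableTypeR R)) ->
  cintegrable A f -> mu.-integrable A (EFin \o (fun x => cmod (f x))).
Proof.
move=> mA [f1 f2].
have n1 := integrable_norm f1; have n2 := integrable_norm f2.
apply: le_integrable (integrableD_real mA n1 n2) => //.
- apply/measurable_EFinP; under eq_fun do rewrite cmodE.
  apply: measurableT_comp; first exact: continuous_measurable_fun (@sqrt_continuous R).
  apply: measurable_funD; apply: measurable_funX; apply/measurable_EFinP.
    exact: measurable_int f1.
  exact: measurable_int f2.
- move=> x Ax /=; rewrite lee_fin ger0_norm ?cmod_ge0 //.
  exact: le_trans (cmod_le_ReIm _) (ler_norm _).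
Qed.

(** The same rotation as for [csum_le]: multiplying by the conjugate of the integral reduces the
    estimate to a real part. *)
Lemma cint_le A f : measurable (A : set (measurableTypeR R)) -> cintegrable A f ->
  cmod (cint A f) <= Rintegral mu A (fun x => cmod (f x)).
Proof.
move=> mA If; have [->|w0] := eqVneq (cint A f) 0.
  by rewrite cmod0; apply: Rintegral_ge0 => x _; exact: cmod_ge0.
set w := cint A f in w0 *; have wp := cmod_gt0 w0.
rewrite -(ler_pM2l wp).
have Iwf := cintegrableZ (conjc w) mA If.
have -> : cmod w * cmod w = complex.Re (cint A (fun x => conjc w * f x)).
  rewrite cintZ // -/w cmodE -expr2 sqr_sqrtr ?addr_ge0 ?sqr_ge0 //.
  by case: (w) => a b /=; ring.
have Ic := cintegrable_cmod mA If.
rewrite -RintegralZl // /cint /=; apply: le_Rintegral => //.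
- by case: Iwf.
- exact: integrableZ_real.
- move=> x Ax; apply: le_trans (ler_norm _) _; apply: le_trans (Re_le_cmod _) _.
  rewrite cmodM; suff -> : cmod (conjc w) = cmod w by [].
  by case: (w) => a b; rewrite !cmodE /= sqrrN.
Qed.

Definition cmeasurable f : Prop :=
  measurable_fun I (fun x => complex.Re (f x)) /\ measurable_fun I (fun x => complex.Im (f x)).

Definition cbounded f (K : R) := forall x, I x -> cmod (f x) <= K.

Lemma cmeasurableM f g : cmeasurable f -> cmeasurable g -> cmeasurable (fun x => f x * g x).
Proof.
move=> [f1 f2] [g1 g2]; split; under eq_fun do rewrite ?cReM ?cImM.
  by apply: measurable_funB; apply: measurable_funM.
by apply: measurable_funD; apply: measurable_funM.
Qed.

Lemma cmeasurableD f g : cmeasurable f -> cmeasurable g -> cmeasurable (fun x => f x + g x).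
Proof.
by move=> [f1 f2] [g1 g2]; split; under eq_fun do rewrite ?cReD ?cImD;
  apply: measurable_funD.
Qed.

Lemma cmeasurable_cst (k : R[i]) : cmeasurable (fun=> k).
Proof. by split; exact: measurable_cst. Qed.

Lemma cmeasurableN f : cmeasurable f -> cmeasurable (fun x => - f x).
Proof.
move=> mf; under eq_fun do rewrite -mulN1r.
by apply: cmeasurableM => //; exact: cmeasurable_cst.
Qed.

Lemma cmeasurableB f g : cmeasurable f -> cmeasurable g -> cmeasurable (fun x => f x - g x).
Proof. by move=> mf mg; apply: cmeasurableD => //; exact: cmeasurableN. Qed.

Lemma icontinuous_cmeasurable f : icontinuous (fun x => complex.Re (f x)) ->
  icontinuous (fun x => complex.Im (f x)) -> cmeasurable f.
Proof. by move=> c1 c2; split; exact: icontinuous_measurable. Qed.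

Lemma expi_affine_cmeasurable (k c : R) : cmeasurable (fun x => expi (k * x + c)).
Proof.
by apply: icontinuous_cmeasurable; [exact: cos_affine_continuous|exact: sin_affine_continuous].
Qed.

Lemma expi_lin_cmeasurable (k : R) : cmeasurable (fun x => expi (k * x)).
Proof. by under eq_fun do rewrite -[_ * _]addr0; exact: expi_affine_cmeasurable. Qed.

Lemma expiN_lin_cmeasurable (k : R) : cmeasurable (fun x => expi (- (k * x))).
Proof. by under eq_fun do rewrite -mulNr; exact: expi_lin_cmeasurable. Qed.

Lemma integrable_Mbounded (F G : R -> R) K : mu.-integrable I (EFin \o F) ->
  measurable_fun I G -> (forall x, I x -> `|G x| <= K) ->
  mu.-integrable I (EFin \o (fun x => F x * G x)).
Proof.
move=> iF mG GK.
have mF : measurable_fun I F by apply/measurable_EFinP; exact: measurable_int iF.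
have iG := integrableZl mI K iF.
apply: le_integrable iG => //.
- by apply/measurable_EFinP; apply: measurable_funM.
- move=> x Ix /=; rewrite lee_fin !normrM mulrC ler_wpM2r //.
  by apply: le_trans (GK x Ix) _; rewrite ler_norm.
Qed.

Lemma cintegrableM f g K : cintegrable I f -> cmeasurable g -> cbounded g K ->
  cintegrable I (fun x => f x * g x).
Proof.
move=> [f1 f2] [g1 g2] gK.
have r1 x : I x -> `|complex.Re (g x)| <= K.
  by move=> Ix; exact: le_trans (Re_le_cmod _) (gK x Ix).
have r2 x : I x -> `|complex.Im (g x)| <= K.
  by move=> Ix; exact: le_trans (Im_le_cmod _) (gK x Ix).
split.
  under eq_fun do rewrite cReM -mulN1r.
  apply: integrableD_real => //; first exact: integrable_Mbounded f1 g1 r1.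
  by apply: integrableZ_real => //; exact: integrable_Mbounded f2 g2 r2.
under eq_fun do rewrite cImM.
by apply: integrableD_real => //; [exact: integrable_Mbounded f1 g2 r2|exact: integrable_Mbounded f2 g1 r1].
Qed.

Lemma cintegrable_cst (k : R[i]) : cintegrable I (fun=> k).
Proof.
have H (K : R) : mu.-integrable I (EFin \o (fun=> K)).
  by apply: icontinuous_integrable => //; apply: continuous_icontinuous => x; exact: cvg_cst.
by split; exact: H.
Qed.

Lemma cintegrable_bounded f K : cmeasurable f -> cbounded f K -> cintegrable I f.
Proof.
move=> mf fK; apply: eq_cintegrable (cintegrableM (cintegrable_cst 1) mf fK) => // x _.
by rewrite mul1r.
Qed.

Lemma cbounded_expi (h : R -> R) : cbounded (fun x => expi (h x)) 1.
Proof. by move=> x _; rewrite cmod_expi. Qed.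

Lemma cintegrable_expi f (k : R) : cintegrable I f -> cintegrable I (fun x => f x * expi (- (k * x))).
Proof.
move=> If; apply: (@cintegrableM _ _ 1) => //; first exact: expiN_lin_cmeasurable.
exact: cbounded_expi.
Qed.

Lemma fourierE f m : fourier f m = (pi^-1)%:C * cint I (fun x => f x * expi (- (m%:~R * x))).
Proof. by []. Qed.

Lemma fourierD f g m : cintegrable I f -> cintegrable I g ->
  fourier (fun x => f x + g x) m = fourier f m + fourier g m.
Proof.
move=> If Ig; rewrite !fourierE -mulrDr -cintD //; try exact: cintegrable_expi.
by congr (_ * _); apply: eq_cint => x _; rewrite mulrDl.
Qed.

Lemma fourierZ k f m : cintegrable I f -> fourier (fun x => k * f x) m = k * fourier f m.
Proof.
move=> If; rewrite !fourierE mulrCA; apply: (congr1 (fun u => _ * u)).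
rewrite -cintZ; [|exact: mI|exact: cintegrable_expi].
by apply: eq_cint => x _; rewrite mulrA.
Qed.

Lemma fourierN f m : cintegrable I f -> fourier (fun x => - f x) m = - fourier f m.
Proof.
move=> If; have -> : (fun x => - f x) = (fun x => (-1) * f x).
  by apply/funext => x; rewrite mulN1r.
by rewrite fourierZ // mulN1r.
Qed.

Lemma fourierB f g m : cintegrable I f -> cintegrable I g ->
  fourier (fun x => f x - g x) m = fourier f m - fourier g m.
Proof. by move=> If Ig; rewrite fourierD ?fourierN //; exact: cintegrableN. Qed.

Lemma eq_fourier f g m : (forall x, I x -> f x = g x) -> fourier f m = fourier g m.
Proof. by move=> fg; rewrite !fourierE; congr (_ * _); apply: eq_cint => x Ix; rewrite fg. Qed.

Lemma fourier_le f m : cintegrable I f ->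
  cmod (fourier f m) <= pi^-1 * Rintegral mu I (fun x => cmod (f x)).
Proof.
move=> If; rewrite fourierE cmodM cmod_real ger0_norm ?invr_ge0 ?pi_ge0 //.
rewrite ler_wpM2l ?invr_ge0 ?pi_ge0 //; apply: le_trans (cint_le mI _) _.
  exact: cintegrable_expi.
rewrite le_eqVlt; apply/orP; left; apply/eqP; apply: eq_Rintegral => x _.
by rewrite cmodM cmod_expi mulr1.
Qed.

Lemma Rintegral_pi_cst (K : R) : Rintegral mu I (fun=> K) = K * pi.
Proof.
have E : mu I = pi%:E.
  by rewrite /I0pi lebesgue_measure_itv /= lte_fin pi_gt0 oppr0 adde0.
transitivity (K * fine (mu I)); last by rewrite E.
by apply: Rintegral_cst; exact: mI.
Qed.

Lemma fourier_le_bound f m K : cmeasurable f -> cbounded f K -> cmod (fourier f m) <= K.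
Proof.
move=> mf fK; have If := cintegrable_bounded mf fK.
apply: le_trans (fourier_le m If) _.
have -> : K = pi^-1 * (K * pi) by rewrite mulrCA mulVf ?mulr1 // gt_eqF // pi_gt0.
rewrite ler_wpM2l ?invr_ge0 ?pi_ge0 // -Rintegral_pi_cst; apply: le_Rintegral => //.
- exact: cintegrable_cmod.
- by have [] := cintegrable_cst K%:C.
Qed.

End ComplexIntegral.

(** * Bessel's inequality and pointwise Fourier inversion *)

Section Inversion.
Variable R : realType.
Local Notation mu := (@lebesgue_measure R).
Local Notation I := (@I0pi R).
Implicit Types (f g : R -> R[i]) (n : nat) (l : int).

Let mI : measurable (I : set (measurableTypeR R)).
Proof. exact: measurable_I0pi. Qed.

Lemma trig_int_pi (m : int) (c : R) : cos (m%:~R * pi *+ 2 + c) = cos c :> R /\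
  sin (m%:~R * pi *+ 2 + c) = sin c :> R.
Proof.
have H (d : R) (k : nat) : cos (d + pi *+ 2 *+ k) = cos d /\ sin (d + pi *+ 2 *+ k) = sin d.
  by rewrite (periodicn (@cosD2pi R)) (periodicn (@sinD2pi R)).
rewrite mulrzl; case: m => k.
  rewrite (_ : pi *~ k = pi *+ k) // mulrnAC addrC; exact: H.
rewrite (_ : pi *~ Negz k = - (pi *+ k.+1)) // mulNrn mulrnAC.
set d := _ + c; have <- : d + pi *+ 2 *+ k.+1 = c by rewrite /d addrAC addNr add0r.
by have [-> ->] := H d k.+1.
Qed.

(** Green's identity for the constant function 1: the boundary terms agree by periodicity. The
    shifts 0 and - pi / 2 give the real and the imaginary part. *)
Lemma cint_expi (m : int) : m != 0 ->
  cint I (fun x : R => expi (2 * m%:~R * x)) = 0.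
Proof.
move=> m0; have k0 : 2 * m%:~R != 0 :> R by rewrite mulf_neq0 ?intr_eq0.
have G c : Rintegral mu I (fun t => cos (2 * m%:~R * t + c)) = 0.
  have d1 x : I x -> rderiv (fun=> 1) x (0 : R).
    by move=> _; apply: is_derive_rderiv; exact: is_derive_cst.
  have a0 : rabs_continuous (fun=> 0 : R).
    by apply: (@lipschitz_rabs_continuous _ _ 0) => // x y _ _; rewrite subrr normr0 mul0r.
  have d0 : {ae mu, forall x, I x -> rderiv (fun=> 0) x (0 : R)}.
    by apply: aeW => x _; apply: is_derive_rderiv; exact: is_derive_cst.
  have i0 : mu.-integrable I (EFin \o (fun=> 0)).
    by apply: icontinuous_integrable => //; apply: continuous_icontinuous => x; exact: cvg_cst.
  set k := 2 * m%:~R in k0 *.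
  have ks : sin (k * pi + c) = sin c by rewrite /k -mulrA mulr_natl (trig_int_pi m c).2.
  have := green_cos k c d1 a0 d0 i0 (b := pi).
  rewrite pi_ge0 lexx => /(_ isT).
  rewrite ks !mul0r !add0r !mulr1 subrr => /esym.
  rewrite RintegralZl //; last first.
    by apply: icontinuous_integrable => //; exact: cos_affine_continuous.
  by move=> /eqP; rewrite mulf_eq0 expf_eq0 /= (negPf k0) => /eqP.
apply: complex_eq => /=.
  rewrite -[RHS](G 0); apply: eq_Rintegral => x _; by rewrite addr0.
rewrite -[RHS](G (- (pi / 2))); apply: eq_Rintegral => x _; by rewrite -cosBpihalf.
Qed.

Lemma cint_expi0 : cint I (fun=> 1) = pi%:C :> R[i].
Proof.
by rewrite /cint /= !Rintegral_pi_cst mul1r mul0r.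
Qed.

(** Enumerates n + 2Z, the frequencies that are even or odd together with n; they give an orthogonal
    system on [0, pi]. *)
Definition frq n l : int := n%:Z + 2 * l.

Lemma fourier_expi n l m :
  fourier (fun x : R => expi ((frq n l)%:~R * x)) (frq n m) = (l == m)%:R.
Proof.
rewrite fourierE.
have -> : cint I (fun x => expi ((frq n l)%:~R * x) * expi (- ((frq n m)%:~R * x))) =
    cint I (fun x => expi (2 * (l - m)%:~R * x)).
  apply: eq_cint => x _; rewrite -expiD -mulrBl -intrB; congr (expi (_ * _)).
  by rewrite (_ : frq n l - frq n m = 2 * (l - m)) ?intrM // /frq; lia.
have [->|lm] := eqVneq l m.
  rewrite subrr mulr0.
  have -> : cint I (fun x => expi (0 * x)) = cint I (fun=> 1) :> R[i].
    by apply: eq_cint => x _; rewrite mul0r expi0.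
  by rewrite cint_expi0 -rmorphM mulVf // gt_eqF // pi_gt0.
by rewrite cint_expi ?mulr0 // subr_eq0.
Qed.

Lemma cmod_sqr (z : R[i]) : cmod z ^+ 2 = complex.Re (z * conjc z).
Proof. by rewrite cmodE sqr_sqrtr ?addr_ge0 ?sqr_ge0 //; case: z => a b /=; ring. Qed.

Lemma cmod2_integrable f K : cmeasurable f -> cbounded f K ->
  mu.-integrable I (EFin \o (fun x => cmod (f x) ^+ 2)).
Proof.
move=> mf fK; have If := cintegrable_cmod mI (cintegrable_bounded mf fK).
have mc : measurable_fun I (fun x => cmod (f x)) by apply/measurable_EFinP; exact: measurable_int If.
apply: (@integrable_Mbounded _ _ _ K If mc) => x Ix.
by rewrite ger0_norm ?cmod_ge0 // fK.
Qed.

(** The remainder r after removing the modes of s is carried along with its other coefficients. Each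
    induction step then involves a single mode, whose removal lowers the mean square by exactly
    |c|^2. *)
Lemma bessel_step n g K (s : seq int) : cmeasurable g -> cbounded g K -> uniq s ->
  exists r, [/\ cmeasurable r, exists L, cbounded r L,
    forall m, m \notin s -> fourier r (frq n m) = fourier g (frq n m) &
    pi^-1 * Rintegral mu I (fun x => cmod (r x) ^+ 2) <=
      K ^+ 2 - \sum_(l <- s) cmod (fourier g (frq n l)) ^+ 2].
Proof.
move=> mg gK; have K0 : 0 <= K.
  by apply: le_trans (cmod_ge0 _) (gK 0 _); apply/I0piP; rewrite lexx pi_ge0.
elim: s => [_|l s IH /= /andP[ls us]].
  exists g; split => //; first by exists K.
  rewrite big_nil subr0 -[leRHS]mul1r -(mulVf (x := pi)) ?gt_eqF ?pi_gt0 // -mulrA.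
  rewrite ler_wpM2l ?invr_ge0 ?pi_ge0 // mulrC -Rintegral_pi_cst.
  apply: le_Rintegral => //; first exact: cmod2_integrable mg gK.
    by have [] := @cintegrable_cst R (K ^+ 2)%:C.
  by move=> x Ix; rewrite lerXn2r ?nnegrE ?cmod_ge0 // gK.
have [r [mr [L rL] rF rB]] := IH us.
set c := fourier g (frq n l).
pose e x : R[i] := expi ((frq n l)%:~R * x).
have me : cmeasurable e by exact: expi_lin_cmeasurable.
have be : cbounded e 1 by exact: cbounded_expi.
have mce : cmeasurable (fun x => c * e x).
  by apply: cmeasurableM => //; exact: cmeasurable_cst.
have Ir := cintegrable_bounded mr rL.
have Ie := cintegrable_bounded me be.
have mr' : cmeasurable (fun x => r x - c * e x) by exact: cmeasurableB.
have br' : cbounded (fun x => r x - c * e x) (L + cmod c).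
  move=> x Ix; apply: le_trans (cmodB _ _) _; rewrite lerD ?rL // cmodM.
  by rewrite /e cmod_expi mulr1.
exists (fun x => r x - c * e x); split => //.
- by exists (L + cmod c).
- move=> m; rewrite inE negb_or => /andP[ml ms].
  rewrite fourierB //; last exact: cintegrableZ.
  by rewrite fourierZ // fourier_expi eq_sym (negPf ml) mulr0 subr0 rF.
- rewrite big_cons opprD addrCA addrC.
  have cl : fourier r (frq n l) = c by rewrite rF.
  suff -> : Rintegral mu I (fun x => cmod (r x - c * e x) ^+ 2) =
      Rintegral mu I (fun x => cmod (r x) ^+ 2) - pi * cmod c ^+ 2.
    by rewrite mulrBr mulrA mulVf ?gt_eqF ?pi_gt0 // mul1r lerD2r.
  have eJ x : conjc (e x) = expi (- ((frq n l)%:~R * x)).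
    by rewrite /e /expi cosN sinN.
  have Ire : cintegrable I (fun x => r x * expi (- ((frq n l)%:~R * x))).
    exact: cintegrable_expi.
  have E x : cmod (r x - c * e x) ^+ 2 = cmod (r x) ^+ 2 +
      (- 2 * complex.Re (conjc c * (r x * expi (- ((frq n l)%:~R * x)))) + cmod c ^+ 2).
    rewrite -eJ !cmod_sqr; have : cmod (e x) ^+ 2 = 1 by rewrite /e cmod_expi expr1n.
    rewrite cmod_sqr; case: (r x) => a1 a2; case: (c) => b1 b2; case: (e x) => d1 d2 /= h.
    have h' : (b1 * b1 + b2 * b2) * (d1 * d1 - d2 * - d2 - 1) = 0 by rewrite h subrr mulr0.
    by apply/eqP; rewrite -subr_eq0; apply/eqP; rewrite -[RHS]h'; ring.
  have IZ := cintegrableZ (conjc c) mI Ire.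
  under eq_Rintegral do rewrite E.
  rewrite RintegralD //; first last.
  + apply: integrableD_real => //; last by have [] := @cintegrable_cst R (cmod c ^+ 2)%:C.
    by apply: integrableZ_real => //; case: IZ.
  + exact: cmod2_integrable mr rL.
  rewrite RintegralD //; first last.
  + by have [] := @cintegrable_cst R (cmod c ^+ 2)%:C.
  + by apply: integrableZ_real => //; case: IZ.
  rewrite RintegralZl //; last by case: IZ.
  have -> : Rintegral mu I (fun x => complex.Re (conjc c * (r x * expi (- ((frq n l)%:~R * x))))) =
      pi * cmod c ^+ 2.
    transitivity (complex.Re (cint I (fun x => conjc c * (r x * expi (- ((frq n l)%:~R * x)))))) => //.
    rewrite (cintZ (conjc c) mI Ire).
    have -> : cint I (fun x => r x * expi (- ((frq n l)%:~R * x))) = pi%:C * c.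
      by rewrite -cl fourierE mulrA -rmorphM mulfV ?gt_eqF ?pi_gt0 // mul1r.
    rewrite cmod_sqr mulrCA; case: (c) => b1 b2 /=; ring.
  by rewrite Rintegral_pi_cst; ring.
Qed.

Lemma bessel n g K (s : seq int) : cmeasurable g -> cbounded g K -> uniq s ->
  \sum_(l <- s) cmod (fourier g (frq n l)) ^+ 2 <= K ^+ 2.
Proof.
move=> mg gK us; have [r [_ _ _ h]] := bessel_step n mg gK us.
rewrite -subr_ge0; apply: le_trans h.
rewrite mulr_ge0 ?invr_ge0 ?pi_ge0 //; apply: Rintegral_ge0 => x _; exact: sqr_ge0.
Qed.

(** By Bessel's inequality the squares are the terms of a convergent series. The injective
    enumeration allows the two uses below, along N and along - N - 1. *)
Lemma riemann_lebesgue n g K (s : nat -> int) : injective s -> cmeasurable g -> cbounded g K ->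
  cmod (fourier g (frq n (s k))) @[k --> \oo] --> 0.
Proof.
move=> js mg gK.
pose u k := cmod (fourier g (frq n (s k))) ^+ 2.
have cu : cvg (series u @ \oo).
  apply: nondecreasing_is_cvgn.
    by apply: nondecreasing_series => k _ _; exact: sqr_ge0.
  exists (K ^+ 2) => _ [N _ <-]; rewrite /series /=.
  have := @bessel n g K [seq s k | k <- index_iota 0 N] mg gK.
  by rewrite map_inj_uniq // iota_uniq big_map => /(_ isT).
have := cvg_series_cvg_0 cu; rewrite /u => h.
apply/cvgrPdist_le => e e0; have e2 : 0 < e ^+ 2 by rewrite exprn_gt0.
have /cvgrPdist_le/(_ _ e2) := h; apply: filterS => k /=.
rewrite !sub0r !normrN ger0_norm ?sqr_ge0 // ger0_norm ?cmod_ge0 //.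
by rewrite ler_sqr // nnegrE ?cmod_ge0 // ltW.
Qed.

Definition ssum (a : int -> R[i]) N := a 0 + \sum_(0 <= k < N) (a k.+1%:Z + a (- k.+1%:Z)).

Lemma ssumS a N : ssum a N.+1 = ssum a N + (a N.+1%:Z + a (- N.+1%:Z)).
Proof. by rewrite /ssum big_nat_recr //= addrA. Qed.

Lemma measurable_inv (F : R -> R) : continuous F -> measurable_fun I (fun x => (F x)^-1).
Proof.
move=> cF; apply: (@measurable_funS _ _ _ _ setT) => //.
pose A := [set x | F x != 0].
have oA : open A.
  rewrite (_ : A = F @^-1` [set y | y != 0]) //.
  by apply: open_comp => [x _|]; [exact: cF|exact: open_neq].
have mA : measurable (A : set (measurableTypeR R)) by exact: open_measurable.
rewrite -(setUv A); apply/measurable_funU; [by []|exact: measurableC|split].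
  apply: open_continuous_measurable_fun => // x; rewrite inE => Ax.
  by apply: cvgV => //; exact: cF.
have E : {in ~` A, (fun=> 0) =1 (fun x => (F x)^-1)}.
  by move=> x; rewrite inE => /negP; rewrite negbK => /eqP ->; rewrite invr0.
apply: eq_measurable_fun E _; exact: measurable_cst.
Qed.

(** From sin t = 2 sin(t/2) cos(t/2) and sin(t/2) >= (t/2) cos(t/2). Unlike concavity on [0, pi/2],
    this reaches every M below pi. *)
Lemma sin_ge_linear (M t : R) : 0 <= t -> t <= M -> M < pi ->
  t * cos (M / 2) ^+ 2 <= sin t.
Proof.
move=> t0 tM Mpi; have pi0 := pi_gt0 R.
have u0 : 0 <= t / 2 by rewrite divr_ge0.
have upi : t / 2 <= pi / 2 by rewrite ler_pM2r ?invr_gt0 // (le_trans tM) // ltW.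
have in0pi (y : R) : 0 <= y -> y <= pi / 2 -> y \in `[0, pi].
  by move=> y0 y1; rewrite in_itv /= y0 (le_trans y1) // ler_pdivrMr // ler_peMr ?ler1n // ltW.
have cmono (y z : R) : 0 <= y -> y <= z -> z <= pi / 2 -> cos z <= cos y.
  move=> y0; rewrite le_eqVlt => /predU1P[->//|yz] z1.
  by rewrite ltW // ltr_cos // in0pi // ?(le_trans y0) ?ltW // (lt_le_trans yz).
have M2 : M / 2 <= pi / 2 by rewrite ler_pM2r ?invr_gt0 // ltW.
have cM : 0 <= cos (M / 2).
  by apply: cos_ge0_pihalf; rewrite M2 andbT (@le_trans _ _ 0) // ?oppr_le0 ?divr_ge0 ?pi_ge0 // (le_trans t0).
have cut : cos (M / 2) <= cos (t / 2).
  by apply: cmono => //; rewrite ler_pM2r ?invr_gt0.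
have su : t / 2 * cos (t / 2) <= sin (t / 2).
  move: u0; rewrite le_eqVlt => /predU1P[<-|u0]; first by rewrite mul0r sin0.
  have cs : {within `[0, t / 2], continuous (@sin R)}.
    by apply: continuous_subspaceT; exact: continuous_sin.
  have [c] := MVT u0 (fun x _ => is_derive_sin x) cs.
  rewrite in_itv /= => /andP[c0 cu]; rewrite sin0 !subr0 => ->.
  by rewrite mulrC ler_pM2r //; apply: cmono => //; exact: ltW.
have -> : sin t = (cos (t / 2) * sin (t / 2)) *+ 2.
  by rewrite -sin_mulr2n; congr sin; rewrite mulr2n -splitr.
have h1 : cos (M / 2) ^+ 2 <= cos (t / 2) ^+ 2 by rewrite lerXn2r ?nnegrE // (le_trans cM).
have h2 : 0 <= cos (t / 2) by exact: le_trans cut.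
have h3 := ler_wpM2l h2 su.
have h4 := ler_wpM2l t0 h1.
apply: le_trans h4 _; rewrite mulr2n.
have -> : t * cos (t / 2) ^+ 2 = cos (t / 2) * (t / 2 * cos (t / 2)) + cos (t / 2) * (t / 2 * cos (t / 2)).
  by rewrite -mulrDr -mulrDl -splitr expr2; ring.
exact: lerD.
Qed.

Lemma expi_affine_lipschitz (k c x y : R) : I x -> I y ->
  cmod (expi (k * y + c) - expi (k * x + c)) <= 2 * `|k| * `|y - x|.
Proof.
move=> Ix Iy; apply: le_trans (cmod_le_ReIm _) _.
have h1 : `|cos (k * y + c) - cos (k * x + c)| <= `|k| * `|y - x|.
  apply: (@rderiv_lipschitz _ (fun t => cos (k * t + c)) (fun t => - sin (k * t + c) * k)) => // t _.
    exact: is_derive_rderiv (is_derive_cos_affine k c t).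
  by rewrite normrM normrN ler_piMl // sin_max.
have h2 : `|sin (k * y + c) - sin (k * x + c)| <= `|k| * `|y - x|.
  apply: (@rderiv_lipschitz _ (fun t => sin (k * t + c)) (fun t => cos (k * t + c) * k)) => // t _.
    exact: is_derive_rderiv (is_derive_sin_affine k c t).
  by rewrite normrM ler_piMl // cos_max.
rewrite cReD cImD cReN cImN /= -mulrA mulr_natl mulr2n; exact: lerD.
Qed.

(* Chernoff's argument: dividing f - f(x0) e^{in(x-x0)} by e^{2i(x-x0)} - 1
   makes the partial sums telescope. *)
Lemma fourier_inversion n f K K' x0 : 0 < x0 < pi -> cmeasurable f -> cbounded f K' ->
  (forall x, I x -> cmod (f x - f x0) <= K * `|x - x0|) ->
  forall e : R, 0 < e -> exists N0, forall N, (N0 <= N)%N ->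
    cmod (ssum (fun l => fourier f (frq n l) * expi ((frq n l)%:~R * x0)) N - f x0) <= e.
Proof.
move=> /andP[x00 x0pi] mf fK' fK e e0; have pi0 := pi_gt0 R.
have Ix0 : I x0 by apply/I0piP; rewrite !ltW.
pose ci : R[i] := 0 +i* 2.
have ci0 : ci != 0 by rewrite /ci eq_complex /= pnatr_eq0 andbF.
pose Nm x := f x - f x0 * expi (n%:R * x + - (n%:R * x0)).
(* The quotient of [Nm x] by e^{2i(x - x0)} - 1 = 2i sin(x - x0) e^{i(x - x0)}. At x = x0 the
   inverse of 0 is 0, so g vanishes there. *)
pose g x := Nm x * (expi (- 1 * x + x0) * (ci^-1 * ((sin (x - x0))^-1)%:C)).
(* The largest distance from x0 to a point of [0, pi]. It is less than pi because x0 is interior, so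
   that sin(x - x0) has no other zero and g is bounded. *)
pose M := Num.max x0 (pi - x0).
have Mpi : M < pi by rewrite gt_max x0pi gtrBl.
have M0 : 0 < M by rewrite lt_max x00.
pose c := cos (M / 2) ^+ 2.
have c0 : 0 < c.
  rewrite exprn_gt0 //; apply: cos_gt0_pihalf; apply/andP; split.
    by rewrite (@lt_trans _ _ 0) ?oppr_lt0 ?divr_gt0.
  by rewrite ltr_pM2r ?invr_gt0.
have sinb x : I x -> c * `|x - x0| <= `|sin (x - x0)|.
  move=> /I0piP/andP[x1 x2]; have [h|h] := leP x0 x.
    have t0 : 0 <= x - x0 by rewrite subr_ge0.
    rewrite ger0_norm // mulrC; apply: le_trans (ler_norm _); apply: sin_ge_linear => //.
    by rewrite le_max; apply/orP; right; rewrite lerD2r.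
  have t0 : 0 <= x0 - x by rewrite subr_ge0 ltW.
  rewrite distrC ger0_norm // mulrC -normrN -sinN opprB.
  apply: le_trans (ler_norm _); apply: sin_ge_linear => //.
  by rewrite le_max; apply/orP; left; rewrite lerBlDr lerDl.
have Nx0 : Nm x0 = 0 by rewrite /Nm addrN expi0 mulr1 subrr.
have NmB x : I x -> cmod (Nm x) <= (K + cmod (f x0) * (2 * n%:R)) * `|x - x0|.
  move=> Ix; have -> : Nm x = (f x - f x0) - f x0 * (expi (n%:R * x + - (n%:R * x0)) - expi (n%:R * x0 + - (n%:R * x0))).
    by rewrite /Nm [n%:R * x0 + _]addrN expi0; ring.
  apply: le_trans (cmodB _ _) _; rewrite mulrDl; apply: lerD; first exact: fK.
  rewrite cmodM -!mulrA ler_wpM2l ?cmod_ge0 //.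
  by have := expi_affine_lipschitz n%:R (- (n%:R * x0)) Ix0 Ix; rewrite normr_nat mulrA.
have mg : cmeasurable g.
  apply: cmeasurableM.
    apply: cmeasurableB => //; apply: cmeasurableM; first exact: cmeasurable_cst.
    exact: expi_affine_cmeasurable.
  apply: cmeasurableM; first exact: expi_affine_cmeasurable.
  apply: cmeasurableM; first exact: cmeasurable_cst.
  split => /=; last exact: measurable_cst.
  apply: (measurable_inv (F := fun x => sin (x - x0))) => x.
  apply: continuous_comp; last exact: continuous_sin.
  by apply: cvgB; [exact: cvg_id|exact: cvg_cst].
have bg : cbounded g ((K + cmod (f x0) * (2 * n%:R)) / c).
  move=> x Ix; have [->|xx0] := eqVneq x x0.
    rewrite /g Nx0 mul0r cmod0 divr_ge0 //; last exact: ltW.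
    have [y Iy yx0] : exists2 y, I y & y != x0.
      by exists 0; [apply/I0piP; rewrite lexx ltW|rewrite lt_eqF].
    have := le_trans (cmod_ge0 _) (NmB y Iy).
    by rewrite pmulr_lge0 // normr_gt0 subr_eq0.
  have d0 : 0 < `|x - x0| by rewrite normr_gt0 subr_eq0.
  have s0 : 0 < `|sin (x - x0)| by apply: lt_le_trans (sinb x Ix); rewrite mulr_gt0.
  have ci2 : cmod ci = 2.
    by rewrite cmodE /= expr0n add0r sqrtr_sqr ger0_norm.
  rewrite /g !cmodM cmod_expi mul1r cmodV ci2 cmod_real normfV.
  rewrite ler_pdivlMr //.
  have h : c / `|sin (x - x0)| <= `|x - x0|^-1.
    rewrite -[leRHS]mul1r ler_pdivlMr // mulrAC ler_pdivrMr // mul1r.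
    exact: sinb.
  have k0 : 0 <= K + cmod (f x0) * (2 * n%:R).
    have := le_trans (cmod_ge0 _) (NmB x Ix); by rewrite pmulr_lge0.
  have h' : c / `|sin (x - x0)| / 2 <= `|x - x0|^-1.
    apply: le_trans h; rewrite ler_pdivrMr // ler_peMr ?ler1n //.
    by rewrite divr_ge0 // ltW.
  have -> : cmod (Nm x) * (2^-1 * `|sin (x - x0)|^-1) * c = cmod (Nm x) * (c / `|sin (x - x0)| / 2) by ring.
  have h2 := NmB x Ix.
  apply: (@le_trans _ _ ((K + cmod (f x0) * (2 * n%:R)) * `|x - x0| * `|x - x0|^-1)).
    apply: ler_pM => //; first exact: cmod_ge0.
    by rewrite !divr_ge0 // ltW.
  by rewrite mulfK // gt_eqF.
have fE x : I x -> f x = f x0 * expi (- (n%:R * x0)) * expi ((frq n 0)%:~R * x) +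
     (expi (- (2 * x0)) * (g x * expi (2 * x)) - g x).
  move=> Ix; have E1 : f x0 * expi (- (n%:R * x0)) * expi ((frq n 0)%:~R * x) =
      f x0 * expi (n%:R * x + - (n%:R * x0)).
    by rewrite -mulrA -expiD addrC /frq mulr0 addr0.
  rewrite E1; suff -> : expi (- (2 * x0)) * (g x * expi (2 * x)) - g x = Nm x.
    by rewrite /Nm addrC subrK.
  have [->|xx0] := eqVneq x x0; first by rewrite /g Nx0 !mul0r mulr0 subr0.
  have d0 : 0 < `|x - x0| by rewrite normr_gt0 subr_eq0.
  have s0 : 0 < `|sin (x - x0)| by apply: lt_le_trans (sinb x Ix); rewrite mulr_gt0.
  have s0' : sin (x - x0) != 0 by rewrite -normr_gt0.
  have -> : expi (- (2 * x0)) * (g x * expi (2 * x)) - g x =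
      Nm x * ((expi (- (2 * x0)) * expi (2 * x) - 1) * expi (- 1 * x + x0)) *
      (ci^-1 * ((sin (x - x0))^-1)%:C) by rewrite /g; ring.
  have -> : (expi (- (2 * x0)) * expi (2 * x) - 1) * expi (- 1 * x + x0) = ci * (sin (x - x0))%:C.
    rewrite mulrBl mul1r -!expiD.
    have -> : - (2 * x0) + 2 * x + (- 1 * x + x0) = x - x0 by ring.
    have -> : - 1 * x + x0 = - (x - x0) by ring.
    by apply: complex_eq; rewrite /ci ?cReD ?cImD ?cReN ?cImN ?cReM ?cImM /expi /= ?cosN ?sinN; ring.
  have -> : Nm x * (ci * (sin (x - x0))%:C) * (ci^-1 * ((sin (x - x0))^-1)%:C) =
     Nm x * ((ci * ci^-1) * ((sin (x - x0))%:C * ((sin (x - x0))^-1)%:C)) by ring.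
  by rewrite divff // mul1r -rmorphM mulfV // mulr1.
have Ig := cintegrable_bounded mg bg.
have me2 : cmeasurable (fun x : R => expi (2 * x)) by exact: expi_lin_cmeasurable.
have Ige : cintegrable I (fun x => g x * expi (2 * x)).
  exact: cintegrableM Ig me2 (@cbounded_expi _ (fun x => 2 * x)).
pose H l := fourier g (frq n l) * expi ((frq n l)%:~R * x0).
have fge l : fourier (fun x => g x * expi (2 * x)) (frq n l) = fourier g (frq n (l - 1)).
  rewrite !fourierE; congr (_ * _); apply: eq_cint => x _; rewrite -mulrA -expiD.
  congr (_ * expi _).
  have -> : frq n l = frq n (l - 1) + 2 by rewrite /frq; lia.
  by rewrite rmorphD /=; ring.
have aE l : fourier f (frq n l) * expi ((frq n l)%:~R * x0) =
    f x0 * (l == 0)%:R + (H (l - 1) - H l).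
  have me0 : cmeasurable (fun x : R => expi ((frq n 0)%:~R * x)) by exact: expi_lin_cmeasurable.
  have Ie0 := cintegrable_bounded me0 (@cbounded_expi _ (fun x => (frq n 0)%:~R * x)).
  rewrite (eq_fourier _ fE) fourierD; [|exact: cintegrableZ|by apply: cintegrableB => //; exact: cintegrableZ].
  rewrite fourierZ // fourierB //; last exact: cintegrableZ.
  rewrite fourierZ // fge fourier_expi mulrDl; congr (_ + _).
    rewrite eq_sym; case: eqP => [->|_]; last by rewrite !mulr0 mul0r.
    by rewrite !mulr1 /frq mulr0 addr0 -mulrA expiNK mulr1.
  rewrite mulrBl /H; congr (_ - _).
  rewrite mulrC mulrCA mulrA mulrC -expiD; congr (_ * expi _).
  have -> : frq n l = frq n (l - 1) + 2 by rewrite /frq; lia.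
  by rewrite rmorphD /=; ring.
have sE N : ssum (fun l => fourier f (frq n l) * expi ((frq n l)%:~R * x0)) N =
    f x0 + (H (- N%:Z - 1) - H N%:Z).
  elim: N => [|N IH].
    by rewrite /ssum big_nil addr0 aE eqxx mulr1 oppr0.
  rewrite ssumS IH !aE.
  have -> : (N.+1%:Z == 0) = false by [].
  have -> : (- N.+1%:Z == 0) = false by rewrite oppr_eq0.
  rewrite !mulr0 !add0r.
  have -> : N.+1%:Z - 1 = N%:Z by lia.
  have -> : - N.+1%:Z = - N%:Z - 1 by lia.
  by ring.
have j1 : injective (fun N : nat => - N%:Z - 1) by move=> a b; lia.
have j2 : injective (fun N : nat => N%:Z) by move=> a b; lia.
have e2 : 0 < e / 2 by rewrite divr_gt0.
have /cvgrPdist_le/(_ _ e2)[N1 _ h1] := riemann_lebesgue n j1 mg bg.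
have /cvgrPdist_le/(_ _ e2)[N2 _ h2] := riemann_lebesgue n j2 mg bg.
exists (maxn N1 N2) => N; rewrite geq_max => /andP[n1 n2].
rewrite sE addrC addrA addNr add0r.
have HE l : cmod (H l) = cmod (fourier g (frq n l)) by rewrite /H cmodM cmod_expi mulr1.
apply: le_trans (cmodB _ _) _; rewrite !HE (splitr e).
apply: lerD.
  have H1 : `|0 - cmod (fourier g (frq n (- N%:Z - 1)))| <= e / 2 := h1 N n1.
  by move: H1; rewrite sub0r normrN ger0_norm ?cmod_ge0.
have H2 : `|0 - cmod (fourier g (frq n N%:Z))| <= e / 2 := h2 N n2.
by move: H2; rewrite sub0r normrN ger0_norm ?cmod_ge0.
Qed.

End Inversion.

(** * Sums over the integers as limits of symmetric partial sums *)

Section IntSums.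
Variable R : realType.

Lemma nat_tail (u : nat -> R) (e : R) : (forall k, 0 <= u k) ->
  (\esum_(k in setT) (u k)%:E < +oo)%E -> 0 < e ->
  exists N0, forall N, (N0 <= N)%N -> forall M, (N <= M)%N -> \sum_(N <= k < M) u k <= e.
Proof.
move=> u0 uS e0.
have cu : cvg (series u @ \oo).
  apply: nondecreasing_is_cvgn; first by apply: nondecreasing_series.
  exists (fine (\esum_(k in setT) (u k)%:E)) => _ [N _ <-]; rewrite /series /=.
  rewrite -lee_fin fineK ?esum_fin // -nneseries_esumT; last by move=> k; rewrite lee_fin.
  rewrite -sumEFin; apply: nneseries_lim_ge => k _; by rewrite lee_fin.
have [N0 _ h] := (cvgrPdist_le _ _).1 cu (e / 2) (divr_gt0 e0 (ltr0n _ 2)).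
exists N0 => N NN M NM.
have hN := h N NN; have hM := h M (leq_trans NN NM).
have -> : \sum_(N <= k < M) u k = series u M - series u N.
  by rewrite /series /= (big_cat_nat (leq0n N) NM) /= [RHS]addrC addKr.
have -> : series u M - series u N = (lim (series u @ \oo) - series u N) - (lim (series u @ \oo) - series u M).
  by ring.
apply: le_trans (ler_norm _) _; apply: le_trans (ler_normB _ _) _.
by rewrite (splitr e) lerD.
Qed.

Lemma int_split (a : int -> R[i]) : csummable a ->
  [/\ csummable (fun k => a k.+1%:Z), csummable (fun k => a (- k.+1%:Z)) &
  csum setT a = a 0 + (csum setT (fun k => a k.+1%:Z) + csum setT (fun k => a (- k.+1%:Z)))].
Proof.
move=> sa.
pose ap (m : int) : R[i] := if m \in [set m : int | 0 <= m] then a m else 0.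
pose an (m : int) : R[i] := if m \in (~` [set m : int | 0 <= m]) then a m else 0.
have bp : set_bij setT [set m : int | 0 <= m] Posz.
  by split=> [k _ //|k l _ _ [] //|[k _|//]]; exists k.
have bn : set_bij setT (~` [set m : int | 0 <= m]) Negz.
  by split=> [k _ //|k l _ _ [] //|[k /(_ isT) //|k _]]; exists k.
have sp : csummable ap.
  by apply: csummableW (csummable_lty sa) => m; rewrite /ap; case: ifP => // _; rewrite cmod0 cmod_ge0.
have sn : csummable an.
  by apply: csummableW (csummable_lty sa) => m; rewrite /an; case: ifP => // _; rewrite cmod0 cmod_ge0.
have E : csum setT a = csum setT ap + csum setT an.
  apply: csumDE => // m; rewrite /ap /an in_setC.
  by case: ifP => _ /=; rewrite ?addr0 ?add0r.
have reidx (D : set int) (f : nat -> int) : set_bij setT D f ->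
   csum D a = csum setT (fun k => a (f k)).
  exact: csum_reindex.
have sreidx (D : set int) (f : nat -> int) : set_bij setT D f -> csummable (fun k => a (f k)).
  move=> bf; split; rewrite -(reindex_esum setT D f (fun m => (cmod (a m))%:E)) //.
  apply: le_lt_trans (csummable_lty sa); rewrite esum_mkcond; apply: le_esum => m _.
  by case: ifP => // _; rewrite lee_fin cmod_ge0.
have s1 := sreidx _ _ bp; have s2 := sreidx _ _ bn.
have s1' : csummable (fun k => a k.+1%:Z).
  have bs : set_bij setT [set m : int | 0 < m] (fun k : nat => k.+1%:Z).
    by split=> [k _ //|k l _ _ [] //|[[//|k] _|//]]; exists k.
  exact: sreidx bs.
split=> //; rewrite E.
have -> : csum setT an = csum setT (fun k => a (- k.+1%:Z)).
  by etransitivity; last exact: (reidx _ _ bn); rewrite [RHS]csum_mkcond.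
have -> : csum setT ap = csum setT (fun k => a (Posz k)).
  by etransitivity; last exact: (reidx _ _ bp); rewrite [RHS]csum_mkcond.
by rewrite csum_nat_recl // addrA.
Qed.

Lemma csum_nat_split (b : nat -> R[i]) N : csummable b ->
  csummable (fun k => b (k + N)%N) /\
  csum setT b = \sum_(0 <= k < N) b k + csum setT (fun k => b (k + N)%N).
Proof.
elim: N => [|N IH] sb.
  split; first by under eq_fun do rewrite addn0.
  rewrite big_nil add0r; congr csum; apply/funext => k; by rewrite addn0.
have [s1 E] := IH sb.
have s2 : csummable (fun k => b (k + N.+1)%N).
  have bs : set_bij setT [set k : nat | (0 < k)%N] succn.
    by split=> [k _ //|k l _ _ [] //|[//|k] _]; exists k.
  split; have := csummable_lty s1; apply: le_lt_trans.
  rewrite [leRHS](esumID [set k : nat | (0 < k)%N]); last by move=> k _; rewrite lee_fin cmod_ge0.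
  rewrite !setTI (reindex_esum _ _ _ _ bs) /=.
  rewrite -[leLHS]adde0 leeD //; last by apply: esum_ge0 => k _; rewrite lee_fin cmod_ge0.
  by apply: le_esum => k _; rewrite addSnnS.
split=> //; rewrite E csum_nat_recl // big_nat_recr //= add0n -addrA.
by congr (_ + (_ + _)); congr csum; apply/funext => k; rewrite addSnnS.
Qed.

(** The tail bound survives multiplication by unimodular factors and gives uniform convergence of
    Fourier series; the second bound serves for the convolution with the coefficients of [v]. *)
Lemma ssum_cvg (a : int -> R[i]) (e : R) : csummable a -> 0 < e ->
  exists N0, forall N, (N0 <= N)%N ->
   (forall M, (N <= M)%N -> \sum_(N <= k < M) (cmod (a k.+1%:Z) + cmod (a (- k.+1%:Z))) <= e) /\
   cmod (csum setT a - ssum a N) <= e.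
Proof.
move=> sa e0; have [s1 s2 E] := int_split sa.
pose u k := cmod (a k.+1%:Z) + cmod (a (- k.+1%:Z)).
have u0 k : 0 <= u k by rewrite addr_ge0 ?cmod_ge0.
have uS : (\esum_(k in setT) (u k)%:E < +oo)%E.
  under eq_esum do rewrite EFinD.
  rewrite esumD; try by move=> k _; rewrite lee_fin cmod_ge0.
  by rewrite lte_add_pinfty ?csummable_lty.
have [N0 hN0] := nat_tail u0 uS e0.
exists N0 => N NN; split; first exact: hN0.
have sb := csummableD s1 s2.
have Eb : csum setT a = a 0 + csum setT (fun k => a k.+1%:Z + a (- k.+1%:Z)).
  by rewrite E csumD.
have [_ Es] := csum_nat_split N sb.
rewrite Eb Es /ssum addrA (addrC (a 0 + _)) addrK.
apply: csum_le; apply: (@le_trans _ _ (\esum_(k in setT) (u (k + N)%N)%:E)%E).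
  by apply: le_esum => k _; rewrite lee_fin cmodD.
apply: esum_nat_le => [k|M]; first exact: u0.
have := hN0 N NN (M + N)%N (leq_addl _ _).
by rewrite -{1}[N]add0n big_addn addnK.
Qed.

Lemma csum_frq n (c : int -> R[i]) : (forall j, ~~ (2 %| j - n%:Z)%Z -> c j = 0) ->
  csum setT c = csum setT (fun l => c (frq n l)) /\
  (csummable c -> csummable (fun l => c (frq n l))).
Proof.
move=> c0.
have bf : set_bij setT [set j : int | (2 %| j - n%:Z)%Z] (frq n).
  split.
  - by move=> l _ /=; rewrite /frq addrC addKr dvdz_mulr.
  - by move=> l m _ _; rewrite /frq => /addrI /mulfI; apply.
  - move=> j /= /dvdzP[l hl]; exists l => //; rewrite /frq; lia.
split.
  have -> : csum setT (fun l => c (frq n l)) = csum [set j : int | (2 %| j - n%:Z)%Z] c.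
    by rewrite (csum_reindex _ bf).
  rewrite [RHS]csum_mkcond; apply: eq_csum => j; case: ifPn => //.
  by rewrite notin_setE /= => /negP /c0.
move=> sc; split; rewrite -(reindex_esum setT _ (frq n) (fun m => (cmod (c m))%:E) bf).
apply: le_lt_trans (csummable_lty sc); rewrite esum_mkcond; apply: le_esum => m _.
by case: ifP => // _; rewrite lee_fin cmod_ge0.
Qed.

End IntSums.

(** * Periodic and antiperiodic expansions *)

Section PeriodicFunctions.
Variable R : realType.
Local Notation mu := (@lebesgue_measure R).
Local Notation I := (@I0pi R).
Implicit Types (f g v : R -> R[i]) (n : nat) (l j : int).

Let mI : measurable (I : set (measurableTypeR R)).
Proof. exact: measurable_I0pi. Qed.

(** The regularity contained in [hill_op], detached from boundary conditions. The second derivative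
    is only integrable, because [v f] is no better. *)
Definition hill_data f f1 f2 : Prop :=
  [/\ forall x, I x -> has_deriv f x (f1 x), abs_continuous f1,
      {ae mu, forall x, I x -> has_deriv f1 x (f2 x)} & cintegrable I f2].

Lemma abs_continuous_ReIm f : abs_continuous f ->
  rabs_continuous (fun x => complex.Re (f x)) /\ rabs_continuous (fun x => complex.Im (f x)).
Proof.
move=> acf; split=> e e0; have [d d0 hd] := acf e e0; exists d => // m a b ab tab sd;
  apply: le_lt_trans (hd m a b ab tab sd); apply: ler_sum => i _.
  by rewrite -cReN -cReD; exact: Re_le_cmod.
by rewrite -cImN -cImD; exact: Im_le_cmod.
Qed.

Lemma differentiable_regular f f1 : (forall x, I x -> has_deriv f x (f1 x)) -> abs_continuous f1 ->
  [/\ cmeasurable f, exists K, cbounded f K &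
      exists K, forall x y, I x -> I y -> cmod (f y - f x) <= K * `|y - x|].
Proof.
move=> df acf1; have [ac1 ac2] := abs_continuous_ReIm acf1.
have d1 x : I x -> rderiv (fun x => complex.Re (f x)) x (complex.Re (f1 x)) by move=> /df[].
have d2 x : I x -> rderiv (fun x => complex.Im (f x)) x (complex.Im (f1 x)) by move=> /df[].
have c1 := rderiv_continuous d1; have c2 := rderiv_continuous d2.
have [K K0 hK] := icontinuous_bounded (rabs_continuous_continuous ac1).
have [L L0 hL] := icontinuous_bounded (rabs_continuous_continuous ac2).
have [K' K'0 hK'] := icontinuous_bounded c1.
have [L' L'0 hL'] := icontinuous_bounded c2.
split.
- exact: icontinuous_cmeasurable.
- exists (K' + L') => x Ix; apply: le_trans (cmod_le_ReIm _) _.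
  by rewrite lerD ?hK' ?hL'.
- exists (K + L) => x y Ix Iy; apply: le_trans (cmod_le_ReIm _) _.
  rewrite cReD cImD cReN cImN mulrDl; apply: lerD.
    exact: (rderiv_lipschitz d1 hK Ix Iy).
  exact: (rderiv_lipschitz d2 hL Ix Iy).
Qed.

Lemma hill_data_regular f f1 f2 : hill_data f f1 f2 ->
  [/\ cmeasurable f, exists K, cbounded f K &
      exists K, forall x y, I x -> I y -> cmod (f y - f x) <= K * `|y - x|].
Proof. by move=> [df acf1 _ _]; exact: differentiable_regular df acf1. Qed.

Lemma hill_data_green f f1 f2 (k : R) : hill_data f f1 f2 ->
  cint I (fun x => (f2 x + (k ^+ 2)%:C * f x) * expi (- (k * x))) =
  (f1 pi + (0 +i* k) * f pi) * expi (- (k * pi)) - (f1 0 + (0 +i* k) * f 0).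
Proof.
move=> [df acf1 dF1 [i1 i2]]; have [ac1 ac2] := abs_continuous_ReIm acf1.
have d1 x : I x -> rderiv (fun x => complex.Re (f x)) x (complex.Re (f1 x)) by move=> /df[].
have d2 x : I x -> rderiv (fun x => complex.Im (f x)) x (complex.Im (f1 x)) by move=> /df[].
have dd1 : {ae mu, forall x, I x -> rderiv (fun x => complex.Re (f1 x)) x (complex.Re (f2 x))}.
  by apply: filterS dF1; [exact: (ae_filter_ringOfSetsType mu)|move=> x h /h []].
have dd2 : {ae mu, forall x, I x -> rderiv (fun x => complex.Im (f1 x)) x (complex.Im (f2 x))}.
  by apply: filterS dF1; [exact: (ae_filter_ringOfSetsType mu)|move=> x h /h []].
have pI : (0 : R) <= pi <= (pi : R) by apply/andP; split; [exact: pi_ge0|exact: lexx].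
have G1 c := @green_cos R _ _ _ k c pi d1 ac1 dd1 i1 pI.
have G2 c := @green_cos R _ _ _ k c pi d2 ac2 dd2 i2 pI.
have c1 := rderiv_continuous d1; have c2 := rderiv_continuous d2.
have int (F F2 : R -> R) c : icontinuous F -> mu.-integrable I (EFin \o F2) ->
   mu.-integrable I (EFin \o (fun t => (F2 t + k ^+ 2 * F t) * cos (k * t + c))).
  move=> cF iF2; apply: integrable_Mcontinuous; last exact: cos_affine_continuous.
  by apply: integrableD_real => //; apply: integrableZ_real => //; exact: icontinuous_integrable.
(* The real identity with shifts 0 and - pi / 2 supplies the cosine and the sine part of the
   exponential. *)
have sE t : sin (k * t) = cos (k * t + - (pi / 2)) :> R by rewrite cosBpihalf.
have c0 : cos (- (pi / 2)) = 0 :> R by rewrite cosN cos_pihalf.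
have s0 : sin (- (pi / 2)) = -1 :> R by rewrite sinN sin_pihalf.
apply: complex_eq.
- rewrite /cint [LHS]/=.
  transitivity (Rintegral mu I (fun t => (complex.Re (f2 t) + k ^+ 2 * complex.Re (f t)) * cos (k * t + 0)) +
    Rintegral mu I (fun t => (complex.Im (f2 t) + k ^+ 2 * complex.Im (f t)) * cos (k * t + - (pi / 2)))).
    rewrite -RintegralD; [|exact: mI|exact: int|exact: int].
    apply: eq_Rintegral => t _; rewrite addr0 -sE cReM cReD cImD cReM cImM /expi /= cosN sinN; ring.
  rewrite -G1 -G2 !addr0 -sE c0 s0 cos0 sin0.
  have -> : sin (k * pi + - (pi / 2)) = - cos (k * pi) by rewrite sinBpihalf.
  rewrite !(cReM, cImM, cReD, cImD, cReN, cImN) /expi /= cosN sinN; ring.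
- rewrite /cint [LHS]/=.
  transitivity (Rintegral mu I (fun t => (complex.Im (f2 t) + k ^+ 2 * complex.Im (f t)) * cos (k * t + 0)) -
    Rintegral mu I (fun t => (complex.Re (f2 t) + k ^+ 2 * complex.Re (f t)) * cos (k * t + - (pi / 2)))).
    rewrite -RintegralB; [|exact: mI|exact: int|exact: int].
    apply: eq_Rintegral => t _; rewrite addr0 -sE cImM cReD cImD cReM cImM /expi /= cosN sinN; ring.
  rewrite -G1 -G2 !addr0 -sE c0 s0 cos0 sin0.
  have -> : sin (k * pi + - (pi / 2)) = - cos (k * pi) by rewrite sinBpihalf.
  rewrite !(cReM, cImM, cReD, cImD, cReN, cImN) /expi /= cosN sinN; ring.
Qed.

(** One sign covers the periodic case (n even) and the antiperiodic case (n odd). *)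
Definition twisted n f := f pi = (-1) ^+ n * f 0.

Lemma cos_nat_pi n : cos (n%:R * pi : R) = (-1) ^+ n /\ sin (n%:R * pi : R) = 0.
Proof.
elim: n => [|m [IH1 IH2]]; first by rewrite mul0r cos0 sin0.
by rewrite -natr1 mulrDl mul1r cosDpi sinDpi IH1 IH2 oppr0 exprS mulN1r.
Qed.

Lemma expi_frq_pi n l : expi (- ((frq n l)%:~R * pi)) = (-1) ^+ n :> R[i].
Proof.
have [h1 h2] := cos_nat_pi n.
have -> : (frq n l)%:~R * pi = l%:~R * pi *+ 2 + n%:R * pi :> R.
  by rewrite /frq intrD intrM -[(n%:Z)%:~R]/(n%:R) -[2%:~R]/(2 : R); ring.
have [e1 e2] := trig_int_pi l (n%:R * pi : R).
rewrite /expi cosN sinN e1 e2 h1 h2 oppr0.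
by transitivity (((-1) ^+ n : R)%:C) => //; rewrite rmorphXn rmorphN1.
Qed.

Lemma sgnK n : (-1) ^+ n * (-1) ^+ n = 1 :> R[i].
Proof. by rewrite -exprD addnn -mul2n exprM sqrrN expr1n expr1n. Qed.

(** The exponential of a frequency in n + 2Z takes the value (-1)^n at pi, which cancels the twist
    of f and f1; no boundary term is left in Green's identity. *)
Lemma fourier_deriv2 f f1 f2 n l : hill_data f f1 f2 -> twisted n f -> twisted n f1 ->
  fourier f2 (frq n l) = - ((frq n l) ^+ 2)%:~R * fourier f (frq n l).
Proof.
move=> hf tf tf1; have [mf [K fK] _] := hill_data_regular hf.
have If := cintegrable_bounded mf fK; have [_ _ _ If2] := hf.
set k : R := (frq n l)%:~R.
have := hill_data_green k hf.
rewrite expi_frq_pi tf tf1 mulrCA -mulrDr mulrAC sgnK mul1r subrr => G.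
have E : fourier (fun x => f2 x + (k ^+ 2)%:C * f x) (frq n l) = 0 by rewrite fourierE G mulr0.
move: E; rewrite fourierD //; last exact: cintegrableZ.
rewrite fourierZ // => /eqP; rewrite addr_eq0 => /eqP ->.
by rewrite mulNr intrC [in RHS]expr2 intrM -expr2.
Qed.

(** Exponentials whose frequencies differ by an odd number are not orthogonal on [0, pi], so
    coefficients outside n + 2Z need not vanish and are cut off by hand. *)
Definition coef n f j : R[i] := if (2 %| j - n%:Z)%Z then fourier f j else 0.

Lemma frq_dvd n l : (2 %| frq n l - n%:Z)%Z.
Proof. by rewrite /frq addrC addKr dvdz_mulr. Qed.

Lemma frqP n j : (2 %| j - n%:Z)%Z -> exists l, j = frq n l.
Proof. by move=> /dvdzP[l hl]; exists l; rewrite /frq; lia. Qed.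

Lemma coef_frq n f l : coef n f (frq n l) = fourier f (frq n l).
Proof. by rewrite /coef frq_dvd. Qed.

(** The coefficients of f and of its second derivative are bounded, hence so is (n^2 - j^2) times
    the coefficient of f, and 1 / |n^2 - j^2| is summable. The indices n and - n, where this says
    nothing, use the sup bound of f. *)
Lemma coef_summable n f f1 f2 : (0 < n)%N -> hill_data f f1 f2 -> twisted n f -> twisted n f1 ->
  csummable (coef n f).
Proof.
move=> n0 hf tf tf1; have [mf [K fK] _] := hill_data_regular hf.
have [_ _ _ If2] := hf.
set A := pi^-1 * Rintegral mu I (fun x => cmod (f2 x)).
have K0 : 0 <= K.
  by apply: le_trans (cmod_ge0 _) (fK 0 _); apply/I0piP; rewrite lexx pi_ge0.
have A0 : 0 <= A.
  by rewrite mulr_ge0 ?invr_ge0 ?pi_ge0 //; apply: Rintegral_ge0 => x _; exact: cmod_ge0.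
set B := (n ^ 2)%:R * K + A.
have B0 : 0 <= B by rewrite addr_ge0 // mulr_ge0.
pose d a j : R[i] := if j == a then fourier f a else 0.
have G := gapinv_esum R n0.
pose w j : R := B * gapinv R n j.
have sw : csummable (fun j => (w j)%:C).
  apply: (@csummable_le _ _ _ (B * (12 / Num.sqrt n%:R))).
  apply: (@le_trans _ _ (\esum_(j in setT) (B * gapinv R n j)%:E)%E).
    by apply: le_esum => j _; rewrite lee_fin cmod_real ger0_norm ?mulr_ge0 ?gapinv_ge0.
  rewrite esumZl //; [|exact: gapinv_ge0|by apply: le_lt_trans G _; rewrite ltry].
  by rewrite [leRHS]EFinM lee_wpmul2l // lee_fin.
have sall := csummableD (csummableD sw (csummable_delta n%:Z K%:C)) (csummable_delta (- n%:Z) K%:C).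
have sd1 := csummable_lty sw.
apply: (@csummableW _ _ _ (fun j => cmod ((w j)%:C) + cmod (if j == n%:Z then K%:C else 0) +
   cmod (if j == - n%:Z then K%:C else 0))); last first.
  have t1 := csummable_lty (csummable_delta n%:Z (K%:C : R[i])).
  have t2 := csummable_lty (csummable_delta (- n%:Z) (K%:C : R[i])).
  under eq_esum do rewrite !EFinD.
  rewrite !esumD; try by move=> j _; rewrite -?EFinD lee_fin ?addr_ge0 ?cmod_ge0.
  by rewrite !lte_add_pinfty.
move=> j; rewrite /coef; case: ifPn => [dj|_]; last by rewrite cmod0 !addr_ge0 ?cmod_ge0.
have fj : cmod (fourier f j) <= K by exact: fourier_le_bound.
have Kc : cmod (K%:C : R[i]) = K by rewrite cmod_real ger0_norm.
have [jn|jn] := eqVneq j n%:Z.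
  by rewrite Kc -addrA addrCA (le_trans fj) // lerDl addr_ge0 ?cmod_ge0.
have [jn'|jn'] := eqVneq j (- n%:Z).
  by rewrite Kc (le_trans fj) // lerDr addr_ge0 ?cmod_ge0.
rewrite cmod0 !addr0 cmod_real ger0_norm ?mulr_ge0 ?gapinv_ge0 // /w /gapinv.
have bj : beta_index n j by apply/and3P.
rewrite bj; have gn := gap_ge_n R n0 bj.
have g0 : 0 < `|(n%:Z ^+ 2 - j ^+ 2)%:~R| :> R by apply: lt_le_trans gn; rewrite ltr0n.
rewrite ler_pdivlMr // -cmod_int -cmodM mulrC.
have [l jl] := frqP dj; have fd : fourier f2 j = - (j ^+ 2)%:~R * fourier f j.
  by rewrite jl; exact: fourier_deriv2 hf tf tf1.
have -> : (n%:Z ^+ 2 - j ^+ 2)%:~R * fourier f j = (n ^ 2)%:R * fourier f j + fourier f2 j.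
  by rewrite fd -gapE mulrBl mulNr.
apply: le_trans (cmodD _ _) _; rewrite cmodM cmod_nat; apply: lerD.
  by rewrite ler_wpM2l.
exact: fourier_le.
Qed.

(** Fourier series are summed at interior points only; this removes the end points from the
    integrals to be estimated. *)
Lemma cint_oo f : cintegrable I f -> cint I f = cint `]0, pi[ f.
Proof.
move=> [f1 f2].
have H (F : R -> R) : mu.-integrable I (EFin \o F) -> Rintegral mu I F = Rintegral mu `]0, pi[ F.
  move=> iF; rewrite /I0pi -Rintegral_itv_bndo_bndc; last first.
    apply: integrableS iF; [exact: measurable_itv|exact: measurable_itv|].
    by move=> x /=; rewrite in_itv /= => /andP[x0 /ltW xpi]; apply/I0piP; rewrite x0.
  rewrite -Rintegral_itv_obnd_cbnd //.
  apply: integrableS iF; [exact: measurable_itv|exact: measurable_itv|].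
  by move=> x /=; rewrite in_itv /= => /andP[/ltW x0 /ltW xpi]; apply/I0piP; rewrite x0.
by rewrite /cint !H.
Qed.

Lemma fourier_mul_le v g (d : R) j : cintegrable I v -> cintegrable I (fun x => v x * g x) ->
  0 <= d -> (forall x, 0 < x < pi -> cmod (g x) <= d) ->
  cmod (fourier (fun x => v x * g x) j) <= pi^-1 * Rintegral mu I (fun x => cmod (v x)) * d.
Proof.
move=> Iv Ivg d0 gd.
rewrite fourierE cmodM cmod_real ger0_norm ?invr_ge0 ?pi_ge0 //.
rewrite -mulrA ler_wpM2l ?invr_ge0 ?pi_ge0 //.
have Ie := cintegrable_expi j%:~R Ivg.
have sub : `]0, pi[ `<=` I.
  by move=> x /=; rewrite in_itv /= => /andP[/ltW x0 /ltW xpi]; apply/I0piP; rewrite x0.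
have restr (F : R -> R) : mu.-integrable I (EFin \o F) -> mu.-integrable `]0, pi[ (EFin \o F).
  by move=> iF; apply: integrableS iF; [exact: measurable_itv|exact: measurable_itv|exact: sub].
have Ioo : cintegrable `]0, pi[ (fun x => v x * g x * expi (- (j%:~R * x))).
  by case: Ie => i1 i2; split; exact: restr.
have iv := cintegrable_cmod mI Iv.
rewrite cint_oo //; apply: le_trans (cint_le (measurable_itv _) Ioo) _.
have -> : Rintegral mu I (fun x => cmod (v x)) = Rintegral mu `]0, pi[ (fun x => cmod (v x)).
  have : cintegrable I (fun x => (cmod (v x))%:C).
    by split => //=; have [] := @cintegrable_cst R 0.
  by move=> /cint_oo [].
rewrite mulrC -RintegralZl //; last exact: restr.
apply: le_Rintegral => //.
- exact: cintegrable_cmod.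
- by apply: integrableZ_real => //; exact: restr.
- move=> x /=; rewrite in_itv /= => xI.
  by rewrite cmodM cmod_expi mulr1 cmodM mulrC ler_wpM2r ?cmod_ge0 // gd.
Qed.

Section Expansion.
Variables (n : nat) (f f1 f2 : R -> R[i]).
Hypotheses (n0 : (0 < n)%N) (hf : hill_data f f1 f2) (tf : twisted n f) (tf1 : twisted n f1).

Let a l := fourier f (frq n l).
Let S (N : nat) (x : R) := ssum (fun l => a l * expi ((frq n l)%:~R * x)) N.

Lemma a_summable : csummable a.
Proof.
have [_ h] := @csum_frq R n (coef n f) (fun j h => ifN _ _ h).
have := h (coef_summable n0 hf tf tf1).
by rewrite (_ : (fun l => coef n f (frq n l)) = a) //; apply/funext => l; exact: coef_frq.
Qed.

Lemma expansion_pointwise (e : R) (x : R) : 0 < x < pi -> 0 < e ->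
  exists N0, forall N, (N0 <= N)%N -> cmod (S N x - f x) <= e.
Proof.
move=> xI e0; have [mf [K' fK'] [K fK]] := hill_data_regular hf.
have Ix : I x by have /andP[h1 h2] := xI; apply/I0piP; rewrite !ltW.
exact: (@fourier_inversion R n f K K' x xI mf fK' (fun y Iy => fK x y Ix Iy) e e0).
Qed.

(** Summable coefficients make the partial sums uniformly Cauchy, and pointwise inversion along M >=
    N identifies the limit. *)
Lemma expansion_uniform (e : R) : 0 < e ->
  exists N0, forall N, (N0 <= N)%N -> forall x, 0 < x < pi -> cmod (f x - S N x) <= e.
Proof.
move=> e0; have [N0 hN0] := ssum_cvg a_summable e0; exists N0 => N NN x xI.
have [tail _] := hN0 N NN.
apply/ler_addgt0Pr => e' e'0; have [N1 hN1] := expansion_pointwise xI e'0.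
pose M := maxn N N1.
have NM : (N <= M)%N by rewrite leq_maxl.
have h1 := hN1 M (leq_maxr _ _).
have dE : S M x - S N x = \sum_(N <= k < M)
    (a k.+1%:Z * expi ((frq n k.+1%:Z)%:~R * x) + a (- k.+1%:Z) * expi ((frq n (- k.+1%:Z))%:~R * x)).
  by rewrite /S /ssum (big_cat_nat (leq0n N) NM) /= addrA [LHS]addrC addKr.
have -> : f x - S N x = (S M x - S N x) - (S M x - f x) by ring.
apply: le_trans (cmodB _ _) _; apply: lerD => //; rewrite dE.
apply: le_trans (cmod_sum _ _ _) _; apply: le_trans (tail M NM).
apply: ler_sum => k _; apply: le_trans (cmodD _ _) _.
by rewrite (cmodM (a _)) (cmodM (a _)) !cmod_expi !mulr1.
Qed.

(** Inversion settles the interior points; the end points follow by Lipschitz continuity. *)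
Lemma expansion_zero : (forall j, coef n f j = 0) -> forall x, I x -> f x = 0.
Proof.
move=> c0; have S0 N x : S N x = 0.
  have a0 l : a l = 0 by rewrite -[RHS](c0 (frq n l)) coef_frq.
  by rewrite /S /ssum a0 mul0r add0r big1 // => k _; rewrite !a0 !mul0r addr0.
have int x : 0 < x < pi -> f x = 0.
  move=> xI; apply: cmod_eq0; apply/eqP; rewrite eq_le cmod_ge0 andbT.
  apply/ler_addgt0Pr => e e0; rewrite add0r.
  by have [N0 /(_ N0 (leqnn _))] := expansion_pointwise xI e0; rewrite S0 sub0r cmodN.
have [_ _ [K fK]] := hill_data_regular hf.
have pi0 := pi_gt0 R.
move=> x Ix; apply: cmod_eq0; apply/eqP; rewrite eq_le cmod_ge0 andbT.
have k0 : 0 < `|K| + 1 by rewrite ltr_wpDl.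
apply/ler_addgt0Pr => e e0; rewrite add0r.
have [y yI yx] : exists2 y, 0 < y < pi & `|y - x| <= e / (`|K| + 1).
  have d0 : 0 < e / (`|K| + 1) by rewrite divr_gt0.
  have /I0piP/andP[x0 xpi] := Ix.
  have m0 : 0 < Num.min (e / (`|K| + 1)) (pi / 2) by rewrite lt_min d0 divr_gt0.
  have m1 : Num.min (e / (`|K| + 1)) (pi / 2) <= pi / 2 by rewrite ge_min lexx orbT.
  have m2 : Num.min (e / (`|K| + 1)) (pi / 2) <= e / (`|K| + 1) by rewrite ge_min lexx.
  move: (Num.min _ _) m0 m1 m2 => d dp d1 d2.
  have [xh|xh] := leP x (pi / 2).
    exists (x + d / 2); last by rewrite addrC addKr ger0_norm; lra.
    by apply/andP; split; lra.
  exists (x - d / 2); last by rewrite addrC addKr normrN ger0_norm; lra.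
  by apply/andP; split; lra.
have Iy : I y by have /andP[h1 h2] := yI; apply/I0piP; rewrite !ltW.
have -> : f x = f x - f y by rewrite (int y yI) subr0.
apply: le_trans (fK y x Iy Ix) _; rewrite distrC.
apply: (@le_trans _ _ ((`|K| + 1) * `|y - x|)).
  by rewrite ler_wpM2r // (le_trans (ler_norm _)) // lerDl.
by rewrite mulrC -ler_pdivlMr.
Qed.

Variable v : R -> R[i].
Hypothesis Iv : cintegrable I v.

Let mode j (x : R) : R[i] := expi (j%:~R * x).
Let mmode j : cmeasurable (mode j). Proof. exact: expi_lin_cmeasurable. Qed.
Let bmode j : cbounded (mode j) 1. Proof. exact: cbounded_expi. Qed.

Lemma fourier_mode j m : fourier (fun x => v x * mode m x) j = fourier v (j - m).
Proof.
rewrite !fourierE; congr (_ * _); apply: eq_cint => x _; rewrite /mode -mulrA -expiD.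
by congr (_ * expi _); rewrite intrB; ring.
Qed.

Lemma S_regular N : cmeasurable (S N) /\ exists L, cbounded (S N) L.
Proof.
have m1 l : cmeasurable (fun x => a l * mode (frq n l) x).
  by apply: cmeasurableM; [exact: cmeasurable_cst|exact: mmode].
have b1 l : cbounded (fun x => a l * mode (frq n l) x) (cmod (a l)).
  by move=> x Ix; rewrite cmodM /mode cmod_expi mulr1.
elim: N => [|N [IH1 [L IH2]]].
  have -> : S 0 = fun x => a 0 * mode (frq n 0) x.
    by apply/funext => x; rewrite /S /ssum big_nil addr0.
  by split; [exact: m1|exists (cmod (a 0)); exact: b1].
have -> : S N.+1 = fun x => S N x + (a N.+1%:Z * mode (frq n N.+1%:Z) x +
    a (- N.+1%:Z) * mode (frq n (- N.+1%:Z)) x).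
  by apply/funext => x; rewrite /S ssumS.
split; first by apply: cmeasurableD => //; apply: cmeasurableD; exact: m1.
exists (L + (cmod (a N.+1%:Z) + cmod (a (- N.+1%:Z)))) => x Ix.
apply: le_trans (cmodD _ _) _; apply: lerD; first exact: IH2.
by apply: le_trans (cmodD _ _) _; apply: lerD; exact: b1.
Qed.

Lemma fourier_vS j N : fourier (fun x => v x * S N x) j =
  ssum (fun l => fourier v (j - frq n l) * a l) N.
Proof.
have Im l : cintegrable I (fun x => v x * mode (frq n l) x).
  exact: cintegrableM Iv (mmode _) (@bmode _).
have E l : fourier (fun x => a l * (v x * mode (frq n l) x)) j = fourier v (j - frq n l) * a l.
  by rewrite (fourierZ _ _ (Im l)) fourier_mode mulrC.
elim: N => [|N IH].
  have -> : (fun x => v x * S 0 x) = fun x => a 0 * (v x * mode (frq n 0) x).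
    by apply/funext => x; rewrite /S /ssum big_nil addr0 mulrCA.
  by rewrite E /ssum big_nil addr0.
have -> : (fun x => v x * S N.+1 x) = fun x => v x * S N x +
    (a N.+1%:Z * (v x * mode (frq n N.+1%:Z) x) +
     a (- N.+1%:Z) * (v x * mode (frq n (- N.+1%:Z)) x)).
  by apply/funext => x; rewrite /S ssumS !mulrDr; congr (_ + (_ + _)); rewrite mulrCA.
have [mS [L bS]] := S_regular N.
have I1 := cintegrableZ (a N.+1%:Z) mI (Im N.+1%:Z).
have I2 := cintegrableZ (a (- N.+1%:Z)) mI (Im (- N.+1%:Z)).
rewrite fourierD; [|exact: cintegrableM Iv mS bS|exact: cintegrableD].
by rewrite fourierD // !E IH ssumS.
Qed.

(** Termwise integration against a merely integrable [v] is justified by uniform convergence: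
    replacing f by its partial sum costs at most the L^1 norm of [v] times the sup norm of the
    error. *)
Lemma fourier_mul j : fourier (fun x => v x * f x) j = conv (fourier v) (coef n f) j.
Proof.
have [mf [K fK] _] := hill_data_regular hf.
set C := pi^-1 * Rintegral mu I (fun x => cmod (v x)).
have VC m : cmod (fourier v m) <= C by exact: fourier_le.
have C0 : 0 <= C by exact: le_trans (cmod_ge0 _) (VC 0).
have sc := conv_summable VC j (coef_summable n0 hf tf tf1).
have supp k : ~~ (2 %| k - n%:Z)%Z -> fourier v (j - k) * coef n f k = 0.
  by move=> h; rewrite /coef (negPf h) mulr0.
have [cE /(_ sc) sc'] := csum_frq supp.
apply/eqP; rewrite -subr_eq0; apply/eqP/cmod_eq0/eqP; rewrite eq_le cmod_ge0 andbT.
apply/ler_addgt0Pr => e e0; rewrite add0r.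
have k0 : 0 < C + 1 by rewrite ltr_wpDl.
have d0 : 0 < e / (C + 1) by rewrite divr_gt0.
have Ee : C * (e / (C + 1)) + e / (C + 1) = e by field; rewrite gt_eqF.
have [N1 h1] := ssum_cvg sc' d0; have [N2 h2] := expansion_uniform d0.
pose N := maxn N1 N2.
have [_ g1] := h1 N (leq_maxl _ _); have g2 := h2 N (leq_maxr _ _).
have [mS [L bS]] := S_regular N.
have Ivf : cintegrable I (fun x => v x * f x) by exact: cintegrableM Iv mf fK.
have IvS : cintegrable I (fun x => v x * S N x) by exact: cintegrableM Iv mS bS.
have Id := cintegrableB mI Ivf IvS.
have D1 : cmod (fourier (fun x => v x * f x) j - fourier (fun x => v x * S N x) j) <= C * (e / (C + 1)).
  rewrite -(fourierB _ Ivf IvS) -(@eq_fourier _ (fun x => v x * (f x - S N x))); last first.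
    by move=> x _; rewrite mulrBr.
  apply: fourier_mul_le; [exact: Iv| |exact: ltW d0|exact: g2].
  by apply: (eq_cintegrable mI _ Id) => x _; rewrite mulrBr.
have sE : csum setT (fun l => fourier v (j - frq n l) * coef n f (frq n l)) =
    csum setT (fun l => fourier v (j - frq n l) * a l).
  by apply: eq_csum => l; rewrite coef_frq.
have ssE : ssum (fun l => fourier v (j - frq n l) * coef n f (frq n l)) N =
    ssum (fun l => fourier v (j - frq n l) * a l) N.
  rewrite /ssum coef_frq; congr (_ + _); apply: eq_bigr => k _; by rewrite !coef_frq.
rewrite ssE in g1.
have -> : fourier (fun x => v x * f x) j - conv (fourier v) (coef n f) j =
    (fourier (fun x => v x * f x) j - fourier (fun x => v x * S N x) j) -
    (csum setT (fun l => fourier v (j - frq n l) * coef n f (frq n l)) -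
      ssum (fun l => fourier v (j - frq n l) * a l) N).
  by rewrite fourier_vS /conv cE; ring.
apply: le_trans (cmodB _ _) _; apply: le_trans (lerD D1 g1) _.
by rewrite Ee.
Qed.

End Expansion.

End PeriodicFunctions.

(** * Neumann eigenfunctions *)

Section NeumannAsymptotics.
Variable R : realType.
Local Notation mu := (@lebesgue_measure R).
Local Notation I := (@I0pi R).
Implicit Types (f g v y : R -> R[i]) (n : nat).

Let mI : measurable (I : set (measurableTypeR R)).
Proof. exact: measurable_I0pi. Qed.

Lemma tan_ge (t : R) : 0 <= t -> t < pi / 2 -> t <= tan t.
Proof.
rewrite le_eqVlt => /predU1P[<-|t0] tpi; first by rewrite tan0.
have cosp (x : R) : 0 <= x -> x <= t -> 0 < cos x.
  move=> x0 xt; apply: cos_gt0_pihalf; rewrite (le_lt_trans xt tpi) andbT.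
  by apply: lt_le_trans x0; rewrite oppr_lt0 divr_gt0 // pi_gt0.
have dt (x : R) : x \in `]0, t[ -> is_derive x 1 tan ((cos x) ^- 2).
  rewrite in_itv /= => /andP[x0 xt].
  by apply: is_derive_tan; rewrite gt_eqF // cosp // ltW.
have ct : {within `[0, t], continuous (@tan R)}.
  apply: continuous_in_subspaceT => x; rewrite inE /= in_itv /= => /andP[x0 xt].
  by apply: continuous_tan; rewrite gt_eqF // cosp.
have [c] := MVT t0 dt ct; rewrite in_itv /= => /andP[c0 ct'].
rewrite tan0 !subr0 => ->; rewrite ler_peMl ?(ltW t0) //.
have cc : 0 < cos c by rewrite cosp // ltW.
rewrite invf_ge1 ?exprn_gt0 //; rewrite expr_le1 // ?ltW //; exact: cos_le1.
Qed.

Lemma atan_le (x : R) : 0 <= x -> atan x <= x.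
Proof.
move=> x0; have a0 : 0 <= atan x by rewrite -atan0 le_atan.
by rewrite -{2}(atanK x); apply: tan_ge => //; exact: atan_ltpi2.
Qed.

Lemma tan_cos_neq0 (x : R) : cos (atan x) != 0.
Proof. by rewrite cos_atan invr_eq0 sqrtr_eq0 -ltNge ltr_pwDl // sqr_ge0. Qed.

(* pi/4 = 2 arctan(1/3) + arctan(1/7) *)
Lemma pi_lt : pi <= 13 / 4 :> R.
Proof.
set a := atan (3^-1 : R); set b := atan (7^-1 : R).
have ta : tan a = 3^-1 by exact: atanK.
have tb : tan b = 7^-1 by exact: atanK.
have ca : cos a != 0 by exact: tan_cos_neq0.
have cb : cos b != 0 by exact: tan_cos_neq0.
have a3 : a <= 3^-1 by apply: atan_le; rewrite invr_ge0.
have b7 : b <= 7^-1 by apply: atan_le; rewrite invr_ge0.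
have a0 : 0 <= a by rewrite -atan0 le_atan // invr_ge0.
have b0 : 0 <= b by rewrite -atan0 le_atan // invr_ge0.
have p2 : 2 <= pi :> R by exact: pi_ge2.
have cpos (x : R) : 0 <= x -> x <= 2 / 3 + 1 / 7 -> cos x != 0.
  move=> x0 x1; rewrite gt_eqF //; apply: cos_gt0_pihalf; apply/andP; split; lra.
have c2 : cos (a + a) != 0 by apply: cpos; lra.
have t2 : tan (a + a) = 3 / 4.
  by rewrite tanD // ta; field.
have t3 : tan (a + a + b) = 1.
  by rewrite tanD // t2 tb; field.
have : a + a + b = pi / 4.
  rewrite -atan1 -t3 tanK // in_itv /=; apply/andP; split; lra.
lra.
Qed.

Lemma Rint_subset (F : R -> R) (b : R) : mu.-integrable I (EFin \o F) ->
  (forall x, 0 <= F x) -> b <= pi -> Rintegral mu `[0, b] F <= Rintegral mu I F.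
Proof.
move=> iF F0 bpi.
have sub : `[0, b] `<=` I.
  by move=> x /=; rewrite in_itv /= => /andP[x0 xb]; apply/I0piP; rewrite x0 (le_trans xb).
have iFb : mu.-integrable `[0, b] (EFin \o F).
  by apply: integrableS iF; [exact: measurable_itv|exact: measurable_itv|exact: sub].
apply: fine_le.
- by apply: integrable_fin_num => //; exact: measurable_itv.
- by apply: integrable_fin_num => //; exact: mI.
- apply: ge0_subset_integral; [exact: measurable_itv|exact: mI| | |exact: sub].
    exact: measurable_int iF.
  by move=> x _; rewrite lee_fin.
Qed.

Lemma const_hill (K : R) : [/\ forall x, I x -> rderiv (fun=> K) x 0, rabs_continuous (fun=> (0 : R)),
   {ae mu, forall x, I x -> rderiv (fun=> (0 : R)) x 0} & mu.-integrable I (EFin \o (fun=> (0 : R)))].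
Proof.
split.
- by move=> x _; apply: is_derive_rderiv; exact: is_derive_cst.
- by apply: (@lipschitz_rabs_continuous _ _ 0) => // x y _ _; rewrite subrr normr0 mul0r.
- by apply: aeW => x _; apply: is_derive_rderiv; exact: is_derive_cst.
- by apply: icontinuous_integrable => //; apply: continuous_icontinuous => x; exact: cvg_cst.
Qed.

Lemma integrable_cos (k c b : R) : b <= pi -> mu.-integrable `[0, b] (EFin \o (fun t => cos (k * t + c))).
Proof. by move=> bpi; apply: icontinuous_integrable => //; exact: cos_affine_continuous. Qed.

Lemma integrable_cst_itv (K b : R) : b <= pi -> mu.-integrable `[0, b] (EFin \o (fun=> K)).
Proof.
move=> bpi; apply: icontinuous_integrable => //.
by apply: continuous_icontinuous => x; exact: cvg_cst.
Qed.

Lemma int_cst_itv (K b : R) : 0 <= b -> Rintegral mu `[0, b] (fun=> K) = K * b.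
Proof.
move=> b0; have E : mu `[0, b]%classic = b%:E.
  rewrite lebesgue_measure_itv /= lte_fin; case: ltP => h; first by rewrite oppr0 adde0.
  by have -> : b = 0 by apply/eqP; rewrite eq_le h b0.
transitivity (K * fine (mu `[0, b]%classic)); last by rewrite E.
by apply: Rintegral_cst; exact: measurable_itv.
Qed.

Lemma int_cos (k c b : R) : k != 0 -> 0 <= b <= pi ->
  Rintegral mu `[0, b] (fun t => cos (k * t + c)) = (sin (k * b + c) - sin c) / k.
Proof.
move=> k0 /andP[b0 bpi]; have [d1 a0 d0 i0] := const_hill 1.
have bI : 0 <= b <= pi by rewrite b0.
have := green_cos k c d1 a0 d0 i0 bI.
rewrite !mul0r !add0r !mulr1 RintegralZl; [|exact: measurable_itv|exact: integrable_cos].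
rewrite -mulrBr => h; apply: (mulfI (expf_neq0 2 k0)); rewrite -h.
by field.
Qed.

Lemma int_id_cos (k : R) : k != 0 -> sin (k * pi) = 0 -> cos (k * pi) = 1 ->
  Rintegral mu I (fun t => t * cos (k * t + 0)) = 0.
Proof.
move=> k0 sk ck; have [_ a0 d0 i0] := const_hill 1.
have did x : I x -> rderiv id x (1 : R).
  by move=> _; apply: is_derive_rderiv; exact: is_derive_id.
have a1 : rabs_continuous (fun=> (1 : R)).
  by apply: (@lipschitz_rabs_continuous _ _ 0) => // x y _ _; rewrite subrr normr0 mul0r.
have d1 : {ae mu, forall x, I x -> rderiv (fun=> (1 : R)) x 0}.
  by apply: aeW => x _; apply: is_derive_rderiv; exact: is_derive_cst.
have pI : (0 : R) <= pi <= (pi : R) by apply/andP; split; [exact: pi_ge0|exact: lexx].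
have := green_cos k 0 did a1 d1 i0 pI.
rewrite !addr0 sk ck cos0 sin0 !mulr0 !addr0 subrr => /esym.
have -> : (fun t => (0 + k ^+ 2 * id t) * cos (k * t + 0)) = (fun t => k ^+ 2 * (t * cos (k * t + 0))).
  by apply/funext => t; rewrite add0r mulrA.
rewrite RintegralZl //; last first.
  apply: integrable_Mcontinuous; last exact: cos_affine_continuous.
  by apply: icontinuous_integrable => //; apply: continuous_icontinuous => x; exact: cvg_id.
by move=> /eqP; rewrite mulf_eq0 expf_eq0 /= (negPf k0) => /eqP.
Qed.

(* Young's inequality: |c| <= (c^2 + 0.49) / 1.4 *)
Lemma norm_cos_le (t : R) : `|cos t| <= 99 / 140 + 5 / 14 * cos (2 * t).
Proof.
have -> : cos (2 * t) = 2 * cos t ^+ 2 - 1 by rewrite mulr_natl cos_mulr2n mulr_natl.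
rewrite -[X in X ^+ 2]/(cos t).
have h : 0 <= (`|cos t| - 7 / 10) ^+ 2 by exact: sqr_ge0.
have e : `|cos t| ^+ 2 = cos t ^+ 2 by rewrite real_normK ?num_real.
by rewrite -e; nra.
Qed.

Lemma int_norm_cos (n : nat) (c b : R) : (0 < n)%N -> 0 <= b <= pi ->
  Rintegral mu `[0, b] (fun t => `|cos (n%:R * t + c)|) <= 99 / 140 * b + n%:R^-1.
Proof.
move=> n0 /andP[b0 bpi]; have bI : 0 <= b <= pi by rewrite b0.
have nr : (0 : R) < n%:R by rewrite ltr0n.
have k0 : 2 * n%:R != 0 :> R by rewrite mulf_neq0 // gt_eqF.
apply: (@le_trans _ _ (Rintegral mu `[0, b] (fun t => 99 / 140 + 5 / 14 * cos (2 * n%:R * t + 2 * c)))).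
  apply: le_Rintegral; [exact: measurable_itv| | |].
  - exact/integrable_norm/integrable_cos.
  - apply: integrableD_real; [exact: measurable_itv|exact: integrable_cst_itv|].
    by apply: integrableZ_real; [exact: measurable_itv|exact: integrable_cos].
  - move=> t _; have -> : 2 * n%:R * t + 2 * c = 2 * (n%:R * t + c) by ring.
    exact: norm_cos_le.
rewrite RintegralD; [|exact: measurable_itv|exact: integrable_cst_itv|]; last first.
  by apply: integrableZ_real; [exact: measurable_itv|exact: integrable_cos].
rewrite int_cst_itv // RintegralZl; [|exact: measurable_itv|exact: integrable_cos].
rewrite int_cos // lerD2l mulrA.
have h : sin (2 * n%:R * b + 2 * c) - sin (2 * c) <= 2.
  by have := sin_le1 (2 * n%:R * b + 2 * c); have := sin_geN1 (2 * c); lra.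
rewrite ler_pdivrMr; last by rewrite mulr_gt0.
rewrite mulrCA mulVf ?gt_eqF // mulr1.
lra.
Qed.

(** The constant is 99/140 times the integral pi^2 / 2 of t; the oscillating part drops out because
    t cos(2nt) has integral 0 over [0, pi]. *)
Lemma int_id_norm_cos n : (0 < n)%N ->
  Rintegral mu I (fun t => t * `|cos (n%:R * t)|) <= 99 / 280 * pi ^+ 2.
Proof.
move=> n0; have nr : (0 : R) < n%:R by rewrite ltr0n.
have k0 : 2 * n%:R != 0 :> R by rewrite mulf_neq0 // gt_eqF.
have [e1 e2] := cos_nat_pi R (2 * n).
have id_c : icontinuous (fun t : R => t) by apply: continuous_icontinuous => x; exact: cvg_id.
have iid : mu.-integrable I (EFin \o (fun t : R => t)) by exact: icontinuous_integrable.
have itc : mu.-integrable I (EFin \o (fun t => t * cos (2 * n%:R * t + 0))).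
  by apply: integrable_Mcontinuous => //; exact: cos_affine_continuous.
apply: (@le_trans _ _ (Rintegral mu I (fun t => 99 / 140 * t + 5 / 14 * (t * cos (2 * n%:R * t + 0))))).
  apply: le_Rintegral => //.
  - apply: integrable_Mcontinuous => //.
    have c1 := @cos_affine_continuous R n%:R 0.
    move=> x Ix e e0; have [d d0 hd] := c1 x Ix e e0; exists d => // y Iy yd.
    have := hd y Iy yd; rewrite !addr0; apply: le_trans.
    exact: ler_dist_dist.
  - apply: integrableD_real => //; first exact: integrableZ_real.
    exact: integrableZ_real.
  - move=> t /I0piP/andP[t0 _].
    have -> : 99 / 140 * t + 5 / 14 * (t * cos (2 * n%:R * t + 0)) =
      t * (99 / 140 + 5 / 14 * cos (2 * (n%:R * t))) by rewrite addr0 -(mulrA 2); ring.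
    by apply: ler_wpM2l => //; exact: norm_cos_le.
rewrite RintegralD //; [|exact: integrableZ_real..].
have s2 : sin (2 * n%:R * pi) = 0 :> R by move: e2; rewrite natrM.
have c2 : cos (2 * n%:R * pi) = 1 :> R by move: e1; rewrite natrM exprM sqrrN !expr1n.
rewrite !RintegralZl // (int_id_cos k0 s2 c2).
have pI : (0 : R) <= pi <= (pi : R) by apply/andP; split; [exact: pi_ge0|exact: lexx].
have -> : Rintegral mu I (fun t : R => t) = pi ^+ 2 / 2.
  have sq (x : R) : I x -> rderiv (fun t : R => 2^-1 * (t * t)) x x.
    move=> Ix; have h : rderiv (id : R -> R) x 1 by apply: is_derive_rderiv; exact: is_derive_id.
    by have := @rderivZ R _ _ 2^-1 _ (rderivM id_c Ix h h); rewrite mul1r mulr1 /= (_ : 2^-1 * (x + x) = x) //; field.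
  rewrite -(@abs_continuous_FTC _ (fun t : R => 2^-1 * (t * t))) //.
  - by rewrite mul0r mulr0 subr0; field.
  - apply: (@lipschitz_rabs_continuous _ _ pi); first exact: pi_ge0.
    move=> x y /I0piP/andP[x0 x1] /I0piP/andP[y0 y1].
    have -> : 2^-1 * (y * y) - 2^-1 * (x * x) = (y + x) / 2 * (y - x) by field.
    by rewrite normrM ler_wpM2r // ger0_norm; lra.
  - by apply: aeW => x; exact: sq.
rewrite mulr0 addr0; clear; move: (pi ^+ 2) => x; have -> : 99 / 140 * (x / 2) = 99 / 280 * x by field.
exact: lexx.
Qed.

End NeumannAsymptotics.

Section NeumannEigenfunction.
Variable R : realType.
Local Notation mu := (@lebesgue_measure R).
Local Notation I := (@I0pi R).
Implicit Types (f g v y : R -> R[i]) (n : nat).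

Let mI : measurable (I : set (measurableTypeR R)).
Proof. exact: measurable_I0pi. Qed.

Lemma in_Lp_cintegrable (p : R) f : 1 <= p -> in_Lp p f -> cintegrable I f.
Proof.
move=> p1 [m1 m2 fin].
have mc : measurable_fun I (fun x => cmod (f x)).
  under eq_fun do rewrite cmodE.
  apply: measurableT_comp; first exact: continuous_measurable_fun (@sqrt_continuous R).
  by apply: measurable_funD; apply: measurable_funX.
have mp : measurable_fun I (fun x => cmod (f x) `^ p).
  exact: (measurableT_comp (measurable_powR p) mc).
have ip : mu.-integrable I (EFin \o (fun x => cmod (f x) `^ p)).
  apply/integrableP; split; first exact/measurable_EFinP.
  under eq_integral => x _ do rewrite /= ger0_norm ?powR_ge0 //.
  exact: fin.
have dom := integrableD_real mI (cintegrable_cst 1).1 ip.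
have H (F : R -> R) : measurable_fun I F -> (forall x, I x -> `|F x| <= cmod (f x)) ->
    mu.-integrable I (EFin \o F).
  move=> mF Ff; apply: le_integrable dom => //; first exact/measurable_EFinP.
  move=> x Ix /=; rewrite lee_fin [leRHS]ger0_norm ?addr_ge0 ?powR_ge0 //.
  apply: le_trans (Ff x Ix) _.
  have [c1|c1] := leP (cmod (f x)) 1; first by rewrite (le_trans c1) // lerDl powR_ge0.
  apply: (@le_trans _ _ (cmod (f x) `^ p)); last by rewrite lerDr.
  by rewrite -{1}(powRr1 (cmod_ge0 (f x))) ler_powR // ltW.
by split; apply: H => // x _; [exact: Re_le_cmod|exact: Im_le_cmod].
Qed.

Lemma hill_op_data v bc f g : cintegrable I v -> hill_op v bc f g ->
  exists f1, [/\ hill_data f f1 (fun x => v x * f x - g x), satisfies_bc bc f f1 & cintegrable I g].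
Proof.
move=> Iv [f1 [f2 [df acf1 df1 bcf [Lg gE]]]]; exists f1.
have Ig : cintegrable I g by apply: in_Lp_cintegrable Lg; rewrite ler1n.
have [mf [K fK] _] := differentiable_regular df acf1.
split => //; split => //.
  apply: filterS2 df1 gE; first exact: (ae_filter_ringOfSetsType mu).
  move=> x h1 h2 Ix.
  by rewrite h2 // opprD opprK addrCA subrr addr0; exact: h1.
by apply: cintegrableB => //; exact: cintegrableM Iv mf fK.
Qed.

Lemma hill_data_eq f f1 f2 g2 : (forall x, I x -> f2 x = g2 x) -> hill_data f f1 f2 -> hill_data f f1 g2.
Proof.
move=> fg [df acf1 df1 If2]; split=> //; last exact: eq_cintegrable mI fg If2.
apply: filterS df1; first exact: (ae_filter_ringOfSetsType mu).
by move=> x h Ix; rewrite -fg //; exact: h.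
Qed.

Lemma hill_data_lin f f1 f2 g g1 g2 (k : R[i]) : hill_data f f1 f2 -> hill_data g g1 g2 ->
  hill_data (fun x => f x + k * g x) (fun x => f1 x + k * g1 x) (fun x => f2 x + k * g2 x).
Proof.
have lin (h h' : R -> R[i]) x a b : has_deriv h x a -> has_deriv h' x b ->
    has_deriv (fun x => h x + k * h' x) x (a + k * b).
  move=> [h1 h2] [h3 h4]; split.
    change (rderiv (fun t => complex.Re (h t + k * h' t)) x (complex.Re (a + k * b))).
    have := rderivD h1 (rderivD (@rderivZ R _ _ (complex.Re k) _ h3) (@rderivZ R _ _ (- complex.Im k) _ h4)).
    rewrite cReD cReM -mulNr; congr (rderiv _ _ _).
    by apply/funext => t; rewrite cReD cReM mulNr.
  change (rderiv (fun t => complex.Im (h t + k * h' t)) x (complex.Im (a + k * b))).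
  have := rderivD h2 (rderivD (@rderivZ R _ _ (complex.Re k) _ h4) (@rderivZ R _ _ (complex.Im k) _ h3)).
  rewrite cImD cImM; congr (rderiv _ _ _).
  by apply/funext => t; rewrite cImD cImM.
move=> [df acf df1 If2] [dg acg dg1 Ig2]; split.
- by move=> x Ix; apply: lin; [exact: df|exact: dg].
- move=> e e0; have e2 : 0 < e / 2 by rewrite divr_gt0.
  have k0 : 0 < cmod k + 1 by rewrite ltr_wpDl // cmod_ge0.
  have [d1 d10 h1] := acf _ e2; have [d2 d20 h2] := acg (e / 2 / (cmod k + 1)) (divr_gt0 e2 k0).
  exists (Num.min d1 d2); first by rewrite lt_min d10.
  move=> m a b ab tab; rewrite lt_min => /andP[s1 s2].
  have H1 := h1 m a b ab tab s1; have := h2 m a b ab tab s2.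
  rewrite ltr_pdivlMr // => H2.
  apply: (@le_lt_trans _ _ (\sum_(i < m) cmod (f1 (b i) - f1 (a i)) +
     cmod k * \sum_(i < m) cmod (g1 (b i) - g1 (a i)))).
    rewrite mulr_sumr -big_split /=; apply: ler_sum => i _.
    have -> : f1 (b i) + k * g1 (b i) - (f1 (a i) + k * g1 (a i)) =
      (f1 (b i) - f1 (a i)) + k * (g1 (b i) - g1 (a i)) by ring.
    by apply: le_trans (cmodD _ _) _; rewrite cmodM.
  have S0 : 0 <= \sum_(i < m) cmod (g1 (b i) - g1 (a i)) by apply: sumr_ge0 => i _; exact: cmod_ge0.
  move: (\sum_(i < m) _) (\sum_(i < m) _) (cmod k) H1 H2 S0 => A B K; clear; nra.
- apply: filterS2 df1 dg1; first exact: (ae_filter_ringOfSetsType mu).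
  by move=> x h1 h2 Ix; apply: lin; [exact: h1|exact: h2].
- by apply: cintegrableD => //; exact: cintegrableZ.
Qed.

Lemma hill_data_green_cos f f1 f2 (k c b : R) : hill_data f f1 f2 -> 0 <= b <= pi ->
  (cos (k * b + c))%:C * f1 b + (k * sin (k * b + c))%:C * f b
  - ((cos c)%:C * f1 0 + (k * sin c)%:C * f 0)
  = cint `[0, b] (fun t => (f2 t + (k ^+ 2)%:C * f t) * (cos (k * t + c))%:C).
Proof.
move=> [df acf1 dF1 [i1 i2]] bI; have [ac1 ac2] := abs_continuous_ReIm acf1.
have d1 x : I x -> rderiv (fun x => complex.Re (f x)) x (complex.Re (f1 x)) by move=> /df[].
have d2 x : I x -> rderiv (fun x => complex.Im (f x)) x (complex.Im (f1 x)) by move=> /df[].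
have dd1 : {ae mu, forall x, I x -> rderiv (fun x => complex.Re (f1 x)) x (complex.Re (f2 x))}.
  by apply: filterS dF1; [exact: (ae_filter_ringOfSetsType mu)|move=> x h /h []].
have dd2 : {ae mu, forall x, I x -> rderiv (fun x => complex.Im (f1 x)) x (complex.Im (f2 x))}.
  by apply: filterS dF1; [exact: (ae_filter_ringOfSetsType mu)|move=> x h /h []].
have G1 := @green_cos R _ _ _ k c b d1 ac1 dd1 i1 bI.
have G2 := @green_cos R _ _ _ k c b d2 ac2 dd2 i2 bI.
apply: complex_eq; rewrite /cint [RHS]/=.
- rewrite (_ : (fun x => complex.Re _) = (fun t => (complex.Re (f2 t) + k ^+ 2 * complex.Re (f t)) * cos (k * t + c))).
    by rewrite -G1 !(cReM, cReD, cReN) /=; ring.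
  by apply/funext => t; rewrite !(cReM, cReD) /=; ring.
- rewrite (_ : (fun x => complex.Im _) = (fun t => (complex.Im (f2 t) + k ^+ 2 * complex.Im (f t)) * cos (k * t + c))).
    by rewrite -G2 !(cImM, cImD, cImN) /=; ring.
  by apply/funext => t; rewrite !(cImM, cImD) /=; ring.
Qed.

End NeumannEigenfunction.

(** Meant for p = pi and Y = |y(0)|. The margin is thin: the bound on D is at most 123/250 p Y,
    against p Y / 2 on the left, and 2/125 is 2 (1/2 - 123/250). This dictates the precision of the
    bounds on pi and on the mean of |cos|. *)
Lemma neumann_low_aux (F : realFieldType) (p Y D w : F) : 0 < Y -> 2 <= p -> p <= 13 / 4 ->
  D <= 50 / 21 * Y * (1 / 320 * p + 99 / 560 * (99 / 280 * p ^+ 2)) ->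
  p / 2 * Y <= D + w -> 2 / 125 * Y <= w.
Proof.
move=> Y0 p2 p13 dle h.
have pp : p ^+ 2 <= 13 / 4 * p by rewrite expr2 ler_wpM2r //; lra.
have h1 : 50 / 21 * Y * (1 / 320 * p + 99 / 560 * (99 / 280 * p ^+ 2)) <=
     50 / 21 * Y * (1 / 320 * p + 99 / 560 * (99 / 280 * (13 / 4 * p))).
  by apply: ler_wpM2l; lra.
have h2 : 2 * Y <= p * Y by rewrite ler_wpM2r //; lra.
have h3 : 50 / 21 * Y * (1 / 320 * p + 99 / 560 * (99 / 280 * (13 / 4 * p))) <= 123 / 250 * (p * Y).
  have -> : 50 / 21 * Y * (1 / 320 * p + 99 / 560 * (99 / 280 * (13 / 4 * p))) =
    (50 / 21 * (1 / 320 + 99 / 560 * (99 / 280 * (13 / 4)))) * (p * Y) by ring.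
  by rewrite ler_wpM2r //; lra.
move: h dle h1 h3; rewrite (mulrAC p).
move: (50 / 21 * Y * _) (50 / 21 * Y * _) (p * Y) h2; clear => a b c; lra.
Qed.

(** 150 rounds up the quotient of 50/21 by 2/125, about 148.8. *)
Lemma neumann_z_aux (F : realFieldType) (Z Y a : F) : 0 < Y -> 0 <= a ->
  Z * (2 / 125 * Y) <= 50 / 21 * Y * a -> Z <= 150 * a.
Proof.
move=> Y0 a0 h; have : Z * (2 / 125) <= 50 / 21 * a.
  by rewrite -(ler_pM2r Y0); move: h; congr (_ <= _); ring.
lra.
Qed.

(** 1200 rounds up 50/21 (1 + 150 * 33/10), about 1181. *)
Lemma neumann_close_aux (F : realFieldType) (p b m a Y : F) : 0 < Y -> 0 <= a -> b <= 13 / 4 -> m <= 1 ->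
  50 / 21 * Y * (a + 150 * a * (99 / 140 * b + m)) <= 1200 * a * Y.
Proof.
move=> Y0 a0 b1 m1; have h : 99 / 140 * b + m <= 33 / 10 by lra.
have : 150 * a * (99 / 140 * b + m) <= 150 * a * (33 / 10) by apply: ler_wpM2l; lra.
rewrite (mulrAC (50 / 21)) => h'.
have : 50 / 21 * (a + 150 * a * (99 / 140 * b + m)) <= 1200 * a by lra.
by move=> h2; rewrite ler_wpM2r // ltW.
Qed.

(** * A priori bounds for Neumann eigenfunctions *)

Section NeumannBounds.
Variable R : realType.
Local Notation mu := (@lebesgue_measure R).
Local Notation I := (@I0pi R).

Let mI : measurable (I : set (measurableTypeR R)).
Proof. exact: measurable_I0pi. Qed.

Variables (v : R -> R[i]) (n : nat) (z : R[i]) (y y1 : R -> R[i]).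
Hypotheses (Iv : cintegrable I v) (n0 : (0 < n)%N).
Hypothesis hy : hill_data y y1 (fun x => v x * y x - ((n ^ 2)%:R + z) * y x).
Hypotheses (y10 : y1 0 = 0) (y1pi : y1 pi = 0).

Local Notation A := (Rintegral mu I (fun x => cmod (v x))).

Let nr : (0 : R) < n%:R. Proof. by rewrite ltr0n. Qed.

Lemma norm_v_ge0 : 0 <= A.
Proof. by apply: Rintegral_ge0 => x _; exact: cmod_ge0. Qed.

Let source x : v x * y x - ((n ^ 2)%:R + z) * y x + (n%:R ^+ 2)%:C * y x = v x * y x - z * y x.
Proof. by rewrite natrX rmorphXn /= -natrC; ring. Qed.

(** Variation of constants, obtained from Green's identity. In the term with z, which may be as
    large as n/4, the kernel is kept inside the integral so that only its mean counts; in the term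
    with [v] it is bounded by 1. *)
Lemma neumann_duhamel (b S r : R) : 0 <= b <= pi -> cbounded y S -> cmod z <= r ->
  n%:R * cmod (y b - (cos (n%:R * b))%:C * y 0) <= S * (A + r * (99 / 140 * b + n%:R^-1)).
Proof.
move=> bI yS zr; have /andP[b0 bpi] := bI.
have sub : `[0, b] `<=` I.
  by move=> x /=; rewrite in_itv /= => /andP[x0 xb]; apply/I0piP; rewrite x0 (le_trans xb).
have mb : measurable (`[0, b] : set (measurableTypeR R)) by exact: measurable_itv.
have S0 : 0 <= S by apply: le_trans (cmod_ge0 _) (yS 0 _); apply/I0piP; rewrite lexx pi_ge0.
have [my _ _] := hill_data_regular hy.
(* With this shift the test function cos(nt + c) is sin(n (b - t)), the kernel of the initial value
   problem. *)
pose c : R := pi / 2 - n%:R * b.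
have e1 : cos (n%:R * b + c) = 0 by rewrite /c subrKC cos_pihalf.
have e2 : sin (n%:R * b + c) = 1 by rewrite /c subrKC sin_pihalf.
have e3 : sin c = cos (n%:R * b) by rewrite /c addrC sinDpihalf cosN.
have := hill_data_green_cos n%:R c hy bI.
rewrite e1 e2 e3 y10 mulr1 => h.
have {}h : (n%:R)%:C * (y b - (cos (n%:R * b))%:C * y 0) = cint `[0, b]
    (fun t => (v t * y t - ((n ^ 2)%:R + z) * y t + (n%:R ^+ 2)%:C * y t) * (cos (n%:R * t + c))%:C).
  by rewrite -h rmorphM /= (_ : 0%:C = 0) // !(mul0r, mulr0, add0r) mulrBr mulrA.
move: h => /(congr1 (@cmod R)); rewrite cmodM cmod_real ger0_norm // => ->.
pose F t := (v t * y t - ((n ^ 2)%:R + z) * y t + (n%:R ^+ 2)%:C * y t) * (cos (n%:R * t + c))%:C.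
rewrite -/(cint _ F).
have mcos : cmeasurable (fun t => (cos (n%:R * t + c))%:C).
  split => /=; last exact: measurable_cst.
  by apply: icontinuous_measurable; exact: cos_affine_continuous.
have bcos : cbounded (fun t => (cos (n%:R * t + c))%:C) 1.
  by move=> x _; rewrite cmod_real; exact: cos_max.
have IF' : cintegrable I (fun t => (v t * y t - z * y t) * (cos (n%:R * t + c))%:C).
  apply: cintegrableM mcos bcos; apply: cintegrableB => //; first exact: cintegrableM Iv my yS.
  by apply: cintegrableZ => //; exact: cintegrable_bounded my yS.
have IF : cintegrable `[0, b] F.
  have [i1 i2] : cintegrable I F.
    by apply: (eq_cintegrable mI _ IF') => x _; rewrite /F source.
  by split; [apply: integrableS i1|apply: integrableS i2].
have icv := cintegrable_cmod mI Iv.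
have icvb : mu.-integrable `[0, b] (EFin \o (fun x => cmod (v x))) by apply: integrableS icv.
have icos := integrable_norm (integrable_cos n%:R c bpi).
apply: le_trans (cint_le mb IF) _.
apply: (@le_trans _ _ (Rintegral mu `[0, b] (fun t => S * (cmod (v t) + r * `|cos (n%:R * t + c)|)))).
  apply: le_Rintegral => //.
  - exact: cintegrable_cmod.
  - by apply: integrableZ_real => //; apply: integrableD_real => //; exact: integrableZ_real.
  - move=> t tb; rewrite /F source -mulrBl !cmodM cmod_real.
    have yt := yS t (sub t tb); have c1 := cos_max (n%:R * t + c).
    have h := cmodB (v t) z.
    rewrite mulrAC mulrC; apply: ler_pM => //; first exact: cmod_ge0.
      by rewrite mulr_ge0 ?cmod_ge0.
    apply: (@le_trans _ _ ((cmod (v t) + cmod z) * `|cos (n%:R * t + c)|)); first exact: ler_wpM2r.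
    by rewrite mulrDl lerD // ?ler_piMr ?cmod_ge0 // ler_wpM2r.
rewrite RintegralZl //; last by apply: integrableD_real => //; exact: integrableZ_real.
rewrite RintegralD //; last exact: integrableZ_real.
rewrite RintegralZl //; apply: ler_wpM2l => //; apply: lerD.
  by apply: Rint_subset => // x; exact: cmod_ge0.
apply: ler_wpM2l; first exact: le_trans (cmod_ge0 _) zr.
exact: int_norm_cos.
Qed.

Hypothesis zn : cmod z <= n%:R / 4.
Hypothesis nA : 400 * (A + 1) <= n%:R.

Let pi2 : 2 <= pi :> R. Proof. exact: pi_ge2. Qed.
Let pi13 : pi <= 13 / 4 :> R. Proof. exact: pi_lt. Qed.

(** Division by n with |z| <= n/4: the mean of the kernel gives 99/140 * 1/4 = 99/560, and the rest,
    (A + 1/4) / n, is below 1/320. *)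
Let duhamel' (b S : R) : 0 <= b <= pi -> cbounded y S ->
  cmod (y b - (cos (n%:R * b))%:C * y 0) <= S * (1 / 320 + 99 / 560 * b).
Proof.
move=> bI yS; have h := neumann_duhamel bI yS zn.
have S0 : 0 <= S by apply: le_trans (cmod_ge0 _) (yS 0 _); apply/I0piP; rewrite lexx pi_ge0.
rewrite -(ler_pM2l nr); apply: le_trans h _; rewrite [leRHS]mulrCA ler_wpM2l //.
have := norm_v_ge0; move: (Rintegral _ _ _) nA => a nA' a0.
have e : n%:R / 4 * (99 / 140 * b + n%:R^-1) = n%:R * (99 / 560 * b) + 4^-1 :> R.
  by field; rewrite gt_eqF.
rewrite e mulrDr; move: (n%:R) nA' => N nA'; move: (N * (99 / 560 * b)) => w; lra.
Qed.

(** For b <= 13/4 the factor 1/320 + 99/560 b stays below 29/50, so variation of constants is a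
    contraction, and 50/21 is 1 / (1 - 29/50). *)
Lemma neumann_sup : cbounded y (50 / 21 * cmod (y 0)).
Proof.
have [_ [K yK] _] := hill_data_regular hy.
move=> x Ix; rewrite -[x]/(sval (exist _ x Ix)); move: (exist _ _ _) => a.
have q0 : 0 <= 29 / 50 :> R by lra.
have q1 : 29 / 50 < 1 :> R by lra.
have H := @sup_contraction R {x | I x} (fun x => cmod (y (sval x))) K (cmod (y 0)) (29 / 50) q0 q1.
suff : cmod (y (sval a)) * (1 - 29 / 50) <= cmod (y 0) by lra.
apply: H.
- by case=> x' Ix' /=; rewrite cmod_ge0 yK.
- move=> S hS [b Ib] /=; have bI : 0 <= b <= pi by apply/I0piP.
  have yS : cbounded y S by move=> t It; exact: (hS (exist _ t It)).
  have S0 : 0 <= S by apply: le_trans (cmod_ge0 _) (yS b Ib).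
  have := duhamel' bI yS; have := cmod_triang (y b) ((cos (n%:R * b))%:C * y 0).
  rewrite cmodM cmod_real; have c1 := cos_max (n%:R * b).
  have c2 : `|cos (n%:R * b)| * cmod (y 0) <= cmod (y 0) by rewrite ler_piMl ?cmod_ge0.
  have /andP[b0 bp] := bI; have p13 := pi13.
  have : S * (1 / 320 + 99 / 560 * b) <= S * (29 / 50) by rewrite ler_wpM2l //; lra.
  lra.
Qed.

Lemma neumann_value0 : (exists2 x, I x & y x != 0) -> 0 < cmod (y 0).
Proof.
move=> [x Ix yx]; have := neumann_sup Ix; have := cmod_gt0 yx; lra.
Qed.

Let ncos x : R[i] := (cos (n%:R * x + 0))%:C.
Let mcos : cmeasurable ncos.
Proof.
split => /=; last exact: measurable_cst.
by apply: icontinuous_measurable; exact: cos_affine_continuous.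
Qed.
Let bcos : cbounded ncos 1.
Proof. by move=> x _; rewrite cmod_real; exact: cos_max. Qed.

Let cint_cos2 : cint I (fun x => ncos x * ncos x) = (pi / 2)%:C.
Proof.
have k0 : 2 * n%:R != 0 :> R by rewrite mulf_neq0 // gt_eqF.
have [e1 e2] := @cos_nat_pi R (2 * n).
have pI : (0 : R) <= pi <= (pi : R) by apply/andP; split; [exact: pi_ge0|exact: lexx].
have h : Rintegral mu I (fun t => cos (2 * n%:R * t + 0)) = 0.
  by rewrite (int_cos 0 k0 pI) !addr0 sin0 subr0 -natrM e2 mul0r.
have i2 := integrable_cos (2 * n%:R) 0 (lexx (pi : R)).
apply: complex_eq; rewrite /cint [LHS]/=; last first.
  rewrite (_ : (fun x => _) = fun=> 0); last by apply/funext => x; rewrite /ncos /=; ring.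
  by rewrite Rintegral_pi_cst mul0r.
rewrite (_ : (fun x => _) = fun x => 2^-1 + 2^-1 * cos (2 * n%:R * x + 0)); last first.
  apply/funext => x; have -> : 2 * n%:R * x + 0 = (n%:R * x) *+ 2 by rewrite addr0 mulr2n; ring.
  by rewrite cos_mulr2n mulr2n /ncos /= !addr0; field.
rewrite RintegralD //; [|exact (cintegrable_cst (2^-1)%:C).1|exact: integrableZ_real].
by rewrite Rintegral_pi_cst RintegralZl // h mulr0 addr0 mulrC.
Qed.

(** Testing against cos nx, itself a Neumann eigenfunction for [v] = 0, removes n^2 and all boundary
    terms. *)
Let z_eq : z * cint I (fun x => y x * ncos x) = cint I (fun x => v x * y x * ncos x).
Proof.
have [my [K yK] _] := hill_data_regular hy.
have Ivy : cintegrable I (fun x => v x * y x * ncos x).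
  by apply: cintegrableM mcos bcos; exact: cintegrableM Iv my yK.
have Iy : cintegrable I (fun x => y x * ncos x).
  by apply: cintegrableM mcos bcos; exact: cintegrable_bounded my yK.
have pI : (0 : R) <= pi <= (pi : R) by apply/andP; split; [exact: pi_ge0|exact: lexx].
have := hill_data_green_cos n%:R 0 hy pI.
have [e1 e2] := @cos_nat_pi R n.
rewrite addr0 e2 sin0 y10 y1pi !(mulr0, mul0r, addr0). rewrite subrr => h.
apply/eqP; rewrite eq_sym -subr_eq0 -cintZ // -cintB //; last exact: cintegrableZ.
rewrite [X in _ == X]h; apply/eqP; apply: eq_cint => x _.
by rewrite source mulrBl (mulrA z).
Qed.

(** Improves the a priori bound n/4 to one independent of n. In [z_eq] the right side is O(|y(0)|),
    so what matters is that y does not become nearly orthogonal to cos nx. *)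
Lemma neumann_z_bound : 0 < cmod (y 0) -> cmod z <= 150 * A.
Proof.
move=> y00; have [my [K yK] _] := hill_data_regular hy; have yS := neumann_sup.
set S := 50 / 21 * cmod (y 0) in yS.
have S0 : 0 <= S by rewrite mulr_ge0 ?cmod_ge0.
have Iy : cintegrable I (fun x => y x * ncos x).
  by apply: cintegrableM mcos bcos; exact: cintegrable_bounded my yK.
have Icc : cintegrable I (fun x => ncos x * ncos x).
  by apply: cintegrableM mcos bcos; exact: cintegrable_bounded mcos bcos.
have Ivy : cintegrable I (fun x => v x * y x) by exact: cintegrableM Iv my yK.
have Ivyc : cintegrable I (fun x => v x * y x * ncos x) by exact: cintegrableM Ivy mcos bcos.
have icv := cintegrable_cmod mI Iv.
have up : cmod (cint I (fun x => v x * y x * ncos x)) <= S * A.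
  apply: le_trans (cint_le mI Ivyc) _; rewrite -RintegralZl //; apply: le_Rintegral => //.
  - exact: cintegrable_cmod.
  - exact: integrableZ_real.
  - move=> x Ix; rewrite !cmodM.
    have c1 := bcos Ix; have h := yS x Ix.
    apply: (@le_trans _ _ (cmod (v x) * cmod (y x))); first by rewrite ler_piMr ?mulr_ge0 ?cmod_ge0.
    by rewrite mulrC ler_wpM2r ?cmod_ge0.
(* The main part integrates to pi / 2 times y(0). In the part of the error that grows with x, the
   factor |cos nx| is kept for the sake of its mean. *)
pose d x := y x * ncos x - y 0 * (ncos x * ncos x).
have Id : cintegrable I d by apply: cintegrableB => //; exact: cintegrableZ.
have id_c : icontinuous (fun t : R => t) by apply: continuous_icontinuous => x; exact: cvg_id.
have iid : mu.-integrable I (EFin \o (fun t : R => t)) by exact: icontinuous_integrable.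
have incos : mu.-integrable I (EFin \o (fun t => cmod (ncos t))).
  by apply: cintegrable_cmod => //; exact: cintegrable_bounded mcos bcos.
have iidc : mu.-integrable I (EFin \o (fun t => t * cmod (ncos t))).
  apply: integrable_Mcontinuous => // x Ix e e0.
  have [d' d0 hd] := @cos_affine_continuous R n%:R 0 x Ix e e0; exists d' => // t It td.
  rewrite !cmod_real; apply: le_trans (hd t It td); exact: ler_dist_dist.
have wint (a b : R) : 0 <= a -> 0 <= b ->
    Rintegral mu I (fun t => S * (a * cmod (ncos t) + b * (t * cmod (ncos t)))) <=
    S * (a * pi + b * (99 / 280 * pi ^+ 2)).
  move=> a0 b0; rewrite RintegralZl //; last first.
    by apply: integrableD_real => //; exact: integrableZ_real.
  apply: ler_wpM2l => //; rewrite RintegralD //; [|exact: integrableZ_real..].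
  rewrite !RintegralZl //; apply: lerD; apply: ler_wpM2l => //.
    rewrite -[leRHS]mul1r -Rintegral_pi_cst; apply: le_Rintegral => //.
    exact (cintegrable_cst (1%:C)).1.
  have := @int_id_norm_cos R n n0.
  by congr (_ <= _); apply: eq_Rintegral => t _; rewrite /ncos cmod_real addr0.
have dle : cmod (cint I d) <= S * (1 / 320 * pi + 99 / 560 * (99 / 280 * pi ^+ 2)).
  apply: le_trans (cint_le mI Id) _.
  apply: (@le_trans _ _ (Rintegral mu I
      (fun t => S * (1 / 320 * cmod (ncos t) + 99 / 560 * (t * cmod (ncos t)))))).
    apply: le_Rintegral => //.
    - exact: cintegrable_cmod.
    - apply: integrableZ_real => //; apply: integrableD_real => //; exact: integrableZ_real.
    - move=> t It; have tI : 0 <= t <= pi by apply/I0piP.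
      have -> : d t = (y t - (cos (n%:R * t))%:C * y 0) * ncos t by rewrite /d /ncos addr0; ring.
      have -> : S * (1 / 320 * cmod (ncos t) + 99 / 560 * (t * cmod (ncos t))) =
        S * (1 / 320 + 99 / 560 * t) * cmod (ncos t) by ring.
      rewrite cmodM; apply: ler_wpM2r; first exact: cmod_ge0.
      exact: duhamel'.
  have h1 : 0 <= 1 / 320 :> R by lra.
  have h2 : 0 <= 99 / 560 :> R by lra.
  exact (wint _ _ h1 h2).
have E : cint I (fun x => y x * ncos x) = (pi / 2)%:C * y 0 + cint I d.
  rewrite /d cintB //; last exact: cintegrableZ.
  by rewrite cintZ // cint_cos2 addrCA mulrC subrr addr0.
have := z_eq; rewrite E => /(congr1 (@cmod R)); rewrite cmodM => zE.
have low : 2 / 125 * cmod (y 0) <= cmod ((pi / 2)%:C * y 0 + cint I d).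
  have := cmod_triang ((pi / 2)%:C * y 0) (- cint I d).
  rewrite cmodN opprK cmodM cmod_real ger0_norm ?divr_ge0 ?pi_ge0 //.
  exact: neumann_low_aux y00 pi2 pi13 dle.
have h1 : cmod z * (2 / 125 * cmod (y 0)) <= S * A.
  by apply: le_trans up; rewrite -zE ler_wpM2l ?cmod_ge0.
exact: neumann_z_aux y00 norm_v_ge0 h1.
Qed.

(** Variation of constants once more, now with the bound on z that is independent of n. *)
Lemma neumann_cos_close (b : R) : 0 <= b <= pi -> 0 < cmod (y 0) ->
  n%:R * cmod (y b - (cos (n%:R * b))%:C * y 0) <= 1200 * A * cmod (y 0).
Proof.
move=> bI y00; apply: le_trans (neumann_duhamel bI neumann_sup (neumann_z_bound y00)) _.
have /andP[b0 bp] := bI; apply: neumann_close_aux => //; first exact: norm_v_ge0.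
  exact: le_trans bp pi13.
by rewrite invf_le1 ?ler1n.
Qed.

End NeumannBounds.

(** * The reduced two by two system *)

Section Reduction.
Variable R : realType.
Local Notation mu := (@lebesgue_measure R).
Local Notation I := (@I0pi R).

Let mI : measurable (I : set (measurableTypeR R)).
Proof. exact: measurable_I0pi. Qed.

Variables (v : R -> R[i]) (n : nat) (z : R[i]) (C : R).

Definition alpha : R[i] := resolvent (fourier v) (weight n z) n%:Z n%:Z.

Hypotheses (Iv : cintegrable I v) (n0 : (0 < n)%N) (zn : cmod z < n%:R / 4).
Hypothesis VC : forall m, cmod (fourier v m) <= C.
Hypothesis Ce : C * (24 / Num.sqrt n%:R) <= 1 / 2.

Let We := weight_esum n0 zn.

Lemma alpha_sym : resolvent (fourier v) (weight n z) (- n%:Z) (- n%:Z) = alpha.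
Proof. by rewrite /alpha (resolvent_sym VC We Ce) ?opprK // => j; rewrite weightN. Qed.

Lemma beta_plusE : beta_plus v n z = resolvent (fourier v) (weight n z) (- n%:Z) n%:Z.
Proof. exact: beta_resolvent VC We Ce. Qed.

Lemma beta_minusE : beta_minus v n z = resolvent (fourier v) (weight n z) n%:Z (- n%:Z).
Proof. by rewrite /beta_minus (beta_resolvent _ VC We Ce) opprK. Qed.

Variables (f f1 f2 h : R -> R[i]) (H : R).
Hypotheses (hf : hill_data f f1 f2) (tf : twisted n f) (tf1 : twisted n f1).
Hypothesis hE : forall x, I x -> h x = f2 x + ((n ^ 2)%:R + z) * f x - v x * f x.
Hypothesis Ih : cintegrable I h.
Hypothesis DH : (\esum_(j in setT) (cmod (weight n z j * fourier h j))%:E <= H%:E)%E.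

Let c := coef n f.

Lemma fourier_system j : (2 %| j - n%:Z)%Z ->
  ((n ^ 2)%:R - (j ^+ 2)%:~R + z) * c j = conv (fourier v) c j + fourier h j.
Proof.
move=> dj; have [mf [K fK] _] := hill_data_regular hf; have [_ _ _ If2] := hf.
have If := cintegrable_bounded mf fK.
have Ivf : cintegrable I (fun x => v x * f x) by exact: cintegrableM Iv mf fK.
have Izf := cintegrableZ ((n ^ 2)%:R + z) mI If.
have -> : fourier h j = fourier f2 j + ((n ^ 2)%:R + z) * fourier f j - fourier (fun x => v x * f x) j.
  rewrite (@eq_fourier _ h _ j hE) fourierB //; last exact: cintegrableD.
  by rewrite fourierD // fourierZ.
rewrite (fourier_mul n0 hf tf tf1 Iv) /c; have [l jl] := frqP dj.
have -> : fourier f2 j = - (j ^+ 2)%:~R * fourier f j by rewrite jl; exact: fourier_deriv2 hf tf tf1.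
rewrite {1}/coef dj; move: (fourier f j) (conv _ _ _) => a b; ring.
Qed.

Let sc : csummable c. Proof. exact: coef_summable hf tf tf1. Qed.

Let nN : n%:Z != - n%:Z. Proof. by lia. Qed.

Let cE j : j != n%:Z -> j != - n%:Z ->
  c j = weight n z j * (conv (fourier v) c j + fourier h j).
Proof.
move=> j1 j2; rewrite /weight /beta_index j1 j2 !andbT.
case: ifPn => dj; last by rewrite mul0r /c /coef (negPf dj).
rewrite -fourier_system // mulKf //.
have bj : beta_index n j by apply/and3P.
have := gap_cmod n0 zn bj; have := gap_ge_n R n0 bj.
have nr : (0 : R) < n%:R by rewrite ltr0n.
move=> h1 h2; apply/eqP => e; move: h2; rewrite e cmod0; lra.
Qed.

Lemma reduction :
  [/\ cmod ((z - alpha) * c n%:Z - beta_plus v n z * c (- n%:Z) - fourier h n%:Z) <= C * (2 * H),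
      cmod ((z - alpha) * c (- n%:Z) - beta_minus v n z * c n%:Z - fourier h (- n%:Z)) <= C * (2 * H) &
      forall j, j != n%:Z -> j != - n%:Z ->
        cmod (c j - weight n z j * (resolvent (fourier v) (weight n z) n%:Z j * c n%:Z +
          resolvent (fourier v) (weight n z) (- n%:Z) j * c (- n%:Z))) <= 2 * H].
Proof.
have [L1 L2] := lyapunov_schmidt VC We Ce nN (weight_n n z) (weight_Nn n z) sc cE DH.
have S1 : z * c n%:Z = conv (fourier v) c n%:Z + fourier h n%:Z.
  rewrite -fourier_system; last by rewrite subrr.
  by congr (_ * _); rewrite rmorphXn /= natrX subrr add0r.
have S2 : z * c (- n%:Z) = conv (fourier v) c (- n%:Z) + fourier h (- n%:Z).
  rewrite -fourier_system; last by lia.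
  by congr (_ * _); rewrite sqrrN rmorphXn /= natrX subrr add0r.
split=> //.
- have := L1 n%:Z; rewrite -beta_plusE -/alpha.
  congr (cmod _ <= _).
  have -> : conv (fourier v) c n%:Z = z * c n%:Z - fourier h n%:Z by rewrite S1 addrK.
  move: (fourier h n%:Z) (c n%:Z) (c (- n%:Z)) alpha (beta_plus v n z) => *; ring.
- have := L1 (- n%:Z); rewrite -beta_minusE alpha_sym.
  congr (cmod _ <= _).
  have -> : conv (fourier v) c (- n%:Z) = z * c (- n%:Z) - fourier h (- n%:Z) by rewrite S2 addrK.
  move: (fourier h (- n%:Z)) (c n%:Z) (c (- n%:Z)) alpha (beta_minus v n z) => *; ring.
Qed.

End Reduction.

(* From the perturbed system p = zeta c+ - beta+ c-, q = zeta c- - beta- c+ with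
   p = - i n J / pi + O(J), q = i n J / pi + O(J) and c+, c- = y0 / 2 + O(y0 / n). *)
Lemma symmetry_aux (F : realType) (zeta bp bm cp cm y0 J kJ : F[i]) (N G X : F) :
  0 < N -> 0 <= G -> 0 <= X -> 16 * G <= N -> 4 * X <= N -> 0 < cmod y0 ->
  N / 4 * cmod J <= cmod kJ ->
  cmod (zeta * cp - bp * cm + kJ) <= 2 * (cmod J * G) ->
  cmod (zeta * cm - bm * cp - kJ) <= 2 * (cmod J * G) ->
  N * cmod (cp - y0 / 2) <= 2 * X * cmod y0 ->
  N * cmod (cm - y0 / 2) <= 2 * X * cmod y0 ->
  N * cmod (2 * zeta - bp - bm) <= (64 * G + 8 * X) * (cmod zeta + cmod bp + cmod bm).
Proof.
move=> N0 G0 X0 GN XN y00 kJ4 P Q CP CM.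
set p := zeta * cp - bp * cm in P *; set q := zeta * cm - bm * cp in Q *.
have J0 := cmod_ge0 J; have Z0 := cmod_ge0 zeta; have P0 := cmod_ge0 bp; have M0 := cmod_ge0 bm.
have pq : cmod (p + q) <= 4 * (cmod J * G).
  have -> : p + q = (p + kJ) + (q - kJ) by ring.
  by apply: le_trans (cmodD _ _) _; lra.
(* J must disappear from the conclusion. Since kJ dominates the error 2 |J| G, p itself measures J,
   and |p + q| becomes O(1/N) times |p|. *)
have lowp : N / 8 * cmod J <= cmod p.
  have := cmod_triang kJ (- p); rewrite cmodN opprK (addrC kJ) => h.
  have h2 : 16 * G * cmod J <= N * cmod J by rewrite ler_wpM2r.
  move: h P kJ4 h2; rewrite (mulrC (cmod J)); lra.
have h1 : N * cmod (p + q) <= 32 * G * cmod p.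
  apply: (@le_trans _ _ (32 * G * (N / 8 * cmod J))); last by apply: ler_wpM2l => //; lra.
  have := ler_wpM2l (ltW N0) pq; lra.
have small (c : F[i]) : N * cmod (c - y0 / 2) <= 2 * X * cmod y0 -> cmod c <= cmod y0.
  move=> h; have := cmod_triang c (y0 / 2).
  have -> : cmod (y0 / 2) = cmod y0 / 2.
    by rewrite cmodM cmodV -[2 : F[i]]/(2%:R) cmod_nat.
  have : N * cmod (c - y0 / 2) <= N * (cmod y0 / 2).
    by apply: le_trans h _; have := ler_wpM2r (ltW y00) XN; lra.
  by rewrite ler_pM2l //; lra.
have cpy := small _ CP; have cmy := small _ CM.
have ple : cmod p <= cmod y0 * (cmod zeta + cmod bp + cmod bm).
  apply: le_trans (cmodB _ _) _; rewrite !cmodM.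
  have := ler_wpM2l Z0 cpy; have := ler_wpM2l P0 cmy.
  have : 0 <= cmod bm * cmod y0 by rewrite mulr_ge0 // ltW.
  lra.
have E : (y0 / 2) * (2 * zeta - bp - bm) = (p + q) - (zeta * ((cp - y0 / 2) + (cm - y0 / 2)) -
    bp * (cm - y0 / 2) - bm * (cp - y0 / 2)) by rewrite /p /q; field.
have h2 : N * (cmod y0 / 2 * cmod (2 * zeta - bp - bm)) <=
    N * cmod (p + q) + (cmod zeta + cmod bp + cmod bm) * (4 * X * cmod y0).
  have -> : cmod y0 / 2 = cmod (y0 / 2) by rewrite cmodM cmodV -[2 : F[i]]/(2%:R) cmod_nat.
  rewrite -cmodM E.
  set u := cp - y0 / 2 in CP *; set w := cm - y0 / 2 in CM *.
  have t1 := cmodB (p + q) (zeta * (u + w) - bp * w - bm * u).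
  have t2 := cmodB (zeta * (u + w) - bp * w) (bm * u).
  have t3 := cmodB (zeta * (u + w)) (bp * w); have t4 := cmodD u w.
  move: t2 t3; rewrite !cmodM => t2 t3.
  have := ler_wpM2l Z0 t4; have := ler_wpM2l Z0 CP; have := ler_wpM2l Z0 CM.
  have := ler_wpM2l P0 CM; have := ler_wpM2l M0 CP.
  have XY : 0 <= X * cmod y0 by rewrite mulr_ge0 // ltW.
  have := mulr_ge0 P0 XY; have := mulr_ge0 M0 XY; have := ler_wpM2l (ltW N0) t1.
  have := ler_wpM2l (ltW N0) t2; have := ler_wpM2l (ltW N0) t3.
  move=> a1 a2 a3 a4 a5 a6 a7 a8 a9 a10.
  have := ler_wpM2l (ltW N0) a10.
  lra.
have h3 := ler_wpM2l (mulr_ge0 (ler0n _ 32) G0) ple.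
rewrite -(ler_pM2r y00).
lra.
Qed.

Lemma dvd2_oppB (n : nat) : (2 %| - n%:Z - n%:Z)%Z.
Proof. by lia. Qed.

Lemma posz_opp_neq (n : nat) : (0 < n)%N ->
  (n%:Z == - n%:Z) = false /\ (- n%:Z == n%:Z) = false.
Proof. by move=> n0; split; apply/eqP; lia. Qed.

(** * The Neumann eigenvalue and the sum of beta^+ and beta^- *)

Section NeumannSymmetry.
Variable R : realType.
Local Notation mu := (@lebesgue_measure R).
Local Notation I := (@I0pi R).

Let mI : measurable (I : set (measurableTypeR R)).
Proof. exact: measurable_I0pi. Qed.

Lemma fourier_trig n (a b : R[i]) (j : int) : (0 < n)%N -> (2 %| j - n%:Z)%Z ->
  fourier (fun x : R => a * expi (n%:R * x) + b * expi (- (n%:R * x))) j =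
  a * (j == n%:Z)%:R + b * (j == - n%:Z)%:R.
Proof.
move=> n0 /frqP[m ->].
have E0 x : expi (n%:R * x) = expi ((frq n 0)%:~R * x) :> R[i].
  by rewrite /frq mulr0 addr0.
have E1 x : expi (- (n%:R * x)) = expi ((frq n (- n%:Z))%:~R * x) :> R[i].
  by rewrite -mulNr; congr (expi (_ * _)); rewrite (_ : frq n (- n%:Z) = - n%:Z) ?intrN // /frq; lia.
have Ie l : cintegrable I (fun x : R => expi ((frq n l)%:~R * x)).
  exact: (cintegrable_bounded (expi_lin_cmeasurable _) (cbounded_expi _)).
rewrite (@eq_fourier _ _ (fun x => a * expi ((frq n 0)%:~R * x) + b * expi ((frq n (- n%:Z))%:~R * x))).
  rewrite fourierD; [|exact: cintegrableZ|exact: cintegrableZ].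
  rewrite !fourierZ // !fourier_expi.
  congr (_ * _%:R + _ * _%:R); apply/eqP/eqP; rewrite /frq; lia.
by move=> x _; rewrite E0 E1.
Qed.

Lemma real_hill_data (r r1 r2 : R -> R) : (forall x, I x -> rderiv r x (r1 x)) ->
  (forall x, I x -> rderiv r1 x (r2 x)) -> icontinuous r2 ->
  hill_data (fun x => (r x)%:C) (fun x => (r1 x)%:C) (fun x => (r2 x)%:C).
Proof.
move=> d1 d2 c2; have [K K0 r2K] := icontinuous_bounded c2.
have z0 x : rderiv (fun=> (0 : R)) x 0 by apply: is_derive_rderiv; exact: is_derive_cst.
split.
- by move=> x Ix; split; [exact: d1|exact: z0].
- have acr1 := lipschitz_rabs_continuous K0 (rderiv_lipschitz d2 r2K).
  move=> e e0; have [d d0 hd] := acr1 e e0; exists d => // m a b ab tab sd.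
  apply: le_lt_trans (hd m a b ab tab sd); apply: ler_sum => i _.
  by rewrite -rmorphB cmod_real.
- by apply: aeW => x Ix; split; [exact: d2|exact: z0].
- split; first exact: icontinuous_integrable.
  exact (cintegrable_cst (0 : R[i])).1.
Qed.

(* The non-twisted part of a Neumann eigenfunction is absorbed by a multiple of
   this function, which has the same jump. *)
Definition jump_corrector n (x : R) : R := pi^-1 * (x * cos (n%:R * x + 0)).

Lemma jump_corrector_hill_data n :
  hill_data (fun x => (jump_corrector n x)%:C)
    (fun x => (pi^-1 * (1 * cos (n%:R * x + 0) + x * (- sin (n%:R * x + 0) * n%:R)))%:C)
    (fun x => (- (2 * n%:R / pi) * sin (n%:R * x + 0) - n%:R ^+ 2 * jump_corrector n x)%:C).
Proof.
have idd (x : R) : rderiv (fun t : R => t) x 1 by apply: is_derive_rderiv; exact: is_derive_id.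
have idc : icontinuous (fun t : R => t) by apply: continuous_icontinuous => x; exact: cvg_id.
have cstc (K : R) : icontinuous (fun=> K).
  by apply: continuous_icontinuous => x; exact: cvg_cst.
have cc := @cos_affine_continuous R n%:R 0; have ss := @sin_affine_continuous R n%:R 0.
have dc x : rderiv (fun t : R => cos (n%:R * t + 0)) x (- sin (n%:R * x + 0) * n%:R).
  exact/is_derive_rderiv/is_derive_cos_affine.
have ds x : rderiv (fun t : R => sin (n%:R * t + 0)) x (cos (n%:R * x + 0) * n%:R).
  exact/is_derive_rderiv/is_derive_sin_affine.
have ds' x : rderiv (fun t : R => - sin (n%:R * t + 0) * n%:R) x (- n%:R * (cos (n%:R * x + 0) * n%:R)).
  have := @rderivZ R _ _ (- n%:R) _ (ds x); congr (rderiv _ _ _).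
  by apply/funext => t; rewrite mulNr mulNr mulrC.
have cs' : icontinuous (fun t : R => - sin (n%:R * t + 0) * n%:R).
  exact: rderiv_continuous (fun x _ => ds' x).
apply: real_hill_data.
- move=> x Ix; apply: rderivZ; exact: (rderivM cc Ix (idd x) (dc x)).
- move=> x Ix.
  have := @rderivZ R _ _ pi^-1 _ (rderivD (@rderivZ R _ _ 1 _ (dc x)) (rderivM cs' Ix (idd x) (ds' x))).
  by congr (rderiv _ _ _); rewrite /jump_corrector; ring.
- apply: icontinuousD; first exact: icontinuousM.
  have := icontinuousM (cstc (- n%:R ^+ 2)) (icontinuousM (cstc pi^-1) (icontinuousM idc cc)).
  by congr icontinuous; apply/funext => x; rewrite mulNr.
Qed.

Lemma jump_corrector_le n x : I x -> `|jump_corrector n x| <= 1.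
Proof.
move=> /I0piP/andP[x0 xpi]; rewrite /jump_corrector mulrA normrM.
apply: mulr_ile1 => //; last exact: cos_max.
by rewrite ger0_norm ?mulr_ge0 ?invr_ge0 ?pi_ge0 // mulrC ler_pdivrMr ?pi_gt0 // mul1r.
Qed.

Variables (v : R -> R[i]) (n : nat) (z : R[i]) (y y1 : R -> R[i]).
Local Notation A := (Rintegral mu I (fun x => cmod (v x))).
Hypotheses (Iv : cintegrable I v) (n0 : (0 < n)%N) (zn : cmod z < n%:R / 4).
Hypothesis hy : hill_data y y1 (fun x => v x * y x - ((n ^ 2)%:R + z) * y x).
Hypotheses (y10 : y1 0 = 0) (y1pi : y1 pi = 0).
Hypothesis nontrivial : exists2 x, I x & y x != 0.
Hypothesis nA : 5000 * (A + 1) <= n%:R.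
Hypothesis Ce : A * (24 / Num.sqrt n%:R) <= 1 / 2.

Let A0 : 0 <= A. Proof. exact: norm_v_ge0. Qed.
Let nr : (0 : R) < n%:R. Proof. by rewrite ltr0n. Qed.
Let nA' : 400 * (A + 1) <= n%:R.
Proof. by apply: le_trans nA; rewrite ler_wpM2r //; have := A0; lra. Qed.
Let y00 : 0 < cmod (y 0).
Proof. exact: neumann_value0 Iv n0 hy y10 (ltW zn) nA' nontrivial. Qed.

Lemma fourier_v_le m : cmod (fourier v m) <= A.
Proof.
apply: le_trans (fourier_le m Iv) _; rewrite ler_piMl // invf_le1 ?pi_gt0 //.
by apply: le_trans (pi_ge2 R); rewrite ler1n.
Qed.

Let s : R[i] := ((-1) ^+ n : R)%:C.
(** The amount by which y fails to be twisted. As [rho] takes the values 0 and s at the end points,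
    subtracting J [rho] repairs this; it also respects the condition on the derivative. *)
Let J := s * y pi - y 0.
Let ssK : s * s = 1. Proof. by rewrite -rmorphM -exprD addnn -mul2n exprM sqrrN !expr1n. Qed.
Let sE : (-1) ^+ n = s. Proof. by rewrite /s rmorphXn rmorphN1. Qed.
Let rho x : R[i] := (jump_corrector n x)%:C.

Let close (b : R) : 0 <= b <= pi -> n%:R * cmod (y b - (cos (n%:R * b))%:C * y 0) <= 1200 * A * cmod (y 0).
Proof. by move=> bI; exact: (neumann_cos_close Iv n0 hy y10 y1pi (ltW zn) nA' bI y00). Qed.

Let JX : n%:R * cmod J <= 1200 * A * cmod (y 0).
Proof.
have pI : (0 : R) <= pi <= (pi : R) by apply/andP; split; [exact: pi_ge0|exact: lexx].
have := close pI; rewrite (cos_nat_pi _ _).1 -/s.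
have -> : y pi - s * y 0 = s * J by rewrite /J mulrBr mulrA ssK mul1r.
by rewrite cmodM /s cmod_real normrX normrN1 expr1n mul1r.
Qed.

Let eta x := y x + - J * rho x.
Let eta1 x := y1 x + - J * (pi^-1 * (1 * cos (n%:R * x + 0) + x * (- sin (n%:R * x + 0) * n%:R)))%:C.

Let rho0 : rho 0 = 0. Proof. by rewrite /rho /jump_corrector mul0r mulr0. Qed.
Let rhopi : rho pi = s.
Proof. by rewrite /rho /jump_corrector addr0 (cos_nat_pi _ _).1 mulrA mulVf ?mul1r // gt_eqF ?pi_gt0. Qed.

Let teta : twisted n eta.
Proof. by rewrite /twisted /eta rho0 rhopi sE mulr0 addr0 /J mulNr mulrBl mulrAC ssK; ring. Qed.
Let teta1 : twisted n eta1.
Proof.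
have [e1 e2] := @cos_nat_pi R n.
rewrite /twisted /eta1 y10 y1pi sE !addr0 e1 e2 mulr0 sin0 cos0 !(oppr0, mul0r, mulr0, addr0, add0r, mulr1, mul1r).
by rewrite rmorphM /= -/s (mulrC _ s) mulrCA.
Qed.

(** The corrector produces the source (2n / pi) sin nx, whose coefficients at n and - n are [a] and
    [- a]. Being opposite, these large terms cancel when the two reduced equations are added. *)
Let a : R[i] := 0 +i* - (n%:R / pi).
Let g x := (v x - z) * rho x.
Let sn x := a * expi (n%:R * x) + - a * expi (- (n%:R * x)).
Let h x := J * sn x + J * g x.

Let snE x : sn x = (2 * n%:R / pi * sin (n%:R * x))%:C.
Proof.
rewrite /sn /expi cosN sinN; apply: complex_eq.
  rewrite cReD !cReM cReN cImN /=; ring.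
rewrite cImD !cImM cReN cImN /=; ring.
Qed.

Let eta_data := hill_data_lin (- J) hy (jump_corrector_hill_data n).

Let hE x : I x -> h x = (v x * y x - ((n ^ 2)%:R + z) * y x +
   - J * (- (2 * n%:R / pi) * sin (n%:R * x + 0) - n%:R ^+ 2 * jump_corrector n x)%:C) +
   ((n ^ 2)%:R + z) * eta x - v x * eta x.
Proof.
move=> _; rewrite /h snE /eta /g /rho addr0.
have -> : (n ^ 2)%:R = (n%:R ^+ 2)%:C :> R[i] by rewrite natrX rmorphXn /= -natrC.
rewrite rmorphB /= !rmorphM /= rmorphN /= rmorphM /=; ring.
Qed.

Let mrho : cmeasurable rho. Proof. by have [] := hill_data_regular (jump_corrector_hill_data n). Qed.
Let brho : cbounded rho 1.
Proof. by move=> x Ix; rewrite cmod_real jump_corrector_le. Qed.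
Let Ig : cintegrable I g.
Proof. by apply: cintegrableM mrho brho; apply: cintegrableB => //; exact: cintegrable_cst. Qed.
Let Isn : cintegrable I sn.
Proof.
apply: cintegrableD => //; apply: cintegrableZ => //.
  exact: (cintegrable_bounded (expi_lin_cmeasurable _) (cbounded_expi _)).
exact: (cintegrable_bounded (expiN_lin_cmeasurable _) (cbounded_expi _)).
Qed.
Let Ih : cintegrable I h. Proof. by apply: cintegrableD => //; exact: cintegrableZ. Qed.

Let zA : cmod z <= 150 * A.
Proof. exact: (neumann_z_bound Iv n0 hy y10 y1pi (ltW zn) nA' y00). Qed.

(** A comes from [v rho] and 150 A from [z rho]. *)
Let gG j : cmod (fourier g j) <= 151 * A.
Proof.
have -> : fourier g j = fourier (fun x => v x * rho x) j - z * fourier rho j.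
  have Irho : cintegrable I rho by exact: cintegrable_bounded mrho brho.
  rewrite -fourierZ // -fourierB //; [|exact: cintegrableM Iv mrho brho|exact: cintegrableZ].
  by apply: eq_fourier => x _; rewrite /g mulrBl.
apply: le_trans (cmodB _ _) _; rewrite cmodM.
have b1 : cmod (fourier rho j) <= 1 by exact: fourier_le_bound.
have b2 : cmod z * cmod (fourier rho j) <= cmod z by rewrite ler_piMr ?cmod_ge0.
have b3 : cmod (fourier (fun x => v x * rho x) j) <= A.
  have p1 : pi^-1 <= 1 :> R.
    by rewrite invf_le1 ?pi_gt0 //; apply: le_trans (pi_ge2 R); rewrite ler1n.
  have rb x : 0 < x < pi -> cmod (rho x) <= 1.
    by move=> /andP[x0 xpi]; apply: brho; apply/I0piP; rewrite !ltW.
  have hl := fourier_mul_le j Iv (cintegrableM Iv mrho brho) ler01 rb.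
  by apply: le_trans hl _; rewrite mulr1 ler_piMl.
have := zA; lra.
Qed.

Let fh j : (2 %| j - n%:Z)%Z -> fourier h j =
  J * (a * (j == n%:Z)%:R + - a * (j == - n%:Z)%:R) + J * fourier g j.
Proof.
move=> dj; rewrite -(fourier_trig a (- a) n0 dj) /h fourierD; [|exact: cintegrableZ..].
by rewrite (fourierZ J j Isn) (fourierZ J j Ig).
Qed.

Let JG0 : 0 <= cmod J * (151 * A).
Proof. by rewrite mulr_ge0 ?cmod_ge0 // mulr_ge0. Qed.

(** The part of the source that is of size n sits at the frequencies n and - n, where the weight
    vanishes; only the bounded part J g is seen here. *)
Let DH : (\esum_(j in setT) (cmod (weight n z j * fourier h j))%:E <=
   (cmod J * (151 * A) * (24 / Num.sqrt n%:R))%:E)%E.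
Proof.
have W := weight_esum n0 zn.
apply: (@le_trans _ _ (\esum_(j in setT) (cmod J * (151 * A) * cmod (weight n z j))%:E)%E).
  apply: le_esum => j _; rewrite lee_fin cmodM mulrC.
  have [dj|dj] := boolP (beta_index n j); last first.
    by rewrite /weight (negPf dj) cmod0 !mulr0.
  apply: ler_wpM2r; first exact: cmod_ge0.
  have /and3P[d1 /negPf d2 /negPf d3] := dj.
  rewrite (fh d1) d2 d3 !mulr0 addr0 mulr0 add0r cmodM.
  by apply: ler_wpM2l; [exact: cmod_ge0|exact: gG].
rewrite esumZl //; [|by move=> j; exact: cmod_ge0|by apply: le_lt_trans W _; rewrite ltry].
by rewrite [leRHS]EFinM lee_wpmul2l // lee_fin.
Qed.

Local Notation zeta := (z - alpha v n z).

Let X0 : 0 <= 1200 * A. Proof. exact (mulr_ge0 (ler0n R 1200) A0). Qed.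
Let G0 : 0 <= 151 * A. Proof. exact (mulr_ge0 (ler0n R 151) A0). Qed.

(** cos nx has coefficient 1/2 at both frequencies; the distance of y from y(0) cos nx and the
    correction J [rho] each contribute at most 1200 A |y(0)| / n. *)
Let cst (j : int) : (2 %| j - n%:Z)%Z -> (j == n%:Z) || (j == - n%:Z) ->
  n%:R * cmod (coef n eta j - y 0 / 2) <= 2 * (1200 * A) * cmod (y 0).
Proof.
move=> dj jn; have cl := close; have jx := JX; have x0 := X0.
move: (1200 * A) cl jx x0 => X cl jx x0.
have nX : 0 <= X * cmod (y 0) by exact: mulr_ge0 x0 (cmod_ge0 _).
have [my [K yK] _] := hill_data_regular hy.
pose cs x : R[i] := 1 / 2 * expi (n%:R * x) + 1 / 2 * expi (- (n%:R * x)).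
have csE x : cs x = (cos (n%:R * x))%:C.
  rewrite /cs -mulrDr; apply: (mulfI (x := 2)); first by rewrite pnatr_eq0.
  have tw (w : R[i]) : 2 * (1 / 2 * w) = w by field.
  rewrite tw mulr_natl mulr2n.
  by apply: complex_eq; rewrite /expi cosN sinN /=; ring.
have mcs : cmeasurable cs.
  by apply: cmeasurableD; apply: cmeasurableM; (try exact: cmeasurable_cst);
    [exact: expi_lin_cmeasurable|exact: expiN_lin_cmeasurable].
have bcs : cbounded cs 1 by move=> x _; rewrite csE cmod_real cos_max.
have Ics := cintegrable_bounded mcs bcs.
have Irho := cintegrable_bounded mrho brho.
have Iy := cintegrable_bounded my yK.
pose d x := y x - y 0 * cs x.
have md : cmeasurable d.
  by apply: cmeasurableB => //; apply: cmeasurableM => //; exact: cmeasurable_cst.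
have bd : cbounded d (X * cmod (y 0) / n%:R).
  move=> x Ix; rewrite ler_pdivlMr // mulrC /d csE mulrC.
  by have := cl x ((I0piP x).1 Ix); rewrite (mulrC (_%:C)) (mulrC n%:R).
have Id := cintegrable_bounded md bd.
have E : coef n eta j - y 0 / 2 = fourier d j - J * fourier rho j.
  rewrite /coef dj (@eq_fourier _ eta (fun x => (d x + y 0 * cs x) + - J * rho x)); last first.
    by move=> x _; rewrite /eta /d subrK.
  rewrite fourierD; [|by apply: cintegrableD => //; exact: cintegrableZ|exact: cintegrableZ].
  rewrite fourierD //; last exact: cintegrableZ.
  rewrite (fourierZ _ _ Ics) (fourierZ _ _ Irho) (fourier_trig _ _ n0 dj) -mulrDr -natrD.
  have -> : ((j == n%:Z) + (j == - n%:Z))%N = 1%N.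
    by have [h1 h2] := posz_opp_neq n0; case/orP: jn => /eqP ->; rewrite eqxx ?h1 ?h2.
  by move: (fourier d j) (fourier rho j) => t1 t2; field.
rewrite E; have b1 : cmod (fourier d j) <= X * cmod (y 0) / n%:R by exact: fourier_le_bound.
have b2 : cmod (fourier rho j) <= 1 by exact: fourier_le_bound.
have b3 : cmod (J * fourier rho j) <= cmod J by rewrite cmodM ler_piMr ?cmod_ge0.
move: b1; rewrite ler_pdivlMr // => b1.
have := ler_wpM2l (ltW nr) (cmodB (fourier d j) (J * fourier rho j)).
have := ler_wpM2l (ltW nr) b3.
move: b1 jx; rewrite (mulrC _ n%:R); lra.
Qed.

Lemma neumann_symmetry :
  n%:R * cmod (2 * zeta - beta_plus v n z - beta_minus v n z) <=
  (64 * (151 * A) + 8 * (1200 * A)) * (cmod zeta + cmod (beta_plus v n z) + cmod (beta_minus v n z)).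
Proof.
have [r1 r2 _] := reduction Iv n0 zn fourier_v_le Ce eta_data teta teta1 hE DH.
rewrite fh in r1; last by rewrite subrr.
rewrite (fh (dvd2_oppB n)) in r2.
have [nN nN'] := posz_opp_neq n0.
rewrite eqxx nN in r1; rewrite eqxx nN' in r2.
have small : A * (2 * (cmod J * (151 * A) * (24 / Num.sqrt n%:R))) <= cmod J * (151 * A).
  have := ler_wpM2l JG0 Ce; move: (24 / Num.sqrt n%:R) => w; lra.
have pi0 := pi_gt0 R; have pi4 : pi <= 4 :> R by have := pi_lt R; lra.
have kJ4 : n%:R / 4 * cmod J <= cmod (- (J * a)).
  rewrite cmodN cmodM mulrC; apply: ler_wpM2l; first exact: cmod_ge0.
  rewrite /a cmodE /= expr0n add0r sqrrN sqrtr_sqr ger0_norm; last by rewrite divr_ge0 // ltW.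
  by apply: ler_wpM2l; [exact: ltW|rewrite lef_pV2 ?posrE].
have A0' := A0; have nA0 := nA.
(* The factor 5000 covers both 16 * 151 = 2416 and 4 * 1200 = 4800. *)
have GN : 16 * (151 * A) <= n%:R by move: (Rintegral _ _ _) A0' nA0 => t; lra.
have XN : 4 * (1200 * A) <= n%:R by move: (Rintegral _ _ _) A0' nA0 => t; lra.
have P : cmod (zeta * coef n eta n%:Z - beta_plus v n z * coef n eta (- n%:Z) + - (J * a)) <=
    2 * (cmod J * (151 * A)).
  move: r1; set u := _ - beta_plus v n z * _; set w := fourier g _.
  move=> r1; have := cmod_triang (u + - (J * a)) (J * w).
  have -> : u + - (J * a) - J * w = u - (J * (a * 1%:R + - a * 0%:R) + J * w) by ring.
  rewrite cmodM; have := ler_wpM2l (cmod_ge0 J) (gG n%:Z); move: (cmod J * cmod _) => t.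
  by move: r1 small; move: (A * _) (cmod _) => t1 t2; lra.
have Q : cmod (zeta * coef n eta (- n%:Z) - beta_minus v n z * coef n eta n%:Z - - (J * a)) <=
    2 * (cmod J * (151 * A)).
  move: r2; set u := _ - beta_minus v n z * _; set w := fourier g _.
  move=> r2; have := cmod_triang (u - - (J * a)) (J * w).
  have -> : u - - (J * a) - J * w = u - (J * (a * 0%:R + - a * 1%:R) + J * w) by ring.
  rewrite cmodM; have := ler_wpM2l (cmod_ge0 J) (gG (- n%:Z)); move: (cmod J * cmod _) => t.
  by move: r2 small; move: (A * _) (cmod _) => t1 t2; lra.
have dn : (2 %| n%:Z - n%:Z)%Z by rewrite subrr.
have en : (n%:Z == n%:Z) || (n%:Z == - n%:Z) by rewrite eqxx.
have eN : (- n%:Z == n%:Z) || (- n%:Z == - n%:Z) by rewrite eqxx orbT.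
have c1 := cst dn en; have c2 := cst (dvd2_oppB n) eN.
exact: (symmetry_aux nr G0 X0 GN XN y00 kJ4 P Q c1 c2).
Qed.

End NeumannSymmetry.

(** * Root functions *)

Section RootFunctions.
Variable R : realType.
Local Notation mu := (@lebesgue_measure R).
Local Notation I := (@I0pi R).

Let mI : measurable (I : set (measurableTypeR R)).
Proof. exact: measurable_I0pi. Qed.

Implicit Types (f g : R -> R[i]).

(* A double eigenvalue with a Jordan block: A u = 0 and A w = - u + E for the
   reduced matrix A; as det A = 0, A^2 = 2 zeta A, so 2 zeta (u - E) = - A E. *)
Lemma jordan_aux (F : realType) (zeta bp bm up um wp wm ep em : F[i]) (t : F) :
  zeta * up = bp * um -> zeta * um = bm * up -> 0 < cmod up + cmod um ->
  zeta * wp - bp * wm = - up + ep -> zeta * wm - bm * wp = - um + em ->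
  cmod ep <= t * (cmod up + cmod um) -> cmod em <= t * (cmod up + cmod um) -> t <= 1 / 6 ->
  cmod zeta <= t * (cmod bp + cmod bm).
Proof.
move=> U1 U2 u0 W1 W2 E1 E2 t6.
have det : zeta ^+ 2 = bp * bm.
  have d1 : (zeta ^+ 2 - bp * bm) * up = 0.
    by rewrite mulrBl expr2 -mulrA U1 mulrCA U2; ring.
  have d2 : (zeta ^+ 2 - bp * bm) * um = 0.
    by rewrite mulrBl expr2 -mulrA U2 mulrCA U1; ring.
  apply/eqP; rewrite -subr_eq0; apply/negPn/negP => h.
  move: d1 d2 => /eqP; rewrite mulf_eq0 (negPf h) /= => /eqP u1 /eqP.
  by rewrite mulf_eq0 (negPf h) /= => /eqP u2; move: u0; rewrite u1 u2 cmod0 addr0 ltxx.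
have K1 : 2 * zeta * up = 2 * zeta * ep - zeta * ep + bp * em.
  have h1 : 2 * zeta * (zeta * wp - bp * wm) = zeta * (zeta * wp - bp * wm) - bp * (zeta * wm - bm * wp)
     + (zeta ^+ 2 - bp * bm) * wp by ring.
  move: h1; rewrite W1 W2 det subrr mul0r addr0 !mulrDr => h1.
  have -> : 2 * zeta * up = 2 * zeta * ep - (2 * zeta * - up + 2 * zeta * ep) by ring.
  by rewrite h1 !mulrN U1; ring.
have K2 : 2 * zeta * um = 2 * zeta * em - zeta * em + bm * ep.
  have h1 : 2 * zeta * (zeta * wm - bm * wp) = zeta * (zeta * wm - bm * wp) - bm * (zeta * wp - bp * wm)
     + (zeta ^+ 2 - bp * bm) * wm by ring.
  move: h1; rewrite W1 W2 det subrr mul0r addr0 !mulrDr => h1.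
  have -> : 2 * zeta * um = 2 * zeta * em - (2 * zeta * - um + 2 * zeta * em) by ring.
  by rewrite h1 !mulrN U2; ring.
have L1 : 2 * (cmod zeta * cmod up) <= cmod zeta * cmod ep + cmod bp * cmod em.
  have <- : cmod (2 * zeta * up) = 2 * (cmod zeta * cmod up) by rewrite !cmodM -[2 : F[i]]/(2%:R) cmod_nat mulrA.
  have -> : 2 * zeta * up = zeta * ep + bp * em by rewrite K1; ring.
  by rewrite -!cmodM; exact: cmodD.
have L2 : 2 * (cmod zeta * cmod um) <= cmod zeta * cmod em + cmod bm * cmod ep.
  have <- : cmod (2 * zeta * um) = 2 * (cmod zeta * cmod um) by rewrite !cmodM -[2 : F[i]]/(2%:R) cmod_nat mulrA.
  have -> : 2 * zeta * um = zeta * em + bm * ep by rewrite K2; ring.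
  by rewrite -!cmodM; exact: cmodD.
have Z0 := cmod_ge0 zeta; have P0 := cmod_ge0 bp; have M0 := cmod_ge0 bm.
have := ler_wpM2l Z0 E1; have := ler_wpM2l Z0 E2; have := ler_wpM2l P0 E2; have := ler_wpM2l M0 E1.
move: L1 L2; move: (cmod zeta) (cmod bp) (cmod bm) Z0 P0 M0 => Z P M Z0 P0 M0.
move: (cmod up) (cmod um) (cmod ep) (cmod em) u0 E1 E2 => a b e1 e2 u0 E1 E2.
move=> L1 L2 h1 h2 h3 h4; rewrite -(ler_pM2r u0).
have zu : 0 <= Z * (a + b) by rewrite mulr_ge0 // ltW.
have := ler_wpM2r zu t6.
lra.
Qed.

Definition eigenfunction (v : R -> R[i]) n lam f : Prop :=
  exists f1, [/\ hill_data f f1 (fun x => v x * f x - lam * f x), twisted n f & twisted n f1].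

Definition jordan_pair (v : R -> R[i]) n lam f g : Prop :=
  [/\ exists f1, [/\ hill_data f f1 (fun x => v x * f x - lam * f x - g x), twisted n f & twisted n f1],
      eigenfunction v n lam g & exists2 x, I x & g x != 0].

Lemma per_bc_twisted n f f1 : satisfies_bc (per_bc n) f f1 -> twisted n f /\ twisted n f1.
Proof.
rewrite /per_bc /twisted -signr_odd; case: (odd n) => -[h1 h2].
  by rewrite expr1 h1 h2 mulrNN mulrNN !mul1r.
by rewrite expr0 h1 h2 !mul1r.
Qed.

Variables (v : R -> R[i]) (Iv : cintegrable I v).

Lemma zero_or_not f : (forall x, I x -> f x = 0) \/ (exists2 x, I x & f x != 0).
Proof.
have [h|h] := pselect (exists2 x, I x & f x != 0); [by right|left => x Ix].
by apply/eqP/negPn/negP => fx; apply: h; exists x.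
Qed.

(** Going down the chain f, (L - lam) f, and so on, the last two nonzero members form a Jordan pair,
    unless f is zero or an eigenfunction. Blocks of higher order thus need no separate treatment. *)
Lemma root_function_cases n lam k f : in_ker_pow v (per_bc n) lam k f ->
  [\/ forall x, I x -> f x = 0, eigenfunction v n lam f | exists p q, jordan_pair v n lam p q].
Proof.
elim: k f => [|k IH] f /=; first by move=> h; exact: Or31.
move=> [g [hg hk]]; have [f1 [df /per_bc_twisted[tf tf1] _]] := hill_op_data Iv hg.
have base : (forall x, I x -> g x - lam * f x = 0) -> eigenfunction v n lam f.
  move=> h; exists f1; split => //; apply: hill_data_eq df => x Ix.
  by congr (_ - _); apply/eqP; rewrite -subr_eq0; apply/eqP; exact: h.
have [h|h|h] := IH _ hk; last exact: Or33.
  by apply: Or32; exact: base.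
have [h0|h0] := zero_or_not (fun x => g x - lam * f x); first by apply: Or32; exact: base.
apply: Or33; exists f, (fun x => g x - lam * f x); split=> //.
exists f1; split=> //; apply: hill_data_eq df => x Ix; ring.
Qed.

Lemma eigenfunction_lin n lam f g (k : R[i]) : eigenfunction v n lam f -> eigenfunction v n lam g ->
  eigenfunction v n lam (fun x => f x + k * g x).
Proof.
move=> [f1 [df tf tf1]] [g1 [dg tg tg1]]; exists (fun x => f1 x + k * g1 x); split.
- by apply: hill_data_eq (hill_data_lin k df dg) => x _; ring.
- by rewrite /twisted tf tg; ring.
- by rewrite /twisted tf1 tg1; ring.
Qed.

Lemma eigenfunction_integrable n lam f : eigenfunction v n lam f -> cintegrable I f.
Proof.
by move=> [f1 [df _ _]]; have [mf [K fK] _] := hill_data_regular df; exact: cintegrable_bounded mf fK.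
Qed.

Lemma coef_lin n f g (k : R[i]) j : cintegrable I f -> cintegrable I g ->
  coef n (fun x => f x + k * g x) j = coef n f j + k * coef n g j.
Proof.
move=> If Ig; rewrite /coef; case: ifP => _; last by rewrite mulr0 addr0.
by rewrite fourierD ?fourierZ //; exact: cintegrableZ.
Qed.

Lemma fourier0 (m : int) : fourier (fun=> (0 : R[i])) m = 0.
Proof.
apply: cmod_eq0; apply/eqP; rewrite eq_le cmod_ge0 andbT.
by apply: fourier_le_bound; [exact: cmeasurable_cst|move=> x _; rewrite cmod0].
Qed.

Variables (n : nat) (z : R[i]) (C : R).
Hypotheses (n0 : (0 < n)%N) (zn : cmod z < n%:R / 4).
Hypothesis VC : forall m, cmod (fourier v m) <= C.
Hypothesis Ce : C * (24 / Num.sqrt n%:R) <= 1 / 2.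

Local Notation lam := ((n ^ 2)%:R + z).
Local Notation zeta := (z - alpha v n z).
Local Notation bp := (beta_plus v n z).
Local Notation bm := (beta_minus v n z).
Local Notation W := (weight n z).

Let C0 : 0 <= C. Proof. exact: le_trans (cmod_ge0 _) (VC 0). Qed.

(** Without source the reduction is exact. The third clause prepares Jordan pairs, where f becomes a
    source and its weighted coefficients must have small l^1 norm; 4 C is 2 C times the bound 2 of
    one weight. *)
Lemma eigen_coef f : eigenfunction v n lam f ->
  [/\ zeta * coef n f n%:Z = bp * coef n f (- n%:Z),
      zeta * coef n f (- n%:Z) = bm * coef n f n%:Z,
      forall j, cmod (W j * coef n f j) <=
        4 * C * (cmod (coef n f n%:Z) + cmod (coef n f (- n%:Z))) * cmod (W j) &
      coef n f n%:Z = 0 -> coef n f (- n%:Z) = 0 -> forall x, I x -> f x = 0].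
Proof.
move=> [f1 [df tf tf1]].
have hE x : I x -> 0 = (v x * f x - lam * f x) + lam * f x - v x * f x by move=> _; ring.
have DH : (\esum_(j in setT) (cmod (W j * fourier (fun=> 0) j))%:E <= (0 : R)%:E)%E.
  under eq_esum do rewrite fourier0 mulr0 cmod0.
  by rewrite esum1.
have [r1 r2 r3] := reduction Iv n0 zn VC Ce df tf tf1 hE DH.
have z0 (w : R[i]) : cmod w <= 0 -> w = 0.
  by move=> w0; apply: cmod_eq0; apply/eqP; rewrite eq_le w0 cmod_ge0.
set cp := coef n f n%:Z in r1 r2 r3 *; set cm := coef n f (- n%:Z) in r1 r2 r3 *.
have {}r3 j : j != n%:Z -> j != - n%:Z -> coef n f j = W j *
    (resolvent (fourier v) W n%:Z j * cp + resolvent (fourier v) W (- n%:Z) j * cm).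
  by move=> j1 j2; apply/eqP; rewrite -subr_eq0; apply/eqP/z0; rewrite -[X in _ <= X](mulr0 2); exact: r3.
split.
- by apply/eqP; rewrite -subr_eq0; apply/eqP/z0; move: r1; rewrite fourier0 subr0 !mulr0.
- by apply/eqP; rewrite -subr_eq0; apply/eqP/z0; move: r2; rewrite fourier0 subr0 !mulr0.
- have We := weight_esum n0 zn => j.
  have RB b : cmod (resolvent (fourier v) W b j) <= 2 * C by exact (resolvent_bound VC We Ce _ _).
  have [->|j1] := eqVneq j n%:Z; first by rewrite weight_n mul0r cmod0 mulr0.
  have [->|j2] := eqVneq j (- n%:Z); first by rewrite weight_Nn mul0r cmod0 mulr0.
  have w2 : cmod (W j) <= 2.
    by have := weight_le j n0 zn; have := gapinv_le1 R j n0; lra.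
  have hc : cmod (coef n f j) <= 2 * (2 * C * (cmod cp + cmod cm)).
    rewrite r3 // cmodM; apply: ler_pM => //; try exact: cmod_ge0.
    apply: le_trans (cmodD _ _) _; rewrite mulrDr !cmodM.
    by apply: lerD; apply: ler_wpM2r; rewrite ?cmod_ge0.
  rewrite cmodM mulrC; apply: ler_wpM2r; first exact: cmod_ge0.
  by apply: le_trans hc _; lra.
- move=> cp0 cm0; apply: (expansion_zero (n := n) df) => j.
  have [->|j1] := eqVneq j n%:Z; first exact: cp0.
  have [->|j2] := eqVneq j (- n%:Z); first exact: cm0.
  by rewrite r3 // cp0 cm0 !mulr0 addr0 mulr0.
Qed.

Lemma eigen_det f : eigenfunction v n lam f -> (exists2 x, I x & f x != 0) -> zeta ^+ 2 = bp * bm.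
Proof.
move=> ef [x Ix fx]; have [U1 U2 _ h] := eigen_coef ef.
apply/eqP; rewrite -subr_eq0; apply/negPn/negP => nd.
move: (coef n f n%:Z) (coef n f (- n%:Z)) U1 U2 h => up um U1 U2 h.
have d1 : (zeta ^+ 2 - bp * bm) * up = 0.
  by rewrite mulrBl expr2 -mulrA U1 mulrCA U2; ring.
have d2 : (zeta ^+ 2 - bp * bm) * um = 0.
  by rewrite mulrBl expr2 -mulrA U2 mulrCA U1; ring.
move: d1 d2 => /eqP; rewrite mulf_eq0 (negPf nd) /= => /eqP u1 /eqP.
rewrite mulf_eq0 (negPf nd) /= => /eqP u2.
by move: fx; rewrite h ?eqxx.
Qed.

Lemma jordan_bound f g : jordan_pair v n lam f g -> 8 * C ^+ 2 * (24 / Num.sqrt n%:R) <= 1 / 6 ->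
  cmod zeta <= 8 * C ^+ 2 * (24 / Num.sqrt n%:R) * (cmod bp + cmod bm).
Proof.
move=> [[f1 [df tf tf1]] eg [x Ix gx]] t6; have [U1 U2 UW U0] := eigen_coef eg.
have Ig := eigenfunction_integrable eg.
set e := 24 / _ in t6 *.
set up := coef n g n%:Z in U1 U2 UW U0; set um := coef n g (- n%:Z) in U1 U2 UW U0.
have u0 : 0 < cmod up + cmod um.
  rewrite lt_neqAle addr_ge0 ?cmod_ge0 // andbT eq_sym; apply/negP.
  rewrite paddr_eq0 ?cmod_ge0 // => /andP[/eqP/cmod_eq0 h1 /eqP/cmod_eq0 h2].
  by move: gx; rewrite (U0 h1 h2) ?eqxx.
have hE x' : I x' -> - g x' = (v x' * f x' - lam * f x' - g x') + lam * f x' - v x' * f x'.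
  by move=> _; ring.
pose H := 4 * C * (cmod up + cmod um) * e.
have Wt := weight_esum n0 zn.
have DH : (\esum_(j in setT) (cmod (W j * fourier (fun x => - g x) j))%:E <= H%:E)%E.
  apply: (@le_trans _ _ (\esum_(j in setT) (4 * C * (cmod up + cmod um) * cmod (W j))%:E)%E).
    apply: le_esum => j _; rewrite lee_fin (fourierN j Ig) mulrN cmodN.
    apply: le_trans (UW j); rewrite /coef; case: ifPn => // dj.
    by rewrite /weight /beta_index (negPf dj) /= !mul0r.
  have k0 : 0 <= 4 * C * (cmod up + cmod um) by rewrite !mulr_ge0 // ltW.
  rewrite esumZl //; [|by move=> j; exact: cmod_ge0|by apply: le_lt_trans Wt _; rewrite ltry].
  by rewrite /H [leRHS]EFinM lee_wpmul2l // lee_fin.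
have [r1 r2 _] := reduction Iv n0 zn VC Ce df tf tf1 hE DH.
rewrite (fourierN _ Ig) opprK in r1; rewrite (fourierN _ Ig) opprK in r2.
have eqp : fourier g n%:Z = up by rewrite /up /coef subrr dvdz0.
have eqm : fourier g (- n%:Z) = um by rewrite /um /coef dvd2_oppB.
rewrite eqp in r1; rewrite eqm in r2.
have HE : C * (2 * H) = 8 * C ^+ 2 * e * (cmod up + cmod um) by rewrite /H; ring.
rewrite HE in r1; rewrite HE in r2.
set wp := coef n f n%:Z in r1 r2; set wm := coef n f (- n%:Z) in r1 r2.
have E1 : zeta * wp - bp * wm = - up + (zeta * wp - bp * wm + up) by rewrite [RHS]addrC addrK.
have E2 : zeta * wm - bm * wp = - um + (zeta * wm - bm * wp + um) by rewrite [RHS]addrC addrK.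
exact: (jordan_aux U1 U2 u0 E1 E2 r1 r2 t6).
Qed.

(** An eigenfunction is determined by its coefficients at n and - n. Independent eigenfunctions
    therefore give two independent vectors in the kernel of the reduced matrix, which must be
    zero. *)
Lemma two_eigenfunctions f g : eigenfunction v n lam f -> eigenfunction v n lam g ->
  (exists2 x, I x & f x != 0) ->
  (forall k, ~ (forall x, I x -> g x + k * f x = 0)) -> [/\ zeta = 0, bp = 0 & bm = 0].
Proof.
move=> ef eg [x Ix fx] ind; have [F1 F2 _ F0] := eigen_coef ef; have [G1 G2 _ _] := eigen_coef eg.
have If := eigenfunction_integrable ef; have Ig := eigenfunction_integrable eg.
set cp := coef n f n%:Z in F1 F2 F0; set cm := coef n f (- n%:Z) in F1 F2 F0.
set dp := coef n g n%:Z in G1 G2; set dm := coef n g (- n%:Z) in G1 G2.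
have dk k : ~ (dp + k * cp = 0 /\ dm + k * cm = 0).
  move=> [h1 h2]; apply: (ind k) => x' Ix'.
  have [_ _ _] := eigen_coef (eigenfunction_lin k eg ef).
  by rewrite !coef_lin // => /(_ h1 h2 x' Ix').
have det : cp * dm - cm * dp != 0.
  apply/eqP => d0; have [cm0|cm0] := eqVneq cm 0.
    have cp0 : cp != 0 by apply: contraNneq fx => h; rewrite F0.
    apply: (dk (- dp / cp)); rewrite cm0 mulr0 addr0 !mulNr divfK // subrr; split=> //.
    move: d0; rewrite cm0 mul0r subr0 => /eqP; rewrite mulf_eq0 (negPf cp0) => /eqP //.
  apply: (dk (- dm / cm)); split; last by rewrite !mulNr divfK // subrr.
  apply: (mulfI cm0); rewrite mulr0 mulrDr (_ : cm * (- dm / cm * cp) = - (cp * dm)); last by field.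
  by rewrite -[RHS]oppr0 -d0 opprB.
have cancel0 (w : R[i]) : w * (cp * dm - cm * dp) = 0 -> w = 0.
  by move/eqP; rewrite mulf_eq0 (negPf det) orbF => /eqP.
split; apply: cancel0.
- have -> : zeta * (cp * dm - cm * dp) = (zeta * cp) * dm - cm * (zeta * dp) by ring.
  by rewrite F1 G1; ring.
- have -> : bp * (cp * dm - cm * dp) = cp * (bp * dm) - (bp * cm) * dp by ring.
  by rewrite -F1 -G1; ring.
- have -> : bm * (cp * dm - cm * dp) = (bm * cp) * dm - cm * (bm * dp) by ring.
  by rewrite -F2 -G2; ring.
Qed.

End RootFunctions.

(** * Comparison of the gaps *)

Section GapAlgebra.
Variable R : realType.
Variables (al bp bm : R[i] -> R[i]) (zp zm zn : R[i]) (t k : R).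
Let zs := (zp + zm) / 2.
Let ze z := z - al z.
Let B z := cmod (bp z) + cmod (bm z).
(** The Lipschitz bounds hold only inside the disc, so they are demanded just at the four points
    that the argument compares. *)
Let near z := z \in [:: zp; zm; zn; zs].
Hypotheses (t0 : 0 <= t) (t1 : t <= 1 / 100) (k0 : 0 <= k) (k1 : k <= 1 / 100).
Hypothesis la : forall z w, near z -> near w -> cmod (al z - al w) <= t * cmod (z - w).
Hypothesis lp : forall z w, near z -> near w -> cmod (bp z - bp w) <= t * cmod (z - w).
Hypothesis lm : forall z w, near z -> near w -> cmod (bm z - bm w) <= t * cmod (z - w).
Hypotheses (S1 : ze zp ^+ 2 = bp zp * bm zp) (S2 : ze zm ^+ 2 = bp zm * bm zm).
Hypothesis double : zp = zm -> cmod (ze zp) <= t * B zp.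
Hypothesis neu : cmod (2 * ze zn - bp zn - bm zn) <= k * (cmod (ze zn) + B zn).

Let g := cmod (zp - zm).
Let d := cmod (zp - zn).

Let np : near zp. Proof. by rewrite /near !inE eqxx. Qed.
Let nm : near zm. Proof. by rewrite /near !inE eqxx orbT. Qed.
Let nn : near zn. Proof. by rewrite /near !inE eqxx !orbT. Qed.
Let ns : near zs. Proof. by rewrite /near !inE eqxx !orbT. Qed.
Let B0 z : 0 <= B z. Proof. by rewrite addr_ge0 ?cmod_ge0. Qed.
Let g0 : 0 <= g. Proof. exact: cmod_ge0. Qed.
Let d0 : 0 <= d. Proof. exact: cmod_ge0. Qed.

Let BL z w : near z -> near w -> B z <= B w + 2 * (t * cmod (z - w)).
Proof.
move=> hz hw; have := lp hz hw; have := lm hz hw.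
have := cmod_triang (bp z) (bp w); have := cmod_triang (bm z) (bm w); rewrite /B; lra.
Qed.

Let c2 : cmod (2 : R[i]) = 2. Proof. exact: cmod_nat R 2. Qed.
Let c4 : cmod (4 : R[i]) = 4. Proof. exact: cmod_nat R 4. Qed.

Let half (w : R[i]) : cmod (w / 2) = cmod w / 2.
Proof. by rewrite cmodM cmodV c2. Qed.

Let sp : zs - zp = - ((zp - zm) / 2). Proof. by rewrite /zs; field. Qed.
Let sm : zs - zm = (zp - zm) / 2. Proof. by rewrite /zs; field. Qed.

Let BsBp : B zs <= B zp + t * g.
Proof. by have := BL ns np; rewrite sp cmodN half /g; lra. Qed.
Let BpBs : B zp <= B zs + t * g.
Proof. by have := BL np ns; rewrite cmodC sp cmodN half /g; lra. Qed.
Let BmBs : B zm <= B zs + t * g.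
Proof. by have := BL nm ns; rewrite cmodC sm half /g; lra. Qed.

Let tg : t * g <= 1 / 100 * g. Proof. exact: ler_wpM2r. Qed.
Let td : t * d <= 1 / 100 * d. Proof. exact: ler_wpM2r. Qed.
Let tg0 : 0 <= t * g. Proof. exact: mulr_ge0. Qed.
Let td0 : 0 <= t * d. Proof. exact: mulr_ge0. Qed.

Let sqr_le z : ze z ^+ 2 = bp z * bm z -> cmod (ze z) <= B z / 2.
Proof.
move=> h; have : cmod (ze z) ^+ 2 <= (B z / 2) ^+ 2.
  rewrite expr2 -cmodM -expr2 h cmodM /B; have := sqr_ge0 (cmod (bp z) - cmod (bm z)).
  move: (cmod _) (cmod _) => a b; rewrite !expr2; lra.
by rewrite ler_sqr ?nnegrE ?cmod_ge0 ?divr_ge0.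
Qed.

Let zep : cmod (ze zp) <= B zp / 2. Proof. exact: sqr_le. Qed.
Let zem : cmod (ze zm) <= B zm / 2. Proof. exact: sqr_le. Qed.

Let dze z w : near z -> near w -> cmod ((ze z - ze w) - (z - w)) <= t * cmod (z - w).
Proof.
move=> hz hw; have -> : ze z - ze w - (z - w) = - (al z - al w) by rewrite /ze; ring.
by rewrite cmodN; exact: la.
Qed.

Let tri z w : near z -> near w ->
  cmod (z - w) <= cmod (ze z - ze w) + t * cmod (z - w) /\
  cmod (ze z - ze w) <= cmod (z - w) + t * cmod (z - w).
Proof.
move=> hz hw; have h := dze hz hw; split; last first.
  by have := cmod_triang (ze z - ze w) (z - w); lra.
have := cmod_triang (z - w) (ze z - ze w); rewrite (cmodC (z - w)); lra.
Qed.

Let zen : cmod (ze zn) * (2 - k) <= (1 + k) * B zn.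
Proof.
have := cmod_triang (2 * ze zn) (bp zn + bm zn); have := cmodD (bp zn) (bm zn).
rewrite opprD addrA cmodM c2.
by move: neu; rewrite /B; lra.
Qed.

Let Bn : B zn <= B zp + 2 * (t * d).
Proof. by have := BL nn np; rewrite cmodC. Qed.

Let kz : 0 <= k * cmod (ze zn) /\ k * cmod (ze zn) <= 1 / 100 * cmod (ze zn).
Proof. by split; [rewrite mulr_ge0 ?cmod_ge0|rewrite ler_wpM2r ?cmod_ge0]. Qed.
Let kB : 0 <= k * B zn /\ k * B zn <= 1 / 100 * B zn.
Proof. by split; [rewrite mulr_ge0|rewrite ler_wpM2r]. Qed.

(** By the arithmetic-geometric mean inequality zeta^2 = beta^+ beta^- gives |zeta| <= B / 2 at both
    periodic eigenvalues, and the Neumann relation gives nearly the same at zn. Both gaps are close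
    to differences of such values. *)
Lemma gap_upper : g + d <= 19 * B zs.
Proof.
have h1 : g <= cmod (ze zp) + cmod (ze zm) + t * g.
  have [h _] := tri np nm; move: h; have := cmodB (ze zp) (ze zm); rewrite /g; lra.
have h2 : d <= cmod (ze zp) + cmod (ze zn) + t * d.
  have [h _] := tri np nn; move: h; have := cmodB (ze zp) (ze zn); rewrite /d; lra.
move: h1 h2 BpBs BmBs zep zem zen Bn kz kB tg td tg0 td0 (B0 zs) (B0 zn).
move: (cmod (ze zp)) (cmod (ze zm)) (cmod (ze zn)) (B zp) (B zm) (B zn) (B zs) g d => x1 x2 x3 x4 x5 x6 x7 x8 x9.
move=> h1 h2 h3 h4 h5 h6 h7 h8 [h9 h10] [h11 h12]; lra.
Qed.

Let sum_small : cmod (ze zp + ze zm) <= 3 * (t * (B zs + t * g)).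
Proof.
have ts : 0 <= t * (B zs + t * g) by rewrite mulr_ge0 // addr_ge0.
have [e|ne] := eqVneq zp zm.
  have ge : g = 0 by rewrite /g e subrr cmod0.
  have se : zs = zp by rewrite /zs -e; field.
  have dd := double e.
  rewrite -e; apply: le_trans (cmodD _ _) _.
  by move: ts; rewrite ge mulr0 addr0 se; lra.
have gp : 0 < g by rewrite cmod_gt0 // subr_eq0.
(* The increments on the right carry a factor t g, and |ze zp - ze zm| >= 99/100 g on the left, so g
   cancels. *)
have E : (ze zp + ze zm) * (ze zp - ze zm) = bp zp * (bm zp - bm zm) + bm zm * (bp zp - bp zm).
  have -> : (ze zp + ze zm) * (ze zp - ze zm) = ze zp ^+ 2 - ze zm ^+ 2 by ring.
  by rewrite S1 S2; ring.
have h1 : cmod (ze zp + ze zm) * cmod (ze zp - ze zm) <= t * g * (cmod (bp zp) + cmod (bm zm)).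
  rewrite -cmodM E; apply: le_trans (cmodD _ _) _; rewrite !cmodM mulrDr [leLHS](_ : _ =
    cmod (bm zp - bm zm) * cmod (bp zp) + cmod (bp zp - bp zm) * cmod (bm zm)); last by ring.
  by apply: lerD; apply: ler_wpM2r; rewrite ?cmod_ge0 //; [exact: lm|exact: lp].
have h2 : 99 / 100 * g <= cmod (ze zp - ze zm).
  by have [h _] := tri np nm; move: h tg; rewrite /g; lra.
have h3 : cmod (bp zp) + cmod (bm zm) <= 2 * (B zs + t * g).
  by have := cmod_ge0 (bm zp); have := cmod_ge0 (bp zm); move: BpBs BmBs; rewrite {1 3}/B; lra.
have h4 := ler_wpM2l (cmod_ge0 (ze zp + ze zm)) h2.
have h5 := ler_wpM2l tg0 h3.
rewrite -(ler_pM2r gp).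
have : 0 <= t * (B zs + t * g) * g by rewrite mulr_ge0.
move: h1 h4 h5; move: (cmod (ze zp + ze zm)) (cmod (bp zp) + _) (cmod (ze zp - _)) (B zs) g => x1 x2 x3 x4 x5.
lra.
Qed.

(** Sum and product determine both numbers: (bp - bm)^2 = (bp + bm)^2 - 4 zeta^2. *)
Let diag : B zp <= 2 * cmod (bp zp + bm zp) + 2 * cmod (ze zp).
Proof.
have h1 : cmod (bp zp - bm zp) <= cmod (bp zp + bm zp) + 2 * cmod (ze zp).
  rewrite -ler_sqr ?nnegrE ?addr_ge0 ?mulr_ge0 ?cmod_ge0 //.
  rewrite expr2 -cmodM (_ : _ * _ = (bp zp + bm zp) * (bp zp + bm zp) - 4 * (ze zp * ze zp)); last by rewrite -(expr2 (ze zp)) S1; ring.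
  apply: le_trans (cmodB _ _) _; rewrite !cmodM c4.
  have := cmod_ge0 (bp zp + bm zp); have := cmod_ge0 (ze zp).
  move: (cmod _) (cmod _) => a b a0 b0; have := mulr_ge0 a0 b0; rewrite sqrrD !expr2; lra.
have h2 : 2 * cmod (bp zp) <= cmod (bp zp + bm zp) + cmod (bp zp - bm zp).
  have := cmodD (bp zp + bm zp) (bp zp - bm zp).
  by rewrite (_ : _ + _ = 2 * bp zp) ?cmodM ?c2 //; ring.
have h3 : 2 * cmod (bm zp) <= cmod (bp zp + bm zp) + cmod (bp zp - bm zp).
  have := cmodB (bp zp + bm zp) (bp zp - bm zp).
  by rewrite (_ : _ - _ = 2 * bm zp) ?cmodM ?c2 //; ring.
rewrite /B; lra.
Qed.

(** For t = k = 0 the chain reads 2 |zeta^+| <= g, |zeta(nu)| <= |zeta^+| + d and |bp + bm| <= 2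
    |zeta(nu)|; with [diag] this gives B <= 3 g + 4 d. *)
Lemma gap_lower : B zs <= 80 * (g + d).
Proof.
have h1 : 2 * cmod (ze zp) <= g + t * g + cmod (ze zp + ze zm).
  have [_ h] := tri np nm; have := cmodD (ze zp + ze zm) (ze zp - ze zm).
  rewrite (_ : _ + _ = 2 * ze zp); last by ring.
  by rewrite cmodM c2; move: h; rewrite /g; lra.
have h2 : cmod (ze zn) <= cmod (ze zp) + d + t * d.
  have [_ h] := tri np nn; have := cmod_triang (ze zn) (ze zp).
  by rewrite (cmodC (ze zn)); move: h; rewrite /d; lra.
have h3 : cmod (bp zp + bm zp) <= 2 * cmod (ze zn) + k * cmod (ze zn) + k * B zn + 2 * (t * d).
  have p1 := lp np nn; have p2 := lm np nn.
  have := cmod_triang (bp zp + bm zp) (bp zn + bm zn).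
  have -> : bp zp + bm zp - (bp zn + bm zn) = (bp zp - bp zn) + (bm zp - bm zn) by ring.
  have := cmodD (bp zp - bp zn) (bm zp - bm zn).
  have := cmod_triang (bp zn + bm zn) (2 * ze zn).
  rewrite (cmodC (bp zn + bm zn)) opprD addrA cmodM c2.
  by move: neu; rewrite /d; lra.
have tBs : t * (B zs + t * g) <= 1 / 100 * (B zs + t * g) by apply: ler_wpM2r => //; exact: addr_ge0.
move: h1 h2 h3 diag sum_small tBs BsBp Bn kz kB tg td tg0 td0 (B0 zs) (B0 zn).
move: (cmod (ze zp)) (cmod (ze zn)) (cmod (bp zp + _)) (cmod (ze zp + _)) (B zp) (B zn) (B zs) g d => x1 x2 x3 x4 x5 x6 x7 x8 x9.
move=> h1 h2 h3 h4 h5 h6 h7 h8 [h9 h10] [h11 h12]; lra.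
Qed.

End GapAlgebra.

(** * From algebraic multiplicities to the reduced equations, and the theorem *)

Section DiscEigenvalues.
Variable R : realType.
Local Notation mu := (@lebesgue_measure R).
Local Notation I := (@I0pi R).
Implicit Types (f g v : R -> R[i]).

Lemma nonzero_eigenfunction v bc lam k f : in_ker_pow v bc lam k f -> (exists2 x, I x & f x != 0) ->
  exists p q, [/\ hill_op v bc p q, forall x, I x -> q x = lam * p x & exists2 x, I x & p x != 0].
Proof.
elim: k f => [|k IH] f /=; first by move=> f0 [x Ix]; rewrite f0 ?eqxx.
move=> [g [hg hk]] fn; have [h|h] := zero_or_not (fun x => g x - lam * f x); last exact: IH hk h.
by exists f, g; split=> // x Ix; apply/eqP; rewrite -subr_eq0 h.
Qed.

Lemma alg_mult_root v bc lam m : alg_mult v bc lam m.+1 ->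
  exists k f, in_ker_pow v bc lam k f /\ exists2 x, I x & f x != 0.
Proof.
move=> [e [re ind _]]; have [k hk] := re ord0; exists k, (e ord0); split=> //.
have [h|//] := zero_or_not (e ord0).
have := ind (fun i => (i == ord0)%:R) _ ord0; rewrite eqxx => /(_ _)/eqP; rewrite oner_eq0.
suff H x : I x -> \sum_(i < m.+1) (i == ord0)%:R * e i x = 0 by move=> /(_ H).
move=> Ix; rewrite big1 // => i _; have [->|_] := eqVneq i ord0; last by rewrite mul0r.
by rewrite mul1r h.
Qed.

Lemma alg_mult_two v bc lam : alg_mult v bc lam 2 ->
  exists k l f g, [/\ in_ker_pow v bc lam k f, in_ker_pow v bc lam l g, exists2 x, I x & f x != 0 &
    forall c, ~ (forall x, I x -> g x + c * f x = 0)].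
Proof.
move=> [e [re ind _]]; have [k hk] := re ord0; have [l hl] := re ord_max.
exists k, l, (e ord0), (e ord_max); split=> //.
  have [h|//] := zero_or_not (e ord0).
  have := ind (fun i => (i == ord0)%:R) _ ord0; rewrite eqxx => H.
  have /eqP : (1 : R[i]) = 0 by apply: H => x Ix; rewrite big_ord_recl big_ord1 /= mul1r mul0r addr0 h.
  by rewrite oner_eq0.
move=> c h; have := ind (fun i => if i == ord0 then c else 1) _ ord_max => /= H.
have /eqP : (1 : R[i]) = 0.
  apply: H => x Ix; rewrite big_ord_recl big_ord1 /= mul1r addrC.
  by rewrite -[RHS](h x Ix); congr (e _ x + _); apply: val_inj.
by rewrite oner_eq0.
Qed.

Variables (v : R -> R[i]) (n : nat).
Local Notation A := (Rintegral mu I (fun x => cmod (v x))).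
Local Notation e := (24 / Num.sqrt (n%:R : R)).
Local Notation t := (8 * A ^+ 2 * e).
Hypotheses (Iv : cintegrable I v) (n0 : (0 < n)%N).
Hypothesis Ce : A * e <= 1 / 2.
Hypothesis t1 : t <= 1 / 100.

Let VC := fourier_v_le Iv.

Lemma periodic_det z m : cmod z < n%:R / 4 -> alg_mult v (per_bc n) ((n ^ 2)%:R + z) m.+1 ->
  (z - alpha v n z) ^+ 2 = beta_plus v n z * beta_minus v n z.
Proof.
move=> zn /alg_mult_root[k [f [hk fn]]].
have [p [q [hpq qE pn]]] := nonzero_eigenfunction hk fn.
have [p1 [dp /per_bc_twisted[tp tp1] _]] := hill_op_data Iv hpq.
apply: (eigen_det Iv n0 zn VC Ce (f := p)) => //.
exists p1; split=> //; apply: hill_data_eq dp => x Ix.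
by rewrite qE.
Qed.

(** Replaces the division by gamma when gamma = 0: two independent root functions either reveal a
    Jordan pair or are both eigenfunctions, in which case zeta vanishes. *)
Lemma periodic_double z : cmod z < n%:R / 4 -> alg_mult v (per_bc n) ((n ^ 2)%:R + z) 2 ->
  cmod (z - alpha v n z) <= t * (cmod (beta_plus v n z) + cmod (beta_minus v n z)).
Proof.
move=> zn /alg_mult_two[k [l [f [g [hk hl fn ind]]]]].
have t6 : t <= 1 / 6 by apply: (le_trans t1); lra.
have e0 : 0 <= e by exact: (divr_ge0 (ler0n R 24) (sqrtr_ge0 _)).
have t0 : 0 <= t by exact: (mulr_ge0 (mulr_ge0 (ler0n R 8) (sqr_ge0 _)) e0).
have jb p q : jordan_pair v n ((n ^ 2)%:R + z) p q ->
    cmod (z - alpha v n z) <= t * (cmod (beta_plus v n z) + cmod (beta_minus v n z)).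
  by move=> jp; exact: (jordan_bound Iv n0 zn VC Ce jp t6).
have [h|ef|[p [q /jb //]]] := root_function_cases Iv hk.
  by move: fn => [x Ix]; rewrite h ?eqxx.
have [h|eg|[p [q /jb //]]] := root_function_cases Iv hl.
  by exfalso; apply: (ind 0) => x Ix; rewrite h // mul0r addr0.
have [-> _ _] := two_eigenfunctions Iv n0 zn VC Ce ef eg fn ind.
by rewrite cmod0 mulr_ge0 // addr_ge0 ?cmod_ge0.
Qed.

Lemma neumann_close z : 5000 * (A + 1) <= n%:R -> cmod z < n%:R / 4 ->
  alg_mult v Neu ((n ^ 2)%:R + z) 1 ->
  n%:R * cmod (2 * (z - alpha v n z) - beta_plus v n z - beta_minus v n z) <=
  (64 * (151 * A) + 8 * (1200 * A)) *
    (cmod (z - alpha v n z) + cmod (beta_plus v n z) + cmod (beta_minus v n z)).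
Proof.
move=> nA zn /alg_mult_root[k [f [hk fn]]].
have [p [q [hpq qE pn]]] := nonzero_eigenfunction hk fn.
have [p1 [dp [b0 bpi] _]] := hill_op_data Iv hpq.
apply: (neumann_symmetry Iv n0 zn _ b0 bpi pn nA Ce).
apply: hill_data_eq dp => x Ix.
by rewrite qE.
Qed.

Lemma functional_lip (b a : int) z w : cmod z < n%:R / 4 -> cmod w < n%:R / 4 ->
  cmod (resolvent (fourier v) (weight n z) b a - resolvent (fourier v) (weight n w) b a) <=
  t * cmod (z - w).
Proof.
move=> hz hw.
have h := resolvent_lip VC b a (weight_esum n0 hz) (weight_esum n0 hw) (weight_lip_esum n0 hz hw) Ce.
apply: le_trans h _; rewrite le_eqVlt; apply/orP; left; apply/eqP.
by move: (Num.sqrt _)^-1 => s; ring.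
Qed.

End DiscEigenvalues.

Lemma large_index (R : realType) (a K : R) : 0 <= a -> 0 <= K ->
  exists N : nat, forall n : nat, (N <= n)%N ->
    [/\ (0 < n)%N, a * (24 / Num.sqrt n%:R) <= 1 / 2,
        8 * a ^+ 2 * (24 / Num.sqrt n%:R) <= 1 / 100, 5000 * (a + 1) <= n%:R &
        K / n%:R <= 1 / 100].
Proof.
(* The two conditions on sqrt n follow from sqrt n >= M, whose summands are the two thresholds; Q
   adds the thresholds on n itself. *)
move=> a0 K0; pose M := 2 * (a * 24) + 100 * (8 * a ^+ 2 * 24).
have M0 : 0 <= M by rewrite addr_ge0 // !mulr_ge0 // sqr_ge0.
pose Q := M ^+ 2 + 5000 * (a + 1) + 100 * K.
have q1 : 0 <= M ^+ 2 by exact: sqr_ge0.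
have q2 : 1 <= 5000 * (a + 1) by lra.
have q3 : 0 <= 100 * K by rewrite mulr_ge0.
exists (Num.bound Q) => n Nn.
have Qn : Q < n%:R.
  have Q0 : 0 <= Q by rewrite /Q; move: (M ^+ 2) (5000 * _) (100 * K) q1 q2 q3 => *; lra.
  by apply: lt_le_trans (archi_boundP Q0) _; rewrite ler_nat.
have [n1 n2 n3] : [/\ M ^+ 2 <= n%:R, 5000 * (a + 1) <= n%:R & 100 * K <= n%:R].
  by move: Qn; rewrite /Q; move: (M ^+ 2) (5000 * _) (100 * K) q1 q2 q3 => *; split; lra.
have np : 0 < n%:R :> R by apply: lt_le_trans n2; apply: lt_le_trans q2.
have sp : 0 < Num.sqrt n%:R :> R by rewrite sqrtr_gt0.
have Ms : M <= Num.sqrt n%:R by rewrite -(ger0_norm M0) -sqrtr_sqr ler_wsqrtr.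
have a2 : 0 <= 8 * a ^+ 2 * 24 by rewrite !mulr_ge0 // sqr_ge0.
have a1 : 0 <= a * 24 by rewrite mulr_ge0.
split=> //.
- by rewrite -(ltr0n R).
- by rewrite mulrA ler_pdivrMr //; move: Ms; rewrite /M; lra.
- by rewrite mulrA ler_pdivrMr //; move: Ms; rewrite /M; lra.
- by rewrite ler_pdivrMr //; lra.
Qed.

Theorem theorem3 (R : realType) (p : R) (v : R -> R[i])
    (hp : 1 < p) (hv : in_Lp p v) :
  exists N : nat, forall n : nat, (N <= n)%N ->
  forall lm lp nu : R[i],
    per_eigenvalues v n lm lp -> neu_eigenvalue v n nu ->
    let gamma := lp - lm in
    let delta := lp - nu in
    let zstar := (lp + lm) / 2 - (n ^ 2)%:R in
    let B := cmod (beta_plus v n zstar) + cmod (beta_minus v n zstar) in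
    1 / 80 * B <= cmod gamma + cmod delta /\
    cmod gamma + cmod delta <= 19 * B.
Proof.
have Iv := in_Lp_cintegrable (ltW hp) hv; have A0 := norm_v_ge0 v.
set A := Rintegral _ _ _ in A0.
have K0 : 0 <= 64 * (151 * A) + 8 * (1200 * A).
  by move: A A0 => a a0; lra.
have [N hN] := large_index A0 K0; exists N => n Nn lm lp nu [dm dp mult _] [dn multn].
have [n0 Ce t1 nA k1] := hN n Nn.
have := mult lm dm; have := mult lp dp; have := multn nu dn; rewrite !eqxx.
rewrite /in_disc in dm dp dn.
have lE (l : R[i]) : l = (n ^ 2)%:R + (l - (n ^ 2)%:R) by rewrite addrC subrK.
rewrite {1}(lE nu) => Mn Mp Mm gamma delta zstar B.
set zp := lp - (n ^ 2)%:R in dp; set zm := lm - (n ^ 2)%:R in dm; set zn := nu - (n ^ 2)%:R in dn Mn.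
have zsE : zstar = (zp + zm) / 2 by rewrite /zstar /zp /zm; field.
have gE : gamma = zp - zm by rewrite /gamma /zp /zm; ring.
have dE : delta = zp - zn by rewrite /delta /zp /zn; ring.
have ds : cmod zstar < n%:R / 4.
  have c2 : cmod (2 : R[i]) = 2 by exact: cmod_nat R 2.
  rewrite zsE cmodM cmodV c2; have := cmodD zp zm; lra.
have nP : (0 : R) < n%:R by rewrite ltr0n.
pose near z := z \in [:: zp; zm; zn; (zp + zm) / 2].
have nd z : near z -> cmod z < n%:R / 4.
  by rewrite /near !inE => /or4P[] /eqP ->; rewrite -?zsE.
have VC := fourier_v_le Iv.
have bpE z : near z -> beta_plus v n z = resolvent (fourier v) (weight n z) (- n%:Z) n%:Z.
  by move=> h; exact: (beta_plusE n0 (nd z h) VC Ce).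
have bmE z : near z -> beta_minus v n z = resolvent (fourier v) (weight n z) n%:Z (- n%:Z).
  by move=> h; exact: (beta_minusE n0 (nd z h) VC Ce).
have la z w : near z -> near w ->
    cmod (alpha v n z - alpha v n w) <= 8 * A ^+ 2 * (24 / Num.sqrt n%:R) * cmod (z - w).
  by move=> hz hw; exact: (functional_lip Iv n0 Ce _ _ (nd z hz) (nd w hw)).
have lbp z w : near z -> near w ->
    cmod (beta_plus v n z - beta_plus v n w) <= 8 * A ^+ 2 * (24 / Num.sqrt n%:R) * cmod (z - w).
  by move=> hz hw; rewrite !bpE //; exact: (functional_lip Iv n0 Ce _ _ (nd z hz) (nd w hw)).
have lbm z w : near z -> near w ->
    cmod (beta_minus v n z - beta_minus v n w) <= 8 * A ^+ 2 * (24 / Num.sqrt n%:R) * cmod (z - w).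
  by move=> hz hw; rewrite !bmE //; exact: (functional_lip Iv n0 Ce _ _ (nd z hz) (nd w hw)).
have S1 : (zp - alpha v n zp) ^+ 2 = beta_plus v n zp * beta_minus v n zp.
  (* The multiplicity of lp is [(lp == lm) + 1], a successor whether or not the two eigenvalues
     coincide. *)
  apply: (periodic_det Iv n0 Ce (m := (lp == lm)) dp).
  by rewrite -lE -addn1.
have S2 : (zm - alpha v n zm) ^+ 2 = beta_plus v n zm * beta_minus v n zm.
  apply: (periodic_det Iv n0 Ce (m := (lm == lp)) dm).
  by rewrite -lE.
have dbl : zp = zm -> cmod (zp - alpha v n zp) <=
    8 * A ^+ 2 * (24 / Num.sqrt n%:R) * (cmod (beta_plus v n zp) + cmod (beta_minus v n zp)).
  move=> e; have eq : lp = lm by rewrite (lE lp) (lE lm) -/zp -/zm e.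
  apply: (periodic_double Iv n0 Ce t1 dp); rewrite -lE.
  by move: Mp; rewrite eq eqxx.
have neu : cmod (2 * (zn - alpha v n zn) - beta_plus v n zn - beta_minus v n zn) <=
    (64 * (151 * A) + 8 * (1200 * A)) / n%:R *
    (cmod (zn - alpha v n zn) + (cmod (beta_plus v n zn) + cmod (beta_minus v n zn))).
  have := neumann_close Iv n0 Ce nA dn Mn.
  rewrite -/A; move: (64 * (151 * A) + 8 * (1200 * A)) => K h.
  by rewrite mulrAC ler_pdivlMr // mulrC addrA.
have t0 : 0 <= 8 * A ^+ 2 * (24 / Num.sqrt n%:R).
  exact: (mulr_ge0 (mulr_ge0 (ler0n R 8) (sqr_ge0 _)) (divr_ge0 (ler0n R 24) (sqrtr_ge0 _))).
have k0 : 0 <= (64 * (151 * A) + 8 * (1200 * A)) / n%:R by exact: (divr_ge0 K0 (ltW nP)).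
have low := gap_lower t0 t1 k0 k1 la lbp lbm S1 S2 dbl neu.
have up := gap_upper t0 t1 k0 k1 la lbp lbm S1 S2 neu.
rewrite gE dE /B zsE; split; last exact: up.
by rewrite mul1r ler_pdivrMl.
Qed.
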